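(* Let $0<K\leq 2$ be arbitrary. There exists an analytic orientation-preserving diffeomorphism $f$ of $\mathbb{S}^1$ with the following properties: (i) $f$ has a single fixed point $x_0$, and $f'(x_0)=1$ and $f''(x_0)=0$; (ii) $\int_{\mathbb{S}^1}|f''|\leq 2K$; and (iii) $f$ is $C^{1+AC}$-undistorted.
   Context: $\mathbb{S}^1$ is $[0,1]$ with endpoints identified (i.e. $\mathbb{R}/\mathbb{Z}$); derivatives are taken in the standard coordinate. $\mathrm{Diff}_+^{1+AC}(\mathbb{S}^1)$ is the group (under composition) of orientation-preserving $C^1$ diffeomorphisms of $\mathbb{S}^1$ whose first derivative is absolutely continuous; it is a Polish group with topology given by the metric $\rho(f,g)=\sup_{x\in\mathbb{S}^1}|f(x)-g(x)|+\sup_{x\in\mathbb{S}^1}|f'(x)-g'(x)|+\int_{\mathbb{S}^1}|f''-g''|$ (where $|f(x)-g(x)|$ denotes distance in $\mathbb{S}^1$). A pseudometric $d$ on a topological group $G$ is maximal if it is continuous, right-invariant, and for every continuous right-invariant pseudometric $\sigma$ on $G$ there are constants $A,C$ with $\sigma\le A\cdot d+C$. Any two maximal pseudometrics on $G$ are quasi-isometrically equivalent; on $\mathrm{Diff}_+^{1+AC}(\mathbb{S}^1)$, $d(f,g)=\int_{\mathbb{S}^1}\left|\frac{f''}{f'}-\frac{g''}{g'}\right|$ is a maximal pseudometric. For $G$ with a maximal pseudometric $d$, an element $f\in G$ is distorted in $G$ if the inclusion $\langle f\rangle\hookrightarrow G$ is not a quasi-isometric embedding (with respect to a right-invariant Cayley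 metric on $\langle f\rangle$ and $d$ on $G$), and undistorted otherwise; this is independent of the choice of $d$. For non-torsion $f$, the limit $\lim_{n\to\infty} d(f^n,e)/n$ exists, and $f$ is distorted if and only if it equals $0$. A diffeomorphism $f$ is called $C^{1+AC}$-distorted if it is distorted in the Polish group $\mathrm{Diff}_+^{1+AC}(\mathbb{S}^1)$ or is a torsion element; otherwise it is $C^{1+AC}$-undistorted. *)

(* Defs.v *)
From HB Require Import structures.
From mathcomp Require Import all_boot all_order all_algebra.
From mathcomp Require Import all_classical all_reals all_analysis.
Set Implicit Arguments.
Unset Strict Implicit.
Unset Printing Implicit Defensive.
Import Order.TTheory GRing.Theory Num.Theory.
Import numFieldNormedType.Exports.
Local Open Scope classical_set_scope.
Local Open Scope ring_scope.

(* The circle R/Z, each class being given by its representative in [0, 1[. *)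
Definition circle (R : realType) := {x : R | 0 <= x < 1}.

Lemma frac_subproof (R : realType) (x : R) :
  0 <= x - (Num.floor x)%:~R < 1.
Proof.
by rewrite subr_ge0 floor_le ltrBlDl -(intrD _ _ 1) floorD1_gt.
Qed.

Definition to_circle (R : realType) (x : R) : circle R :=
  exist _ (x - (Num.floor x)%:~R) (frac_subproof x).

Definition circle_dist (R : realType) (x y : circle R) : R :=
  Num.min `|sval x - sval y| (1 - `|sval x - sval y|).

Section circle_maps.
Variable R : realType.
Implicit Types (f g h : circle R -> circle R) (F : R -> R).

Definition is_lift F f :=
  continuous F /\ forall x, f (to_circle x) = to_circle (F x).

(* Two lifts differ by an integer constant, so that the derivatives below do
   not depend on the lift chosen here.  A map without lift is discontinuous
   and gets the default value. *)
Definition lift_of f : R -> R := xget (id : R -> R) [set F | is_lift F f].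

(* Derivatives in the standard coordinate, as 1-periodic functions on R.
   When f' is only absolutely continuous, f'' is meaningful almost
   everywhere. *)
Definition circle_deriv f : R -> R := derive1 (lift_of f).
Definition circle_deriv2 f : R -> R := derive1 (circle_deriv f).

Definition C1_fun F := (forall x, derivable F x 1) /\ continuous (derive1 F).

Definition analytic_fun F := forall x, exists a : nat -> R, exists2 r : R,
  0 < r & forall h : R, `|h| < r -> pseries a h @ \oo --> F (x + h).

Definition abs_continuous_on (u v : R) F :=
  forall e : R, 0 < e -> exists2 delta : R, 0 < delta &
    forall (n : nat) (a b : 'I_n -> R),
      (forall i, u <= a i /\ a i <= b i /\ b i <= v) ->
      trivIset setT (fun i => `]a i, b i[%classic) ->
      \sum_(i < n) (b i - a i) < delta ->
      \sum_(i < n) `|F (b i) - F (a i)| < e.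

(* Orientation-preserving bijections of the circle that, together with their
   inverse, belong to the regularity class P. *)
Definition op_diffeo (P : (R -> R) -> Prop) f :=
  exists g, exists F G : R -> R,
    [/\ cancel f g, cancel g f, is_lift F f & is_lift G g] /\
    [/\ {homo F : x y / x < y}, P F & P G].

Definition analytic_diffeo f := op_diffeo analytic_fun f.

Definition Diff1AC : set (circle R -> circle R) :=
  [set f | op_diffeo C1_fun f /\ abs_continuous_on 0 1 (circle_deriv f)].

Definition rho f g : R :=
  sup [set circle_dist (f x) (g x) | x in [set: circle R]] +
  sup [set `|circle_deriv f (sval x) - circle_deriv g (sval x)|
      | x in [set: circle R]] +
  \int[lebesgue_measure]_(x in `[0, 1])
    `|circle_deriv2 f x - circle_deriv2 g x|.

Definition circle_inv f : circle R -> circle R :=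
  xget (id : circle R -> circle R) [set g | cancel f g /\ cancel g f].

Definition circle_pow f (n : int) : circle R -> circle R :=
  match n with
  | Posz k => iter k f
  | Negz k => iter k.+1 (circle_inv f)
  end.

Definition torsion f := exists2 n : nat, (0 < n)%N & iter n f =1 id.

End circle_maps.

(* Pseudometrics on a group G of circle maps, topologized by a metric dG.  They
   are functions of two arbitrary maps of which only the values on G matter. *)
Section maximal_pseudometrics.
Variable R : realType.
Local Notation map := (circle R -> circle R).
Variables (G : set map) (dG : map -> map -> R).
Implicit Types (f g h : map) (d sigma : map -> map -> R).

Definition pseudometric_on d :=
  [/\ forall f, G f -> d f f = 0,
      forall f g, G f -> G g -> 0 <= d f g,
      forall f g, G f -> G g -> d f g = d g f &
      forall f g h, G f -> G g -> G h -> d f h <= d f g + d g h].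

Definition continuous_pseudometric d :=
  forall f g, G f -> G g -> forall e : R, 0 < e ->
    exists2 delta : R, 0 < delta & forall f' g', G f' -> G g' ->
      dG f f' < delta -> dG g g' < delta -> `|d f g - d f' g'| < e.

Definition right_invariant d :=
  forall f g h, G f -> G g -> G h -> d (f \o h) (g \o h) = d f g.

Definition admissible_pseudometric d :=
  [/\ pseudometric_on d, continuous_pseudometric d & right_invariant d].

Definition maximal_pseudometric d :=
  admissible_pseudometric d /\
  forall sigma, admissible_pseudometric sigma ->
    exists A C : R, forall f g, G f -> G g -> sigma f g <= A * d f g + C.

(* The right-invariant word metric of the cyclic group generated by f, for the
   generating set {f, f^-1}: the least |k| with g h^-1 = f^k. *)
Definition cayley_dist f g h : R :=
  inf [set `|k|%N%:R | k in [set k : int | circle_pow f k \o h = g]].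

Definition qi_embedded d f :=
  exists A C : R, [/\ 0 < A, 0 <= C & forall m n : int,
    let g := circle_pow f m in let h := circle_pow f n in
    A^-1 * cayley_dist f g h - C <= d g h /\
    d g h <= A * cayley_dist f g h + C].

(* Maximal pseudometrics are pairwise quasi-isometric, so one of them may be
   used as well as any other. *)
Definition distorted_in f :=
  exists2 d, maximal_pseudometric d & ~ qi_embedded d f.

End maximal_pseudometrics.

Definition C1AC_distorted (R : realType) (f : circle R -> circle R) :=
  distorted_in (@Diff1AC R) (@rho R) f \/ torsion f.

Definition C1AC_undistorted (R : realType) (f : circle R -> circle R) :=
  Diff1AC f /\ ~ C1AC_distorted f.

(* Main.v *)
From HB Require Import structures.
Require Import Defs.
From mathcomp Require Import all_boot all_order all_algebra.
From mathcomp Require Import all_classical all_reals all_analysis.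
From mathcomp Require Import measurable_realfun.
From mathcomp Require Import ring lra zify.
Import Order.TTheory GRing.Theory Num.Theory.
Import numFieldNormedType.Exports.
Set Implicit Arguments.
Unset Strict Implicit.
Unset Printing Implicit Defensive.
Local Open Scope classical_set_scope.
Local Open Scope ring_scope.

(** The total variation of [ln f' - ln g'] is a continuous right-invariant
    pseudometric, so every maximal pseudometric dominates it up to affine
    change, and it suffices to make the variation of [ln (f^n)'] grow linearly
    in [n].  Take the lift [F x = x + al * sin(pi x)^4 + be * sin(pi x)^(2k+2)].
    The first bump makes [0] the only fixed point and moves points near [1/2] by
    a definite amount.  The second one is so narrow that [(ln F')'] is small
    away from [1/2], while near [1/2] the function [ln F'] drops by at least
    [mu = K / 8] from [p] to [1 - p] although the integral of [|F''|] remains of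
    order [mu].  An interval [(p, 1 - p)] never meets its images, so along its
    orbit the drop of size [mu] is felt once and the other contributions are
    bounded by half of it; each of the [n] preimages of the interval hence
    contributes [mu / 2] to the variation of [ln (F^n)'].  Analyticity of [F]
    and of its inverse comes from polynomial ODEs with bounded solutions. *)

(** As the derivative at the fixed point is 1, growth cannot be read off there; it has to come from
    the orbits inside (0, 1). This dictates the order of the choices. With mu fixed, al bounds the
    second derivative of the wide bump by mu / 8, and points within theta = al / 8 of 1/2 then move
    by at least 4 theta. Only now is k taken so large that the narrow bump is negligible off this
    neighbourhood, which every orbit leaves in one step. Finally be divides by the maximal slope of
    the narrow bump, so that the drop does not depend on k. Off the neighbourhood |F''| <= mu / 4,
    and F' >= 1/2 makes [ln F'] there Lipschitz with constant mu / 2; disjoint intervals in [0, 1]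
    therefore contribute at most mu / 2 altogether.

    The analytic obstacle is the continuity of the pseudometric. [rho] only sees the integral of a
    [derive1] that is meaningful almost everywhere, so the variation of f' - g' has to be recovered
    from it, through Radon-Nikodym densities and Lebesgue differentiation. *)

(** * Finite families of intervals, and the variation of absolutely continuous functions *)

Definition disjoint_intervals (R : realType) (p q : R * R) :=
  (p.2 <= q.1) || (q.2 <= p.1).

(** A list in arbitrary order, whose intervals may touch or degenerate: one of them can then be
    replaced by a partition of itself, which is awkward for the indexed families of
    [abs_continuous_on]. *)
Definition interval_family (R : realType) (u v : R) (s : seq (R * R)) :=
  all (fun p => [&& u <= p.1, p.1 <= p.2 & p.2 <= v]) s && pairwise (@disjoint_intervals R) s.

Lemma variation_zip_pairs (R : realType) (a b : R) (f : R -> R) (s : seq R) :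
  variation a b f s = \sum_(p <- zip (a :: s) s) `|f p.2 - f p.1|.
Proof.
rewrite /variation; elim: s a => [|x s IH] a; first by rewrite big_nil big_nil.
rewrite big_nat_recl//= big_cons; congr (_ + _).
rewrite -IH; apply: eq_big_nat => i /andP[_ ilt] /=.
by [].
Qed.

Lemma interval_family_zip (R : realType) (a b : R) (s : seq R) :
  itv_partition a b s -> interval_family a b (zip (a :: s) s) /\
    \sum_(p <- zip (a :: s) s) (p.2 - p.1) = b - a.
Proof.
elim: s a => [|x s IH] a [/= +] /eqP.
  by move=> _ ->; rewrite big_nil subrr.
case/andP=> ax xs lb.
have [|/andP[fam pw] len] := IH x; first by split=> //; apply/eqP.
have xb : x <= b.
  rewrite -subr_ge0 -len big_seq; apply: sumr_ge0 => p /(allP fam)/and3P[_ + _].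
  by rewrite subr_ge0.
split; last by rewrite big_cons len/=; lra.
rewrite /interval_family /= lexx (ltW ax) xb /= pw andbT.
apply/andP; split; first last.
  apply: sub_all fam => p /and3P[xp _ _].
  by rewrite /disjoint_intervals/= xp.
apply: sub_all fam => p /and3P[xp -> ->]; rewrite !andbT.
exact: le_trans (ltW ax) xp.
Qed.

Lemma abs_continuous_on_seq (R : realType) (u v : R) (F : R -> R) :
  abs_continuous_on u v F -> forall e : R, 0 < e -> exists2 delta : R, 0 < delta &
    forall s, interval_family u v s -> \sum_(p <- s) (p.2 - p.1) < delta ->
      \sum_(p <- s) `|F p.2 - F p.1| < e.
Proof.
move=> acF e e0; have [delta d0 H] := acF e e0; exists delta => // s.
case/andP=> /allP fam /pairwiseP pw lens.
have key (i : 'I_(size s)) := fam _ (mem_nth (0, 0) (ltn_ord i)).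
have := H (size s) (fun i => (nth (0, 0) s i).1) (fun i => (nth (0, 0) s i).2).
rewrite !(big_nth (0, 0)) !big_mkord in lens *; apply => //.
  by move=> i; have /and3P[] := key i.
move=> i j _ _ [x [/= xi xj]]; apply: val_inj => /=.
move: xi xj; rewrite !in_itv/= => xi xj.
case: (ltngtP (i : nat) j) => // ij.
  have := pw (0, 0) _ _ (ltn_ord i) (ltn_ord j) ij.
  by clear ij; rewrite /disjoint_intervals => dij; exfalso; case/orP: dij; lra.
have := pw (0, 0) _ _ (ltn_ord j) (ltn_ord i) ij.
by clear ij; rewrite /disjoint_intervals => dij; exfalso; case/orP: dij; lra.
Qed.

Lemma interval_family_subdivide (R : realType) (u v : R) (p : R * R) s1 s2 :
  interval_family u v (p :: s2) -> interval_family p.1 p.2 s1 ->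
  interval_family u v (s1 ++ s2).
Proof.
rewrite /interval_family /= => /andP[/andP[/and3P[up p12 pv] a2] /andP[ap pw2]].
case/andP=> a1 pw1; rewrite all_cat a2 pairwise_cat pw1 pw2 !andbT /=.
apply/andP; split.
  by apply: sub_all a1 => q; lra.
apply/allrelP => x y xs1 ys2.
have := allP a1 _ xs1; have := allP ap _ ys2; rewrite /disjoint_intervals.
by move=> /orP[] ?  /and3P[? ? ?]; apply/orP; [left|right]; lra.
Qed.

(** Induction on [s1]: a partition of its head is moved to [s2], where plain increments are counted,
    and then the supremum over these partitions is taken. Subdivision preserves disjointness and
    total length, so the same e serves throughout. *)
Lemma sum_total_variation_le (R : realType) (u v : R) (F : R -> R) (e delta : R) :
  (forall s, interval_family u v s -> \sum_(p <- s) (p.2 - p.1) < delta ->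
      \sum_(p <- s) `|F p.2 - F p.1| < e) ->
  forall s1 s2, interval_family u v (s1 ++ s2) ->
    \sum_(p <- s1 ++ s2) (p.2 - p.1) < delta ->
    (\sum_(p <- s1) total_variation p.1 p.2 F
      + (\sum_(p <- s2) `|F p.2 - F p.1|)%:E <= e%:E)%E.
Proof.
move=> H; have disjC r1 r2 :
    allrel (@disjoint_intervals R) r1 r2 = allrel (@disjoint_intervals R) r2 r1.
  by rewrite allrelC; apply: eq_allrel => x y; exact: orbC.
elim=> [|p s1 IH] s2 fam len.
  by rewrite big_nil add0e lee_fin ltW// H.
have fam12 : interval_family u v (s1 ++ s2).
  by move: fam => /andP[/= /andP[_ a] /andP[_ b]]; apply/andP.
have len12 : \sum_(p <- s1 ++ s2) (p.2 - p.1) < delta.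
  apply: le_lt_trans len; rewrite big_cons lerDr subr_ge0.
  by move: fam => /andP[/= /andP[/and3P[]]].
(* Finiteness of the other terms lets them be moved to the right, leaving the supremum over
   partitions of p alone on the left. *)
have fin : (\sum_(p <- s1) total_variation p.1 p.2 F
    + (\sum_(p <- s2) `|F p.2 - F p.1|)%:E)%E \is a fin_num.
  rewrite ge0_fin_numE; first exact: le_lt_trans (IH _ fam12 len12) (ltry _).
  rewrite adde_ge0// ?lee_fin ?sumr_ge0//.
  move: fam12 => /andP[+ _]; rewrite all_cat => /andP[fam1 _].
  rewrite big_seq; apply: sume_ge0 => q /(allP fam1) /and3P[_ ? _].
  exact: total_variation_ge0.
rewrite big_cons -addeA -leeBrDr//.
apply: ge_ereal_sup => _ [_ [s ps <-] <-].
rewrite leeBrDr// addeCA -EFinD variation_zip_pairs -big_cat.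
have [fs lens] := interval_family_zip ps.
have eqs : perm_eq (s1 ++ zip (p.1 :: s) s ++ s2) (zip (p.1 :: s) s ++ (s1 ++ s2)).
  by rewrite perm_catCA.
apply: IH.
  have := @interval_family_subdivide _ u v p _ (s1 ++ s2) fam fs.
  rewrite /interval_family => /andP[a b]; apply/andP; split.
    by rewrite (perm_all _ eqs).
  move: b; rewrite !pairwise_cat !allrel_catr (disjC s1).
  by rewrite (disjC s1); move=> /and3P[/andP[-> ->] -> /and3P[-> -> ->]].
rewrite !big_cat/= lens; move: len; rewrite big_cons big_cat/=; lra.
Qed.

(** For e = 1, an interval shorter than the corresponding delta has variation at most 1, and [u, v]
    is cut into finitely many of these. *)
Lemma abs_continuous_on_bounded_variation (R : realType) (F : R -> R) (u v : R) :
  u <= v -> abs_continuous_on u v F -> bounded_variation u v F.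
Proof.
move=> uv /abs_continuous_on_seq/(_ 1 ltr01)[delta d0 H].
apply/bounded_variationP => //.
have small x y : u <= x -> x <= y -> y <= v -> y - x < delta ->
    total_variation x y F \is a fin_num.
  move=> ux xy yv yx.
  have := @sum_total_variation_le _ _ _ _ _ _ H [:: (x, y)] [::].
  rewrite cats0 !big_cons !big_nil /= addr0 !adde0 /interval_family/= ux xy yv.
  move=> /(_ isT yx) le1; rewrite ge0_fin_numE ?total_variation_ge0//.
  exact: le_lt_trans le1 (ltry _).
pose n := (Num.truncn ((v - u) / (delta / 2))).+1.
pose h := (v - u) / n%:R.
have n0 : 0 < n%:R :> R by rewrite ltr0n.
have h0 : 0 <= h by rewrite divr_ge0 ?subr_ge0// ltW.
have hd : h < delta.
  have : (v - u) / (delta / 2) < n%:R by rewrite /n; exact: truncnS_gt.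
  rewrite ltr_pdivrMr ?divr_gt0// => ?; rewrite ltr_pdivrMr//; nra.
suff : forall k, (k <= n)%N -> total_variation u (u + k%:R * h) F \is a fin_num.
  by move=> /(_ n (leqnn n)); rewrite mulrC divfK ?gt_eqF// addrC subrK.
elim=> [|k IH] kn; first by rewrite mul0r addr0 total_variationxx.
have step : u + k.+1%:R * h = u + k%:R * h + h by rewrite -natr1; ring.
rewrite (@total_variationD _ _ _ (u + k%:R * h)).
- rewrite fin_numD IH ?(ltnW kn)//= small//.
  + by rewrite lerDl mulr_ge0.
  + by rewrite step lerDl.
  + rewrite -lerBrDl -[leRHS](divfK (lt0r_neq0 n0)) mulrC -/h.
    by rewrite ler_wpM2l// ler_nat.
  + by rewrite step addrAC subrr add0r.
- by rewrite lerDl mulr_ge0.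
- by rewrite step lerDl.
Qed.

(** The last inequality is not strict: a total variation, being a supremum, inherits only this
    form. *)
Definition ac_seq (R : realType) (u v : R) (F : R -> R) :=
  forall e : R, 0 < e -> exists2 delta : R, 0 < delta &
    forall s, interval_family u v s -> \sum_(p <- s) (p.2 - p.1) < delta ->
      \sum_(p <- s) `|F p.2 - F p.1| <= e.

Lemma ac_seqB (R : realType) (u v : R) (F G : R -> R) :
  ac_seq u v F -> ac_seq u v G -> ac_seq u v (F \- G).
Proof.
move=> acF acG e e0.
have [d1 d10 H1] := acF _ (divr_gt0 e0 (ltr0n R 2)).
have [d2 d20 H2] := acG _ (divr_gt0 e0 (ltr0n R 2)).
exists (Num.min d1 d2); first by rewrite lt_min d10.
move=> s fam; rewrite lt_min => /andP[s1 s2].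
rewrite (splitr e); apply: le_trans (lerD (H1 _ fam s1) (H2 _ fam s2)).
rewrite -big_split/=; apply: ler_sum => p _.
have -> : F p.2 - G p.2 - (F p.1 - G p.1) = (F p.2 - F p.1) - (G p.2 - G p.1) by ring.
exact: ler_normB.
Qed.

(** An increment of the variation function is the total variation over the interval, so
    [sum_total_variation_le] with empty [s2] is the required estimate. *)
Lemma ac_seq_total_variation (R : realType) (u v : R) (F : R -> R) : u <= v ->
  abs_continuous_on u v F -> ac_seq u v (fun x => fine (total_variation u x F)).
Proof.
move=> uv acF e e0.
have bv : bounded_variation u v F by exact: abs_continuous_on_bounded_variation.
have fin x y : u <= x -> x <= y -> y <= v -> total_variation x y F \is a fin_num.
  move=> ux xy yv; apply/bounded_variationP => //.
  by apply: (@bounded_variationl _ _ _ v) => //; apply: bounded_variationr bv => //; exact: le_trans yv.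
have [delta d0 H] := abs_continuous_on_seq acF e0; exists delta => // s fam len.
have := @sum_total_variation_le _ _ _ _ _ _ H s [::].
rewrite cats0 big_nil adde0 => /(_ fam len); rewrite -lee_fin; apply: le_trans.
rewrite -sumEFin big_seq [leRHS]big_seq; apply: lee_sum => p ps.
have /and3P[up p12 pv] := allP (andP fam).1 _ ps.
rewrite (@total_variationD _ _ p.2 p.1)// fineD ?fin//; last exact: le_trans pv.
rewrite addrC addKr ger0_norm ?fine_ge0 ?total_variation_ge0//.
by rewrite fineK// fin.
Qed.

(** * Stieltjes measures and densities of absolutely continuous functions *)

Lemma lebesgue_stieltjes_measure_oc (R : realType) (F : cumulative R R) (a b : R) :
  a <= b -> lebesgue_stieltjes_measure F `]a, b]%classic = (F b - F a)%:E.
Proof.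
move=> ab; rewrite /lebesgue_stieltjes_measure/= /measure_extension/=.
rewrite measurable_mu_extE; last exact: is_ocitv.
rewrite [LHS](_ : _ = wlength F [set` `]a, b]%R])// wlength_itv /= lte_fin.
have [//|ba] := ltP a b.
have -> : a = b by apply/eqP; rewrite eq_le ab ba.
by rewrite subrr.
Qed.

(** Half-open intervals have Stieltjes measure F b - F a, and touching ones remain disjoint. *)
Local Notation oc_cover s := (\big[setU/set0]_(p <- s) `]p.1, p.2]%classic).

Lemma oc_coverP (R : realType) (s : seq (R * R)) (x : R) :
  oc_cover s x <-> exists2 p, p \in s & p.1 < x <= p.2.
Proof.
rewrite -bigcup_seq; split => [[p/= ps]|[p ps xp]]; first by rewrite in_itv/=; exists p.
by exists p => //=; rewrite in_itv.
Qed.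

Lemma lebesgue_measure_oc_cover (R : realType) (u v : R) (s : seq (R * R)) :
  interval_family u v s ->
  (@lebesgue_measure R (oc_cover s) = (\sum_(p <- s) (p.2 - p.1))%:E)%E.
Proof.
elim: s => [|p s IH]; first by rewrite !big_nil measure0.
move=> /andP[/= /andP[/and3P[up p12 pv] a] /andP[dp pw]].
rewrite !big_cons measureU//=.
- rewrite IH; last exact/andP.
  rewrite lebesgue_measure_itv/= lte_fin EFinD.
  congr (_ + _)%E; have [//|p21] := ltP p.1 p.2.
  by rewrite (_ : p.1 = p.2) ?subrr//; apply/eqP; rewrite eq_le p12.
- exact: bigsetU_measurable.
- apply/seteqP; split => // x [/=]; rewrite in_itv/= => xp.
  move=> /oc_coverP[q /(allP dp)]; rewrite /disjoint_intervals.
  by move=> /orP dpq xq; exfalso; case: dpq; lra.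
Qed.

Lemma stieltjes_oc_cover_le (R : realType) (F : cumulative R R) (u v : R)
    (s : seq (R * R)) : interval_family u v s ->
  (lebesgue_stieltjes_measure F (oc_cover s)
     <= (\sum_(p <- s) `|F p.2 - F p.1|)%:E)%E.
Proof.
elim: s => [|p s IH]; first by rewrite !big_nil measure0.
move=> /andP[/= /andP[/and3P[up p12 pv] a] /andP[dp pw]].
rewrite !big_cons; apply: (le_trans (measureU2 _ _ _)) => //=.
  exact: bigsetU_measurable.
rewrite EFinD leeD//; last by apply: IH; exact/andP.
by rewrite lebesgue_stieltjes_measure_oc// lee_fin ler_norm.
Qed.

(** For open U these finite families exhaust the part of U in ]0, 1] as n grows, and absolute
    continuity applies to each of them. *)
Definition dyadic_cells (R : realType) (U : set R) (n : nat) : seq (R * R) :=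
  [seq p <- [seq (j%:R / 2 ^+ n, j.+1%:R / 2 ^+ n) | j <- iota 0 (2 ^ n)]
     | `[< `]p.1, p.2]%classic `<=` U >]].

Lemma interval_family_dyadic_cells (R : realType) (U : set R) (n : nat) :
  interval_family 0 1 (dyadic_cells U n).
Proof.
have n0 : 0 < 2 ^+ n :> R by rewrite exprn_gt0.
apply/andP; split.
  apply/allP => p; rewrite mem_filter => /andP[_ /mapP[j]].
  rewrite mem_iota add0n => /= jn ->{p} /=; apply/and3P; split.
  - by rewrite divr_ge0// ltW.
  - by rewrite ler_pM2r ?invr_gt0// ler_nat.
  - by rewrite ler_pdivrMr// mul1r -natrX ler_nat.
apply: (subseq_pairwise (filter_subseq _ _)).
rewrite pairwise_map.
have : pairwise ltn (iota 0 (2 ^ n)) by rewrite -(sorted_pairwise ltn_trans) iota_ltn_sorted.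
apply: sub_pairwise => i j ij; rewrite /= /disjoint_intervals /=.
by rewrite ler_pM2r ?invr_gt0// ler_nat (ij : (i < j)%N).
Qed.

Lemma mem_dyadic_cells (R : realType) (U : set R) (n : nat) (x : R) :
  oc_cover (dyadic_cells U n) x <->
  exists j : nat, [/\ (j < 2 ^ n)%N, j%:R < x * 2 ^+ n <= j.+1%:R &
    `]j%:R / 2 ^+ n, j.+1%:R / 2 ^+ n]%classic `<=` U].
Proof.
have n0 : 0 < 2 ^+ n :> R by rewrite exprn_gt0.
rewrite oc_coverP; split.
  move=> [p]; rewrite mem_filter => /andP[/asboolP cellU /mapP[j]].
  rewrite mem_iota add0n => /= jn ep xp; subst p; exists j; split => //.
  by move: xp => /=; rewrite ltr_pdivrMr// ler_pdivlMr.
move=> [j [jn xj cellU]]; exists (j%:R / 2 ^+ n, j.+1%:R / 2 ^+ n).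
  rewrite mem_filter; apply/andP; split; first exact/asboolP.
  by apply/mapP; exists j => //; rewrite mem_iota.
by rewrite /= ltr_pdivrMr// ler_pdivlMr.
Qed.

Lemma dyadic_cells_nondecreasing (R : realType) (U : set R) :
  {homo (fun n => oc_cover (dyadic_cells U n)) : n m / (n <= m)%N >-> (n <= m)%O}.
Proof.
apply/nondecreasing_seqP => n; apply/subsetPset => x /mem_dyadic_cells[j [jn]].
have n0 : 0 < 2 ^+ n :> R by rewrite exprn_gt0.
move=> /andP[jx xj] cellU; apply/mem_dyadic_cells.
(* The half of the parent cell that contains x; the midpoint belongs to the left half, as cells are
   closed on the right. *)
pose j' := if 2 * (x * 2 ^+ n) <= j.*2.+1%:R then j.*2 else j.*2.+1.
have j2 : j.*2%:R = 2 * j%:R :> R by rewrite -muln2 natrM mulrC.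
have [j'l j'r] : (j.*2 <= j' /\ j' < j.*2.+2)%N.
  by rewrite /j'; case: ifP.
exists j'; split.
- rewrite expnS mul2n; apply: (leq_trans j'r).
  by rewrite -doubleS leq_double.
- rewrite exprS mulrCA; apply/andP; rewrite /j'.
  case: ifPn => [h|]; last rewrite -ltNge => h; split => //.
  + by rewrite j2 ltr_pM2l.
  + have -> : j.*2.+2%:R = 2 * j.+1%:R :> R by rewrite -doubleS -muln2 natrM mulrC.
    by rewrite ler_pM2l.
- move=> y /=; rewrite in_itv/= => /andP[jy yj]; apply: cellU; rewrite /= in_itv/=.
  rewrite exprS in jy yj.
  have e (k : nat) : k%:R / (2 * 2 ^+ n) = k%:R / 2 / 2 ^+ n :> R by rewrite invfM mulrA.
  rewrite !e in jy yj; apply/andP; split.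
    apply: le_lt_trans jy; rewrite ler_pM2r ?invr_gt0// ler_pdivlMr//.
    by rewrite mulrC -j2 ler_nat.
  apply: (le_trans yj); rewrite ler_pM2r ?invr_gt0// ler_pdivrMr// mulrC.
  have -> : 2 * j.+1%:R = j.*2.+2%:R :> R by rewrite -doubleS -muln2 natrM mulrC.
  by rewrite ler_nat.
Qed.

Lemma open_sub_dyadic_cells (R : realType) (U : set R) : open U ->
  U `&` `]0, 1]%classic `<=` \bigcup_n oc_cover (dyadic_cells U n).
Proof.
move=> oU x [Ux /=]; rewrite in_itv/= => /andP[x0 x1].
have /nbhs_ballP[/= r r0 rU] : nbhs x U by exact: open_nbhs_nbhs.
pose n := Num.bound r^-1; exists n => //.
have n0 : 0 < 2 ^+ n :> R by rewrite exprn_gt0.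
have rn : (2 ^+ n)^-1 < r.
  rewrite -[ltRHS]invrK ltf_pV2 ?posrE ?invr_gt0//.
  exact: (upper_nthrootP (leqnn _)).
pose y := x * 2 ^+ n.
have y0 : 0 < y by rewrite mulr_gt0.
(* Ceiling minus 1 instead of the floor, because cells are open on the left. *)
pose j := `|Num.ceil y - 1|%N.
have jE : j%:R = (Num.ceil y)%:~R - 1 :> R.
  rewrite /j natr_absz ger0_norm ?intrB//.
  by rewrite subr_ge0 -gtz0_ge1 ceil_gt0.
have jy : j%:R < y <= j%:R + 1.
  by rewrite jE subrK -[_ - 1](intrB _ _ 1); exact: ceil_itv.
apply/mem_dyadic_cells; exists j; split.
- rewrite -(ltr_nat R) natrX; apply: lt_le_trans (_ : y <= _).
    by case/andP: jy.
  by rewrite /y ger_pMl.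
- by rewrite -[j.+1%:R]natr1.
- move=> z /=; rewrite in_itv/= => zj; apply: rU; rewrite /ball/=.
  apply: le_lt_trans rn.
  have : j%:R < z * 2 ^+ n <= j%:R + 1.
    by move: zj; rewrite ltr_pdivrMr// ler_pdivlMr// natr1.
  rewrite -[X in _ -> _ <= X]mul1r ler_pdivlMr// -[X in `|_| * X](gtr0_norm n0).
  rewrite -normrM mulrBl -/y ler_norml; move: jy; lra.
Qed.

(** Continuity from below along the dyadic exhaustion: each stage is an interval family of total
    length below delta, so its Stieltjes measure is at most e. *)
Lemma stieltjes_open_le (R : realType) (F : cumulative R R) (U : set R)
    (e delta : R) : open U -> (@lebesgue_measure R U < delta%:E)%E ->
  (forall s, interval_family 0 1 s -> \sum_(p <- s) (p.2 - p.1) < delta ->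
     \sum_(p <- s) `|F p.2 - F p.1| <= e) ->
  (lebesgue_stieltjes_measure F (U `&` `]0%R, 1%R]%classic) <= e%:E)%E.
Proof.
move=> oU Ud H.
have mV n : measurable (oc_cover (dyadic_cells U n)) by exact: bigsetU_measurable.
have mVV : measurable (\bigcup_n oc_cover (dyadic_cells U n)).
  exact: bigcupT_measurable.
apply: (@le_trans _ _ (lebesgue_stieltjes_measure F (\bigcup_n oc_cover (dyadic_cells U n)))).
  apply: le_measure; rewrite ?inE//; last exact: open_sub_dyadic_cells.
  by apply: measurableI => //; exact: open_measurable.
have := @nondecreasing_cvg_mu _ _ _ (lebesgue_stieltjes_measure F) _ mV mVV
  (@dyadic_cells_nondecreasing R U).
move=> cvV; rewrite -(cvg_lim _ cvV)//.
apply: lime_le; first by apply/cvg_ex; eexists; exact: cvV.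
apply: nearW => n /=.
have fam := interval_family_dyadic_cells U n.
apply: le_trans (stieltjes_oc_cover_le F fam) _.
rewrite lee_fin; apply: H => //.
rewrite -lte_fin -(lebesgue_measure_oc_cover fam); apply: le_lt_trans Ud.
apply: le_measure; rewrite ?inE; [exact: mV|exact: open_measurable|].
move=> x /mem_dyadic_cells[j [_ xj cellU]]; apply: cellU => /=.
by rewrite in_itv/= ltr_pdivrMr// ler_pdivlMr.
Qed.

(** The Stieltjes measure of F on ]0, 1] is absolutely continuous with respect to Lebesgue measure,
    and g is its Radon-Nikodym derivative. *)
Lemma ac_nondecreasing_density (R : realType) (F : R -> R) :
  {in `[0, 1] &, nondecreasing F} -> ac_seq 0 1 F ->
  exists g : R -> R, (@lebesgue_measure R).-integrable setT (EFin \o g) /\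
    forall x, 0 <= x <= 1 ->
      \int[lebesgue_measure]_(t in `]0, x]) g t = F x - F 0.
Proof.
move=> ndF acF.
(* Clamping to [0, 1] extends F by constants to a nondecreasing function on the whole line, as a
   cumulative function has to be. *)
pose cl x : R := Num.max 0 (Num.min x 1).
have cl01 x : 0 <= cl x <= 1.
  by rewrite /cl le_max lexx /= ge_max ler01 ge_min lexx orbT.
have clid x : 0 <= x <= 1 -> cl x = x.
  by move=> /andP[x0 x1]; rewrite /cl (min_idPl x1) (max_idPr x0).
have clm x y : x <= y -> cl x <= cl y <= cl x + (y - x).
  rewrite /cl => xy; case: (leP x 1) => ?; case: (leP y 1) => ?;
    case: (leP 0 x) => ?; case: (leP 0 y) => ?; case: (leP (0 : R) 1) => ?; lra.
pose Fc x := F (cl x).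
have nd : nondecreasing Fc.
  move=> x y /clm/andP[xy _]; apply: ndF => //; rewrite in_itv/=; exact: cl01.
have rc : right_continuous Fc.
  move=> x; apply/cvgrPdist_le => e e0.
  have [delta d0 H] := acF _ e0; near=> y.
  have xy : x < y by near: y; exact: nbhs_right_gt.
  have yx : y < x + delta by near: y; apply: nbhs_right_lt; rewrite ltrDl.
  have /andP[c1 c2] := clm _ _ (ltW xy).
  have := H [:: (cl x, cl y)]; rewrite !big_cons !big_nil /= !addr0 distrC; apply.
    rewrite /interval_family/= c1 !andbT.
    by have /andP[-> _] := cl01 x; have /andP[_ ->] := cl01 y.
  by move: c2 yx; lra.
pose Fm : cumulative R R := HB.pack Fc (isCumulative.Build R _ R Fc nd rc).
have Fm_ac s (e delta : R) : (forall s, interval_family 0 1 s -> \sum_(p <- s) (p.2 - p.1) < delta ->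
     \sum_(p <- s) `|F p.2 - F p.1| <= e) ->
     interval_family 0 1 s -> \sum_(p <- s) (p.2 - p.1) < delta ->
     \sum_(p <- s) `|Fm p.2 - Fm p.1| <= e.
  move=> H fam len; apply: le_trans (H _ fam len); rewrite big_seq [leRHS]big_seq.
  apply: ler_sum => p /(allP (andP fam).1) /and3P[p0 p12 p1].
  by rewrite /Fm/= /Fc !clid//; apply/andP; split => //; lra.
have fin : (lebesgue_stieltjes_measure Fm `]0%R, 1%R]%classic < +oo)%E.
  by rewrite lebesgue_stieltjes_measure_oc// ltry.
have m01 : measurable (`]0%R, 1%R]%classic : set (measurableTypeR R)).
  exact: measurable_itv.
pose nu : {finite_measure set (measurableTypeR R) -> \bar R} := mfrestr m01 fin.
have nuE B : nu B = lebesgue_stieltjes_measure Fm (B `&` `]0%R, 1%R]%classic) by [].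
(* By outer regularity a null set lies in an open set of measure below delta, whose Stieltjes
   measure is at most e; and e is arbitrary. *)
have dom : nu `<< @lebesgue_measure R.
  apply/null_content_dominatesP => A mA A0.
  apply/eqP; rewrite eq_le measure_ge0 andbT; apply/lee_addgt0Pr => e e0.
  rewrite add0e; have [delta d0 H] := acF _ e0.
  have [|U [oU AU UA]] := lebesgue_regularity_outer mA _ d0.
    by rewrite A0 ltry.
  apply: (@le_trans _ _ (lebesgue_stieltjes_measure Fm (U `&` `]0%R, 1%R]%classic))).
    rewrite nuE; apply: le_measure; rewrite ?inE; [exact: measurableI| |exact: setSI].
    by apply: measurableI => //; exact: open_measurable.
  apply: (stieltjes_open_le oU (delta := delta)); last by move=> s; exact: Fm_ac.
  rewrite -(setDUK AU) measureU//; first by rewrite A0 add0e.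
    by apply: measurableD => //; exact: open_measurable.
  by rewrite setDIK.
have [f [f0 ffin fint fE]] := @radon_nikodym_sigma_finite _ _ _ (@lebesgue_measure R) nu dom.
have fE' : EFin \o (fine \o f) = f by apply/funext => x /=; rewrite fineK.
exists (fine \o f); split; first by rewrite fE'.
move=> x /andP[x0 x1].
have := fE `]0, x]%classic (measurable_itv _).
rewrite nuE.
have -> : `]0, x]%classic `&` `]0, 1]%classic = `]0, x]%classic.
  apply/setIidPl => y /=; rewrite !in_itv/= => /andP[-> yx]/=.
  exact: le_trans yx x1.
rewrite lebesgue_stieltjes_measure_oc//= /Fc !clid ?lexx ?ler01 ?x0// => fEx.
rewrite /Rintegral; under eq_integral do rewrite fineK//.
by rewrite -fEx.
Unshelve. all: by end_near. Qed.

(** Jordan decomposition u = P - (P - u), where P is the variation function: both parts are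
    nondecreasing and absolutely continuous. *)
Lemma abs_continuous_on_density (R : realType) (u : R -> R) :
  abs_continuous_on 0 1 u ->
  exists g : R -> R, (@lebesgue_measure R).-integrable setT (EFin \o g) /\
    forall x, 0 <= x <= 1 ->
      \int[lebesgue_measure]_(t in `]0, x]) g t = u x - u 0.
Proof.
move=> acu.
have bv : bounded_variation 0 1 u by apply: abs_continuous_on_bounded_variation.
pose P x := fine (total_variation 0 x u).
have fin x y : 0 <= x -> x <= y -> y <= 1 -> total_variation x y u \is a fin_num.
  move=> ux xy yv; apply/bounded_variationP => //.
  by apply: (@bounded_variationl _ _ _ 1) => //; apply: bounded_variationr bv => //; exact: le_trans yv.
have PB x y : 0 <= x -> x <= y -> y <= 1 -> `|u y - u x| <= P y - P x.
  move=> x0 xy y1; rewrite -lee_fin /P (@total_variationD _ _ y x)//.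
  have x1 : x <= 1 by exact: le_trans y1.
  by rewrite fineD ?fin// addrAC subrr add0r fineK ?fin// total_variation_ge.
have acP : ac_seq 0 1 P by exact: ac_seq_total_variation.
have acN : ac_seq 0 1 (P \- u).
  apply: ac_seqB => // e e0.
  have [d d0 H] := abs_continuous_on_seq acu e0; exists d => // s s1 s2.
  exact/ltW/H.
have [||gP [iP gPE]] := @ac_nondecreasing_density _ P => //.
  move=> x y; rewrite !in_itv/= => /andP[x0 x1] /andP[y0 y1] xy.
  by rewrite -subr_ge0; apply: le_trans (PB _ _ x0 xy y1).
have [||gN [iN gNE]] := @ac_nondecreasing_density _ (P \- u) => //.
  move=> x y; rewrite !in_itv/= => /andP[x0 x1] /andP[y0 y1] xy /=.
  by have := PB _ _ x0 xy y1; rewrite ler_norml; lra.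
exists (gP \- gN); split.
  by rewrite (_ : _ \o _ = ((EFin \o gP) \- (EFin \o gN))%E)//; exact: integrableB.
move=> x x01; rewrite RintegralB//; [|exact: integrableS iP|exact: integrableS iN].
by rewrite gPE// gNE//=; ring.
Qed.

(** * Almost everywhere derivatives, and the variation of a difference bounded by an integral *)

Lemma derive_subr_cst (R : realType) (u : R -> R) (c x : R) :
  derivable (fun y => u y - c) x 1 -> 'D_1 u x = 'D_1 (fun y => u y - c) x.
Proof.
move=> du; have uE : u = (fun y => u y - c) + cst c.
  by apply/funext => y; rewrite !fctE subrK.
rewrite [LHS](_ : _ = 'D_1 ((fun y => u y - c) + cst c) x); last by rewrite -uE.
by rewrite (deriveD du (derivable_cst _ _ _)) derive_cst addr0.
Qed.

(** Lebesgue differentiation of the indefinite integral, which agrees with u - u 0 near every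
    interior point. *)
Lemma ae_derive1_density (R : realType) (u g : R -> R) :
  (@lebesgue_measure R).-integrable setT (EFin \o g) ->
  (forall x, 0 <= x <= 1 ->
      \int[lebesgue_measure]_(t in `]0, x]) g t = u x - u 0) ->
  {ae @lebesgue_measure R, forall x, 0 < x < 1 -> derive1 u x = g x}.
Proof.
move=> ig ug.
have lg : locally_integrable setT g.
  have := integrable_locally measurableT ig; by rewrite patch_setT.
have ig' y : (@lebesgue_measure R).-integrable [set` Interval (BRight 0) (BRight y)] (EFin \o g).
  exact: integrableS ig.
have := FTC1 ig' lg; apply: filterS; first exact: (ae_filter_ringOfSetsType (@lebesgue_measure R)).
move=> x H /andP[x0 x1].
have /H[dG <-] : (BRight (0 : R) < BRight x)%O by rewrite bnd_simp.
rewrite !derive1E; pose w y := u y - u 0.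
have near1 : \forall y \near x, \int[lebesgue_measure]_(t in `]0, y]) g t = w y.
  near=> y; apply: ug; apply/andP; split; apply/ltW; near: y.
    exact: lt_nbhsr.
  exact: lt_nbhsl.
apply/esym; rewrite (near_eq_derive _ near1).
exact/esym/derive_subr_cst/(near_eq_derivable near1 dG).
Unshelve. all: by end_near. Qed.

(** The integral of a nonnegative function is a supremum over the simple functions below it, and
    this supremum is monotone for arbitrary functions. *)
Lemma le_ge0_integral (R : realType) d (T : measurableType d)
    (mu : {measure set T -> \bar R}) (D : set T) (f g : T -> \bar R) :
  (forall x, D x -> 0 <= f x)%E -> (forall x, D x -> f x <= g x)%E ->
  (\int[mu]_(x in D) f x <= \int[mu]_(x in D) g x)%E.
Proof.
move=> f0 fg; rewrite integral_mkcond [leRHS]integral_mkcond.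
have fD0 x : (0 <= (f \_ D) x)%E by rewrite patchE; case: ifPn => // /set_mem/f0.
have fgD x : ((f \_ D) x <= (g \_ D) x)%E by rewrite !patchE; case: ifPn => // /set_mem/fg.
rewrite !ge0_integralTE//; last by move=> x; exact: le_trans (fgD x).
by apply: le_ereal_sup => _ [h hf <-]; exists h => // x; exact: le_trans (fgD x).
Qed.

(* No measurability is assumed on f: derive1 takes junk values on a null set. *)
Lemma ge0_ae_eq_integral_nonmeasurable (R : realType) d (T : measurableType d)
    (mu : {measure set T -> \bar R}) (D : set T) (f g : T -> \bar R) :
  measurable D -> measurable_fun D g ->
  (forall x, D x -> 0 <= f x)%E -> (forall x, D x -> 0 <= g x)%E ->
  {ae mu, forall x, D x -> f x = g x} ->
  (\int[mu]_(x in D) f x = \int[mu]_(x in D) g x)%E.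
Proof.
move=> mD mg f0 g0 [B [mB B0 subB]].
have mDB : measurable (D `\` B) by exact: measurableD.
have gDB : (\int[mu]_(x in D) g x = \int[mu]_(x in D) (g \_ (~` B)) x)%E.
  by rewrite (ge0_negligible_integral mB)// setDE integral_mkcondr.
(* f is caught between g cut to 0 on the null set B and g raised to +oo on B; both have the integral
   of g. *)
pose g2 x := maxe (g x) ((cst +oo%E \_ B) x).
have gDBy : (\int[mu]_(x in D) g x = \int[mu]_(x in D) g2 x)%E.
  apply: ge0_ae_eq_integral => //.
  - apply: measurable_maxe => //; apply/measurable_restrict => //.
  - by move=> x Dx; rewrite le_max g0.
  - exists B; split => // x /= H; apply: contrapT => nB; apply: H => Dx.
    by rewrite /g2 patchE memNset// (max_idPl _)// g0.
apply/eqP; rewrite eq_le; apply/andP; split.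
  rewrite gDBy; apply: le_ge0_integral => // x Dx; rewrite /g2 patchE.
  case: (boolP (x \in B)) => [_|]; first by rewrite le_max leey orbT.
  rewrite notin_setE => xB; rewrite (max_idPl _) ?g0//. have : ~ ~ (D x -> f x = g x) by move=> /subB.
  by move=> /contrapT ->.
rewrite gDB; apply: le_ge0_integral => x Dx; rewrite patchE; case: ifPn => //.
- by move=> _; exact: g0.
- move=> /set_mem xB; have : ~ ~ (D x -> f x = g x) by move=> /subB.
  by move=> /contrapT ->.
- by move=> _; exact: f0.
Qed.

Lemma ae_and (R : realType) (P Q : R -> Prop) :
  {ae @lebesgue_measure R, forall x, P x} -> {ae @lebesgue_measure R, forall x, Q x} ->
  {ae @lebesgue_measure R, forall x, P x /\ Q x}.
Proof.
move=> [A [mA A0 sA]] [B [mB B0 sB]]; exists (A `|` B); split.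
- exact: measurableU.
- by rewrite measureU0.
- move=> x /= /not_andP[Px|Qx]; [left; exact: sA|right; exact: sB].
Qed.

(** Two functions are allowed on the right because the increments of ln f' - ln g' will be bounded
    by those of f' - g' and of f'. *)
Lemma total_variation_le_combination (R : realType) (a b A B : R) (f g h : R -> R) :
  a <= b -> 0 <= A -> 0 <= B ->
  (forall x y : R, a <= x -> x <= y -> y <= b ->
     `|f y - f x| <= A * `|g y - g x| + B * `|h y - h x|) ->
  (total_variation a b f
     <= A%:E * total_variation a b g + B%:E * total_variation a b h)%E.
Proof.
move=> ab A0 B0 H; apply: ge_ereal_sup => _ [_ [s ps <-] <-].
apply: (@le_trans _ _ (A * variation a b g s + B * variation a b h s)%:E).
  rewrite lee_fin !variation_zip_pairs !mulr_sumr -big_split/=.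
  rewrite big_seq [leRHS]big_seq; apply: ler_sum => p.
  have [/andP[fam _] _] := interval_family_zip ps.
  by move=> /(allP fam)/and3P[? ? ?]; exact: H.
have le (k : R -> R) : ((variation a b k s)%:E <= total_variation a b k)%E.
  apply: ereal_sup_ubound; exists (variation a b k s) => //.
  exact: variations_variation.
by rewrite EFinD !EFinM leeD// lee_wpmul2l ?lee_fin.
Qed.

Lemma Rintegral_itvB_oc (R : realType) (g : R -> R) (x y : R) :
  (@lebesgue_measure R).-integrable setT (EFin \o g) -> 0 <= x -> x <= y ->
  \int[lebesgue_measure]_(t in `]0, y]) g t - \int[lebesgue_measure]_(t in `]0, x]) g t
    = \int[lebesgue_measure]_(t in `]x, y]) g t.
Proof.
move=> ig x0 xy; rewrite Rintegral_itvB ?bnd_simp//.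
exact: integrableS ig.
Qed.

Lemma total_variationB_le_Rintegral (R : realType) (u v : R -> R) :
  abs_continuous_on 0 1 u -> abs_continuous_on 0 1 v ->
  (total_variation 0 1 (u \- v)%R <=
    (\int[lebesgue_measure]_(x in `[0, 1]) `|derive1 u x - derive1 v x|)%R%:E)%E.
Proof.
move=> /abs_continuous_on_density[gu [igu guE]].
move=> /abs_continuous_on_density[gv [igv gvE]].
have aeu := ae_derive1_density igu guE.
have aev := ae_derive1_density igv gvE.
pose w x := `|gu x - gv x|.
have iuv : (@lebesgue_measure R).-integrable setT (EFin \o (gu \- gv)).
  by rewrite (_ : _ \o _ = ((EFin \o gu) \- (EFin \o gv))%E)//; exact: integrableB.
have iw : (@lebesgue_measure R).-integrable setT (EFin \o w).
  exact: (integrable_norm iuv).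
have -> : \int[lebesgue_measure]_(x in `[0, 1]) `|derive1 u x - derive1 v x|
    = \int[lebesgue_measure]_(x in `]0, 1]) w x.
  rewrite Rintegral_itv_obnd_cbnd; last exact: integrableS iw.
  rewrite /Rintegral; congr fine.
  apply: ge0_ae_eq_integral_nonmeasurable => //.
  - by apply: measurable_funTS; exact: measurable_int iw.
  - by move=> x _; rewrite lee_fin /w.
  (* The derivatives are identified only inside (0, 1), so both endpoints join the exceptional null
     set. *)
  have ae0 : {ae @lebesgue_measure R, forall x : R, x != 0}.
    exists [set 0]; split; rewrite ?lebesgue_measure_set1//.
    by move=> x /= /negP; rewrite negbK => /eqP.
  have ae1 : {ae @lebesgue_measure R, forall x : R, x != 1}.
    exists [set 1]; split; rewrite ?lebesgue_measure_set1//.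
    by move=> x /= /negP; rewrite negbK => /eqP.
  have ae01 : {ae @lebesgue_measure R, forall x : R, x != 0 /\ x != 1}.
    exact: ae_and.
  have [A [mA A0 sA]] := ae_and (ae_and aeu aev) ae01; exists A; split => //.
  move=> x /= nx; apply: sA => /= -[[Hu Hv] [x0 x1]]; apply: nx; rewrite /= in_itv/= => /andP[x0' x1'].
  have x01 : 0 < x < 1 by rewrite !lt_neqAle eq_sym x0 x1 x0'.
  by rewrite /w Hu// Hv.
(* W dominates the increments of u - v and is nondecreasing, so its own variation is W 1 - W 0. *)
pose W x := \int[lebesgue_measure]_(t in `]0, x]) w t.
have WE (x y : R) : 0 <= x -> x <= y -> y <= 1 -> `|(u \- v) y - (u \- v) x| <= W y - W x.
  move=> x0 xy y1; rewrite /W Rintegral_itvB_oc//.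
  have -> : (u \- v) y - (u \- v) x = \int[lebesgue_measure]_(t in `]x, y]) (gu t - gv t).
    rewrite RintegralB//; [|exact: integrableS igu|exact: integrableS igv].
    have x01 : 0 <= x <= 1 by rewrite x0 (le_trans xy).
    have y01 : 0 <= y <= 1 by rewrite y1 (le_trans x0).
    rewrite -(Rintegral_itvB_oc igu x0 xy) -(Rintegral_itvB_oc igv x0 xy).
    by rewrite (guE _ x01) (guE _ y01) (gvE _ x01) (gvE _ y01) /=; ring.
  apply: le_normr_Rintegral => //; exact: integrableS iuv.
have := @total_variation_le_combination _ 0 1 1 0 (u \- v) W W ler01 ler01 (lexx _).
rewrite mul0e adde0 mul1e => H; apply: (le_trans (H _)).
  by move=> x y x0 xy y1; rewrite mul1r mul0r addr0; apply: le_trans (ler_norm _); exact: WE.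
rewrite nondecreasing_total_variation//.
  by rewrite /W set_itvoc0 Rintegral_set0 subr0.
move=> x y; rewrite !in_itv/= => /andP[x0 x1] /andP[y0 y1] xy.
by rewrite -subr_ge0; apply: le_trans (WE _ _ x0 xy y1).
Qed.

(** * Lifts of circle maps *)

Lemma to_circleP (R : realType) (x y : R) :
  to_circle x = to_circle y <-> exists n : int, y = x + n%:~R.
Proof.
split=> [e|[n ->]].
  have := congr1 sval e; rewrite /= => exy.
  exists (Num.floor y - Num.floor x); rewrite intrB; lra.
apply: eq_exist => /=.
by rewrite (floorDrz x (intr_int R n)) intrKfloor intrD; ring.
Qed.

(** Two distinct values differ by at least 1, so the smaller one plus 1/2 would be attained as well,
    and it is not an integer. *)
Lemma int_valued_continuous_cst (R : realType) (u : R -> R) :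
  continuous u -> (forall x : R, exists n : int, u x = n%:~R) ->
  forall x y : R, u x = u y.
Proof.
move=> cu iu.
suff H x y : x <= y -> u x = u y.
  by move=> x y; case: (leP x y) => [/H//|/ltW/H].
move=> xy; apply/eqP/negPn/negP => nxy.
have [nx ex] := iu x; have [ny ey] := iu y.
have half (m : int) : m%:~R != 2^-1 :> R.
  apply/eqP => m2; have : (m * 2)%:~R = 1%:~R :> R by rewrite intrM m2 mulVf.
  by move=> /intr_inj; lia.
pose v : R := Num.min (u x) (u y) + 2^-1.
have sep : 1 <= `|u x - u y|.
  rewrite ex ey -intrB -intr_norm -[1]/(1%:~R) ler_int -gtz0_ge1 normr_gt0 subr_eq0.
  by apply: contra nxy => /eqP nn; rewrite ex ey nn.
have [z _ uz] : exists2 z, z \in `[x, y]%R & u z = v.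
  apply: IVT => //; first exact: continuous_subspaceT.
  rewrite /v; move: sep; rewrite ler_normr; case: (leP (u x) (u y)) => ? /orP[]; lra.
have [nz ez] := iu z; move: uz; rewrite ez /v.
case: (leP (u x) (u y)) => _; rewrite ?ex ?ey => e.
  by have /eqP[] := half (nz - nx); rewrite intrB e; ring.
by have /eqP[] := half (nz - ny); rewrite intrB e; ring.
Qed.

Lemma is_lift_unique (R : realType) (f : circle R -> circle R) (F F' : R -> R) :
  is_lift F f -> is_lift F' f -> exists n : int, forall x : R, F' x = F x + n%:~R.
Proof.
move=> [cF Ff] [cF' Ff'].
have h (x : R) : exists n : int, (F' \- F) x = n%:~R.
  have /to_circleP[n en] : to_circle (F x) = to_circle (F' x) by rewrite -Ff -Ff'.
  by exists n; rewrite /= en addrAC subrr add0r.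
have c : continuous (F' \- F) by move=> x; apply: continuousB; [exact: cF'|exact: cF].
have [n en] := h 0; exists n => x.
by rewrite -en (int_valued_continuous_cst c h 0 x) /= addrC subrK.
Qed.

Lemma is_lift_comp (R : realType) (f g : circle R -> circle R) (F G : R -> R) :
  is_lift F f -> is_lift G g -> is_lift (F \o G) (f \o g).
Proof.
move=> [cF Ff] [cG Gg]; split; last by move=> x /=; rewrite Gg Ff.
by move=> x; apply: continuous_comp; [exact: cG|exact: cF].
Qed.

Lemma lift_ofP (R : realType) (f : circle R -> circle R) (F : R -> R) :
  is_lift F f -> is_lift (lift_of f) f.
Proof. by move=> lF; rewrite /lift_of; case: xgetP => [g -> //|/(_ F)]. Qed.

Lemma derive1_addr_cst (R : realType) (F : R -> R) (c : R) :
  derive1 (fun x => F x + c) = derive1 F.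
Proof.
apply: funext => x; rewrite /derive1.
have -> : (fun h => h^-1 *: (F (h + x) + c - (F x + c)))
    = (fun h => h^-1 *: (F (h + x) - F x)).
  by apply: funext => h; congr (_ *: _); ring.
by [].
Qed.

Lemma circle_derivE (R : realType) (f : circle R -> circle R) (F : R -> R) :
  is_lift F f -> circle_deriv f = derive1 F.
Proof.
move=> lF; have [n en] := is_lift_unique lF (lift_ofP lF).
by rewrite /circle_deriv (_ : lift_of f = fun x => F x + n%:~R) ?derive1_addr_cst//; exact/funext.
Qed.

(** The difference F (x + 1) - F x is a positive integer n. If n > 1, some z strictly between x and
    x + 1 satisfies F z = F x + 1, against the injectivity of f. *)
Lemma lift_addr1 (R : realType) (f : circle R -> circle R) (F : R -> R) :
  injective f -> is_lift F f -> {homo F : x y / x < y} ->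
  forall x : R, F (x + 1) = F x + 1.
Proof.
move=> injf [cF Ff] incF.
have lF' : is_lift (fun x => F (x + 1)) f.
  split.
    have c : continuous (F \o (fun x : R => x + 1)).
      move=> x; apply: continuous_comp; last exact: cF.
      by apply: cvgD; [exact: cvg_id|exact: cvg_cst].
    exact: c.
  move=> x; rewrite -Ff; congr f; apply/to_circleP; by exists 1.
have [n en] := is_lift_unique (conj cF Ff) lF'.
move=> x; rewrite en; congr (_ + _).
have n0 : (0 < n)%R.
  have := incF x (x + 1); rewrite en !ltrDl ltr0z; exact.
have [n1|n1] := leP n 1.
  by have -> : n = 1 by apply/eqP; rewrite eq_le n1 -gtz0_ge1.
exfalso.
have [z zx Fz] : exists2 z, z \in `[x, x + 1]%R & F z = F x + 1.
  apply: IVT; first by rewrite lerDl.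
    by apply: continuous_subspaceT.
  rewrite en; have : 1 <= n%:~R :> R by rewrite (ler_int _ 1) ltW.
  by case: (leP (F x) (F x + n%:~R)); lra.
have /to_circleP[k zk] : to_circle x = to_circle z.
  by apply: injf; rewrite !Ff; apply/to_circleP; exists 1.
move: zx; rewrite in_itv/= zk lerDl lerD2l ler0z (ler_int _ k 1) => /andP[k0 k1].
have [k00|k11] : k = 0 \/ k = 1 by lia.
  by move: Fz; rewrite zk k00 addr0; lra.
move: Fz; rewrite zk k11 en => /addrI/(@intr_inj R n 1) n1'; move: n1.
by rewrite n1' ltxx.
Qed.

Record regular_lift (R : realType) (f : circle R -> circle R) (L : R -> R) : Prop :=
  RegularLift {
    regular_lift_is_lift : is_lift L f ;
    regular_lift_incr : {homo L : x y / x < y} ;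
    regular_lift_inv : exists L', [/\ cancel L L', cancel L' L & {homo L' : x y / x < y}] ;
    regular_lift_derivable : forall x : R, derivable L x 1 ;
    regular_lift_continuous : continuous (derive1 L) ;
    regular_lift_gt0 : forall x : R, 0 < derive1 L x ;
    regular_lift_addr1 : forall x : R, L (x + 1) = L x + 1 ;
    regular_lift_derive1_addr1 : forall x : R, derive1 L (x + 1) = derive1 L x }.

Lemma regular_liftP (R : realType) (f g : circle R -> circle R) (F G : R -> R) :
  cancel f g -> cancel g f -> is_lift F f -> is_lift G g ->
  {homo F : x y / x < y} -> C1_fun F -> C1_fun G -> regular_lift f F.
Proof.
move=> fK gK lF lG incF [dF cF] [dG cG].
have lid : is_lift id (@idfun (circle R)) by split=> // x; exact: cvg_id.
have [k GF] : exists k : int, forall x, G (F x) = x + k%:~R.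
  apply: (is_lift_unique lid); rewrite (_ : idfun = g \o f); last by apply/funext => z /=; rewrite fK.
  exact: is_lift_comp lG lF.
have [l FG] : exists k : int, forall x, F (G x) = x + k%:~R.
  apply: (is_lift_unique lid); rewrite (_ : idfun = f \o g); last by apply/funext => z /=; rewrite gK.
  exact: is_lift_comp lF lG.
have F1 := lift_addr1 (can_inj fK) lF incF.
have D1 x : derive1 F (x + 1) = derive1 F x.
  rewrite /derive1.
  have -> : (fun h => h^-1 *: (F (h + (x + 1)) - F (x + 1)))
      = (fun h => h^-1 *: (F (h + x) - F x)).
    by apply: funext => h; congr (_ *: _); rewrite addrA !F1; ring.
  by [].
have leF := le_mono incF; have ltF := leW_mono leF.
apply: RegularLift; [exact: lF|exact: incF| |exact: dF|exact: cF| |exact: F1|exact: D1].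
(* G lifts the inverse of f and so inverts F only up to an integer l, which the shift corrects. *)
- pose L' y := G (y - l%:~R).
  have L'K : cancel L' F by move=> x; rewrite /L' FG subrK.
  exists L'; split; [|exact: L'K|].
    by move=> x; apply: (inc_inj leF); rewrite L'K.
  by move=> x y xy; rewrite -ltF !L'K.
(* Monotonicity gives F' >= 0; the chain rule for G \o F, a translation, excludes the value 0. *)
- move=> x; rewrite lt_neqAle; apply/andP; split; last first.
    apply: (@incr_derive1_ge0 _ F setT); [by move=> y _; exact: dF|by move=> y z _ _; exact: incF|].
    by rewrite interiorT.
  have := derive1_comp (dF x) (dG (F x)).
  have -> : G \o F = (fun x => x + k%:~R) by apply: funext.
  rewrite derive1_addr_cst derive1_id => e.
  by apply/eqP => e0; move: e; rewrite -e0 mulr0 => /eqP; rewrite oner_eq0.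
Qed.

(** The lift picked by [lift_of] differs by an integer from the F that witnesses regularity, and
    thus inherits its properties. *)
Lemma Diff1AC_regular_lift (R : realType) (f : circle R -> circle R) :
  Diff1AC f -> regular_lift f (lift_of f) /\ abs_continuous_on 0 1 (circle_deriv f).
Proof.
move=> [[g [F [G [[fK gK lF lG] [incF dF dG]]]]] ac]; split => //.
have lL := lift_ofP lF.
have [n en] := is_lift_unique lF lL.
apply: (regular_liftP fK gK lL lG _ _ dG).
  by move=> x y xy; rewrite !en ltrD2r incF.
have -> : lift_of f = (fun x => F x + n%:~R) by exact/funext.
split; last by rewrite derive1_addr_cst; exact: dF.2.
by move=> x; apply: derivableD; [exact: dF.1|exact: derivable_cst].
Qed.

(** * Total variation under changes of variable and over a period *)

Lemma total_variation_comp_le (R : realType) (phi H : R -> R) (a b : R) :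
  {homo H : x y / x < y} -> a <= b ->
  (total_variation a b (phi \o H) <= total_variation (H a) (H b) phi)%E.
Proof.
move=> incH ab; apply: ge_ereal_sup => _ [_ [s [ps /eqP lasts] <-] <-].
apply: ereal_sup_ubound; exists (variation (H a) (H b) phi (map H s)).
  apply: variations_variation; split; last by rewrite last_map lasts.
  by rewrite path_map; apply: sub_path ps => x y; exact: incH.
congr EFin; rewrite !variation_zip_pairs; elim: s a {ab ps lasts} => [|x s IH] a.
  by rewrite !big_nil.
by rewrite /= !big_cons -IH.
Qed.

(** An increasing map carries partitions to partitions; this gives one inequality for H and the
    other one for H'. *)
Lemma total_variation_comp (R : realType) (phi H H' : R -> R) (a b : R) :
  cancel H H' -> cancel H' H -> {homo H : x y / x < y} -> {homo H' : x y / x < y} ->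
  a <= b -> total_variation a b (phi \o H) = total_variation (H a) (H b) phi.
Proof.
move=> HK H'K incH incH' ab; apply/eqP; rewrite eq_le total_variation_comp_le//=.
have Hab : H a <= H b by rewrite (le_mono incH).
have := @total_variation_comp_le _ (phi \o H) H' _ _ incH' Hab.
by rewrite !HK; have -> : (phi \o H) \o H' = phi by apply/funext => x /=; rewrite H'K.
Qed.

Lemma total_variation_shift (R : realType) (phi : R -> R) (c a b : R) :
  a <= b -> total_variation a b (fun x => phi (x + c)) = total_variation (a + c) (b + c) phi.
Proof.
move=> ab; apply: (@total_variation_comp _ phi (fun x => x + c) (fun x => x - c)) => //.
- by move=> x; rewrite addrK.
- by move=> x; rewrite subrK.
- by move=> x y; rewrite ltrD2r.
- by move=> x y; rewrite ltrD2r.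
Qed.

Lemma periodic_int (R : realType) (phi : R -> R) :
  (forall x : R, phi (x + 1) = phi x) -> forall (n : int) (x : R), phi (x + n%:~R) = phi x.
Proof.
move=> per; have pn (n : nat) (x : R) : phi (x + n%:R) = phi x.
  by elim: n => [|n IH]; rewrite ?addr0// -natr1 addrA per.
case=> n x; first exact: pn.
by rewrite -(pn n.+1 (x + _)) NegzE mulrNz subrK.
Qed.

Lemma total_variation_period (R : realType) (phi : R -> R) (a : R) :
  (forall x : R, phi (x + 1) = phi x) ->
  total_variation a (a + 1) phi = total_variation 0 1 phi.
Proof.
move=> per; pose b := a - (Num.floor a)%:~R.
have /andP[b0 b1] : 0 <= b < 1 := frac_subproof a.
have phiE (c : int) : (fun x => phi (x + c%:~R)) = phi.
  by apply: funext => x; exact: periodic_int.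
have -> : total_variation a (a + 1) phi = total_variation b (b + 1) phi.
  have bb : b <= b + 1 by rewrite lerDl.
  have := @total_variation_shift _ phi (Num.floor a)%:~R _ _ bb.
  by rewrite phiE => ->; congr total_variation; rewrite /b; ring.
have le1b : 1 <= b + 1 by rewrite lerDr.
(* The piece [1, b + 1] is moved back to [0, b] by periodicity. *)
rewrite (total_variationD phi (ltW b1) le1b).
have := @total_variation_shift _ phi 1 _ _ b0.
rewrite (phiE 1) add0r => <-.
by rewrite addeC -total_variationD// ltW.
Qed.

(** * The pseudometric given by the variation of the logarithmic derivative *)

Lemma lipschitz_ln (R : realType) (m x y : R) : 0 < m -> m <= x -> m <= y ->
  `|ln x - ln y| <= m^-1 * `|x - y|.
Proof.
move=> m0 mx my.
have H (a b : R) : m <= a -> m <= b -> ln a - ln b <= m^-1 * `|a - b|.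
  move=> ma mb; have a0 : 0 < a by exact: lt_le_trans ma.
  have b0 : 0 < b by exact: lt_le_trans mb.
  rewrite -ln_div ?posrE//.
  apply: (@le_trans _ _ (a / b - 1)).
    have := @le_ln1Dx _ (a / b - 1); rewrite [1 + _]addrC subrK; apply.
    by rewrite ltrBDl subrr divr_gt0.
  have -> : a / b - 1 = b^-1 * (a - b) by field; rewrite gt_eqF.
  apply: (@le_trans _ _ (b^-1 * `|a - b|)).
    by apply: ler_wpM2l; [rewrite invr_ge0 ltW|exact: ler_norm].
  by rewrite ler_wpM2r// lef_pV2 ?posrE.
rewrite ler_norml H// andbT lerNl opprB distrC; exact: H.
Qed.

Lemma circle_deriv_bounds (R : realType) (f : circle R -> circle R) : Diff1AC f ->
  exists m M : R, 0 < m /\ forall x : R, 0 <= x <= 1 -> m <= circle_deriv f x <= M.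
Proof.
move=> /Diff1AC_regular_lift[L _].
have c : {within `[0, 1], continuous (circle_deriv f)}.
  by apply: continuous_subspaceT; exact: regular_lift_continuous L.
have [a _ am] := EVT_min ler01 c; have [b _ bM] := EVT_max ler01 c.
exists (circle_deriv f a), (circle_deriv f b); split.
  exact: regular_lift_gt0 L a.
by move=> x x01; rewrite am ?bM// in_itv.
Qed.

Definition log_deriv (R : realType) (f : circle R -> circle R) (x : R) : R :=
  ln (circle_deriv f x).

(** On [Diff1AC] this is the integral of |f''/f' - g''/g'|, written so that only first derivatives
    occur. *)
Definition log_variation (R : realType) (f g : circle R -> circle R) : R :=
  fine (total_variation 0 1 (log_deriv f \- log_deriv g)).

(** f' has bounded variation and stays above some m > 0, where [ln] is Lipschitz. *)
Lemma log_variation_fin_num (R : realType) (f g : circle R -> circle R) :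
  Diff1AC f -> Diff1AC g ->
  total_variation 0 1 (log_deriv f \- log_deriv g) \is a fin_num.
Proof.
move=> Gf Gg.
have fin (h : circle R -> circle R) : Diff1AC h -> total_variation 0 1 (log_deriv h) \is a fin_num.
  move=> Gh; have [m [M [m0 mM]]] := circle_deriv_bounds Gh.
  have bv : total_variation 0 1 (circle_deriv h) \is a fin_num.
    apply/bounded_variationP => //; apply: abs_continuous_on_bounded_variation => //.
    by case: (Diff1AC_regular_lift Gh).
  have i0 : 0 <= m^-1 by rewrite invr_ge0 ltW.
  have H (x y : R) : 0 <= x -> x <= y -> y <= 1 ->
      `|log_deriv h y - log_deriv h x| <= m^-1 * `|circle_deriv h y - circle_deriv h x|
         + 0 * `|circle_deriv h y - circle_deriv h x|.
    move=> x0 xy y1; rewrite mul0r addr0; apply: lipschitz_ln => //.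
      by have /mM/andP[] : 0 <= y <= 1 by rewrite y1 (le_trans x0).
    by have /mM/andP[] : 0 <= x <= 1 by rewrite x0 (le_trans xy).
  have := total_variation_le_combination ler01 i0 (lexx 0) H.
  rewrite mul0e adde0 => le1.
  rewrite ge0_fin_numE ?total_variation_ge0//; apply: le_lt_trans le1 _.
  by rewrite lte_mul_pinfty// ?lee_fin// ltey_eq bv.
have := @total_variation_le _ 0 1 (log_deriv f) (\- log_deriv g) ler01.
rewrite total_variationN => le1.
rewrite ge0_fin_numE ?total_variation_ge0//; apply: le_lt_trans le1 _.
by rewrite lte_add_pinfty// ltey_eq fin.
Qed.

Lemma total_variationB_triangle (R : realType) (a b : R) (u v w : R -> R) : a <= b ->
  (total_variation a b (u \- w)%R
     <= total_variation a b (u \- v)%R + total_variation a b (v \- w)%R)%E.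
Proof.
move=> ab; apply: le_trans (total_variation_le _ _ ab).
rewrite (_ : (u \- v) \+ (v \- w) = u \- w)//.
by apply/funext => x /=; rewrite addrA subrK.
Qed.

Lemma fine_total_variationB_triangle (R : realType) (u v w : R -> R) :
  total_variation 0 1 (u \- w) \is a fin_num ->
  total_variation 0 1 (u \- v) \is a fin_num ->
  total_variation 0 1 (v \- w) \is a fin_num ->
  fine (total_variation 0 1 (u \- w))
    <= fine (total_variation 0 1 (u \- v)) + fine (total_variation 0 1 (v \- w)).
Proof.
move=> f1 f2 f3; rewrite -lee_fin EFinD !fineK//.
exact: total_variationB_triangle.
Qed.

Lemma log_variation_pseudometric (R : realType) :
  pseudometric_on (@Diff1AC R) (@log_variation R).
Proof.
split.
- move=> f Gf; rewrite /log_variation (_ : _ \- _ = cst 0).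
    have := @nondecreasing_total_variation _ 0 1 (cst (0 : R)) ler01.
    by move=> ->//=; rewrite subrr.
  by apply/funext => x /=; rewrite subrr.
- by move=> f g _ _; rewrite fine_ge0// total_variation_ge0.
- move=> f g _ _; rewrite /log_variation -total_variationN; congr (fine (total_variation _ _ _)).
  by apply/funext => x /=; rewrite opprB.
- move=> f g h Gf Gg Gh.
  exact: (fine_total_variationB_triangle (log_variation_fin_num Gf Gh)
    (log_variation_fin_num Gf Gg) (log_variation_fin_num Gg Gh)).
Qed.

Lemma log_deriv_comp (R : realType) (f h : circle R -> circle R) :
  Diff1AC f -> Diff1AC h ->
  log_deriv (f \o h) = (log_deriv f \o lift_of h) \+ log_deriv h.
Proof.
move=> /Diff1AC_regular_lift[Lf _] /Diff1AC_regular_lift[Lh _].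
apply/funext => x; rewrite /log_deriv/=.
rewrite (circle_derivE (is_lift_comp (regular_lift_is_lift Lf) (regular_lift_is_lift Lh))).
rewrite derive1_comp; [|exact: regular_lift_derivable Lh _|exact: regular_lift_derivable Lf _].
by rewrite lnM// posrE; [exact: regular_lift_gt0 Lf _|exact: regular_lift_gt0 Lh _].
Qed.

(** By the chain rule the term ln h' cancels, and ln f' - ln g' is composed with the lift of h,
    which maps a period onto a period. *)
Lemma log_variation_right_invariant (R : realType) :
  right_invariant (@Diff1AC R) (@log_variation R).
Proof.
move=> f g h Gf Gg Gh.
have [L _] := Diff1AC_regular_lift Gh.
pose phi := log_deriv f \- log_deriv g.
have e : log_deriv (f \o h) \- log_deriv (g \o h) = phi \o lift_of h.
  rewrite (log_deriv_comp Gf Gh) (log_deriv_comp Gg Gh).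
  by apply: funext => x; rewrite /phi /=; ring.
transitivity (fine (total_variation 0 1 (phi \o lift_of h))).
  by congr (fine (total_variation _ _ _)).
have [L' [LK L'K incL']] := regular_lift_inv L.
rewrite (total_variation_comp _ LK L'K (regular_lift_incr L) incL' ler01).
have L1 : lift_of h 1 = lift_of h 0 + 1 by rewrite -(regular_lift_addr1 L) add0r.
have per (x : R) : phi (x + 1) = phi x.
  rewrite /phi /log_deriv /circle_deriv /=.
  have [Lf _] := Diff1AC_regular_lift Gf; have [Lg _] := Diff1AC_regular_lift Gg.
  by rewrite (regular_lift_derive1_addr1 Lf) (regular_lift_derive1_addr1 Lg).
rewrite L1; exact: (congr1 fine (total_variation_period _ per)).
Qed.

(** A set without supremum has [sup] 0 by default, which agrees with the claim. *)
Lemma sup_ge0_of_ge0 (R : realType) (A : set R) :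
  (forall y : R, A y -> 0 <= y) -> 0 <= sup A.
Proof.
move=> A0; have [[[y Ay] ub]|nA] := pselect (has_sup A).
  exact: le_trans (A0 _ Ay) (ub_le_sup ub Ay).
by rewrite sup_out.
Qed.

Lemma rho_lt (R : realType) (f g : circle R -> circle R) (delta : R) :
  Diff1AC f -> Diff1AC g -> rho f g < delta ->
  (forall x : R, 0 <= x <= 1 -> `|circle_deriv f x - circle_deriv g x| < delta) /\
  \int[lebesgue_measure]_(x in `[0, 1])
    `|circle_deriv2 f x - circle_deriv2 g x| < delta.
Proof.
move=> Gf Gg; rewrite /rho.
set A := [set _ | _ in _]; set B := [set _ | _ in _]; set I := (X in _ + X < _).
have A0 : 0 <= sup A.
  apply: sup_ge0_of_ge0 => // _ [x _ <-]; rewrite /circle_dist.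
  case: (f x) (g x) => [a /= /andP[a0 a1]] [b /= /andP[b0 b1]].
  by rewrite le_min normr_ge0 subr_ge0 ler_norml; lra.
have B0 : 0 <= sup B by apply: sup_ge0_of_ge0 => // _ [x _ <-].
have I0 : 0 <= I by exact: Rintegral_ge0.
move=> lt; split; last by apply: le_lt_trans lt; rewrite lerDr addr_ge0.
have [mf [Mf [mf0 fb]]] := circle_deriv_bounds Gf.
have [mg [Mg [mg0 gb]]] := circle_deriv_bounds Gg.
have ubB : has_ubound B.
  exists (Mf + Mg) => _ [[x /= /andP[x0 x1]] _ <-].
  have /fb : 0 <= x <= 1 by rewrite x0 ltW.
  have /gb : 0 <= x <= 1 by rewrite x0 ltW.
  by rewrite ler_norml; lra.
have H (x : R) : 0 <= x < 1 -> `|circle_deriv f x - circle_deriv g x| < delta.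
  move=> x01; apply: (@le_lt_trans _ _ (sup B)); last first.
    by apply: le_lt_trans lt; rewrite -addrA [leRHS]addrCA lerDl addr_ge0.
  by apply: ub_le_sup => //; exists (exist _ x x01).
(* Representatives of circle points stay below 1; the endpoint 1 is reached by periodicity. *)
move=> x /andP[x0]; rewrite le_eqVlt => /predU1P[->|x1]; last by apply: H; rewrite x0.
have [Lf _] := Diff1AC_regular_lift Gf; have [Lg _] := Diff1AC_regular_lift Gg.
have f1 : circle_deriv f 1 = circle_deriv f 0.
  by rewrite /circle_deriv -(regular_lift_derive1_addr1 Lf 0) add0r.
have g1 : circle_deriv g 1 = circle_deriv g 0.
  by rewrite /circle_deriv -(regular_lift_derive1_addr1 Lg 0) add0r.
rewrite f1 g1.
by apply: H; rewrite lexx ltr01.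
Qed.

(** With w = u - v one has u / v = 1 + w / v, whose increment is dw / vy - wx * dv / (vx * vy),
    where dv = du - dw. The bound s <= m / 2 keeps v between m / 2 and 2 * M, so that [ln] is
    Lipschitz at the quotients, and it absorbs the dw contained in dv. *)
Lemma log_ratio_increment (R : realType) (m M s ux uy vx vy : R) : 0 < m ->
  m <= ux -> ux <= M -> m <= uy -> uy <= M ->
  `|ux - vx| <= s -> `|uy - vy| <= s -> s <= m / 2 ->
  `|(ln uy - ln vy) - (ln ux - ln vx)|
     <= (8 * M / m ^+ 2) * `|(uy - vy) - (ux - vx)| + (8 * M / m ^+ 3 * s) * `|uy - ux|.
Proof.
move=> m0 mx xM my yM sx sy sm.
have [vx0 vxM] : m / 2 <= vx /\ vx <= 2 * M by move: sx; rewrite ler_norml; lra.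
have [vy0 vyM] : m / 2 <= vy /\ vy <= 2 * M by move: sy; rewrite ler_norml; lra.
have pvx : 0 < vx by lra. have pvy : 0 < vy by lra.
have pux : 0 < ux by lra. have puy : 0 < uy by lra.
have s0 : 0 <= s by exact: le_trans sx.
have -> : ln uy - ln vy = ln (uy / vy) by rewrite ln_div ?posrE.
have -> : ln ux - ln vx = ln (ux / vx) by rewrite ln_div ?posrE.
have low u v : m <= u -> 0 < v -> v <= 2 * M -> m / (2 * M) <= u / v.
  move=> mu v0 vM; rewrite ler_pdivrMr; last lra.
  rewrite mulrAC ler_pdivlMr//; nra.
have q0 : 0 < m / (2 * M) by rewrite divr_gt0//; lra.
apply: (le_trans (lipschitz_ln q0 (low _ _ my pvy vyM) (low _ _ mx pvx vxM))).
have -> : uy / vy - ux / vx = ((uy - vy) - (ux - vx)) / vy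
    - (ux - vx) * ((uy - ux) - ((uy - vy) - (ux - vx))) / (vx * vy).
  by field; rewrite !gt_eqF.
set dw := (uy - vy) - (ux - vx); set du := uy - ux; set wx := ux - vx in sx *.
have i2 v : m / 2 <= v -> v^-1 <= 2 / m.
  by move=> mv; rewrite -invf_div lef_pV2 ?posrE ?divr_gt0// (lt_le_trans _ mv)// divr_gt0.
have key : `|dw / vy - wx * (du - dw) / (vx * vy)|
    <= (2 / m) * `|dw| + s * (`|du| + `|dw|) * ((2 / m) * (2 / m)).
  apply: (le_trans (ler_normB _ _)); apply: lerD.
    rewrite normrM mulrC ler_wpM2r// gtr0_norm ?invr_gt0//; exact: i2.
  rewrite normrM (gtr0_norm (_ : 0 < (vx * vy)^-1)) ?invr_gt0 ?mulr_gt0//.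
  have iv0 (v : R) : 0 < v -> 0 <= v^-1 by move=> v0; rewrite invr_ge0 ltW.
  apply: ler_pM => //; first by apply: iv0; rewrite mulr_gt0.
    rewrite normrM; apply: ler_pM => //; exact: ler_normB.
  by rewrite invfM; apply: ler_pM; [exact: iv0|exact: iv0|exact: i2|exact: i2].
have -> : (m / (2 * M))^-1 = 2 * M / m by rewrite invf_div.
have c0 : 0 <= 2 * M / m by rewrite divr_ge0; lra.
apply: (le_trans (ler_wpM2l c0 key)).
have im0 : 0 < m^-1 by rewrite invr_gt0.
have smi : s * m^-1 <= 2^-1 by rewrite ler_pdivrMr//; lra.
have -> : 2 * M / m * (2 / m * `|dw| + s * (`|du| + `|dw|) * (2 / m * (2 / m)))
   = 4 * M / m ^+ 2 * `|dw| + 8 * M / m ^+ 2 * (s / m) * `|dw| + 8 * M / m ^+ 3 * s * `|du|.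
  by field; rewrite gt_eqF.
rewrite lerD2r -mulrDl ler_wpM2r//.
have : 8 * M / m ^+ 2 * (s / m) <= 8 * M / m ^+ 2 * 2^-1.
  by apply: ler_wpM2l => //; rewrite divr_ge0 ?exprn_ge0//; lra.
have -> : 4 * M / m ^+ 2 = 8 * M / m ^+ 2 / 2 by field; rewrite gt_eqF.
lra.
Qed.

(** The variation is at most a multiple of that of f' - g', which the integral part of [rho]
    controls, plus delta times a multiple of that of f', where delta is the uniform distance allowed
    between f' and g'. *)
Lemma log_variation_small (R : realType) (f : circle R -> circle R) (e : R) :
  Diff1AC f -> 0 < e -> exists2 delta : R, 0 < delta &
    forall g, Diff1AC g -> rho f g < delta -> log_variation f g < e.
Proof.
move=> Gf e0; have [m [M [m0 mM]]] := circle_deriv_bounds Gf.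
have [_ acf] := Diff1AC_regular_lift Gf.
have fin : total_variation 0 1 (circle_deriv f) \is a fin_num.
  by apply/bounded_variationP => //; exact: abs_continuous_on_bounded_variation.
set V := total_variation 0 1 (circle_deriv f) in fin.
have V0 : 0 <= fine V by rewrite fine_ge0// total_variation_ge0.
have M0 : 0 < M.
  have /mM/andP[? ?] : 0 <= (0 : R) <= 1 by rewrite lexx ler01.
  lra.
pose C := 8 * M / m ^+ 2 + 8 * M / m ^+ 3 * fine V + 1.
have cA : 0 <= 8 * M / m ^+ 2 by rewrite divr_ge0 ?exprn_ge0 ?mulr_ge0// ltW.
have cB : 0 <= 8 * M / m ^+ 3 by rewrite divr_ge0 ?exprn_ge0 ?mulr_ge0// ltW.
have C0 : 0 < C by rewrite ltr_wpDl// addr_ge0// mulr_ge0.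
exists (Num.min (m / 2) (e / C)); first by rewrite lt_min !divr_gt0.
set delta := Num.min _ _ => g Gg /(rho_lt Gf Gg)[supw intw].
have d0 : 0 < delta by rewrite lt_min !divr_gt0.
have dm : delta <= m / 2 by rewrite ge_min lexx.
have de : delta <= e / C by rewrite ge_min lexx orbT.
have [_ acg] := Diff1AC_regular_lift Gg.
have TVw := total_variationB_le_Rintegral acf acg.
have cBd : 0 <= 8 * M / m ^+ 3 * delta by rewrite mulr_ge0// ltW.
have H (x y : R) : 0 <= x -> x <= y -> y <= 1 ->
  `|(log_deriv f \- log_deriv g) y - (log_deriv f \- log_deriv g) x|
    <= (8 * M / m ^+ 2) *
         `|(circle_deriv f \- circle_deriv g) y - (circle_deriv f \- circle_deriv g) x|
       + (8 * M / m ^+ 3 * delta) * `|circle_deriv f y - circle_deriv f x|.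
  move=> x0 xy y1.
  have x01 : 0 <= x <= 1 by rewrite x0 (le_trans xy).
  have y01 : 0 <= y <= 1 by rewrite y1 (le_trans x0).
  have /andP[? ?] := mM _ x01; have /andP[? ?] := mM _ y01.
  by apply: log_ratio_increment => //; apply/ltW/supw.
have := total_variation_le_combination ler01 cA cBd H.
rewrite -/V -(fineK (log_variation_fin_num Gf Gg)) -/(log_variation f g) => le1.
have le2 : ((8 * M / m ^+ 2)%:E * total_variation 0 1 (circle_deriv f \- circle_deriv g)%R
    <= (8 * M / m ^+ 2 * delta)%:E)%E.
  rewrite [X in (_ <= X)%E]EFinM lee_wpmul2l ?lee_fin//; apply: le_trans TVw _.
  by rewrite lee_fin; exact: ltW intw.
have := le_trans le1 (leeD le2 (lexx _)).
rewrite -(fineK fin) -EFinM -EFinD lee_fin => /le_lt_trans; apply.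
apply: (@lt_le_trans _ _ (delta * C)).
  by rewrite /C; have := d0; nra.
by rewrite -ler_pdivlMr.
Qed.

Lemma log_variation_continuous (R : realType) :
  continuous_pseudometric (@Diff1AC R) (@rho R) (@log_variation R).
Proof.
move=> f g Gf Gg e e0.
have arith (a b c d p q : R) : c < e / 2 -> d < e / 2 -> a <= c + p -> p <= b + d ->
    b <= c + q -> q <= a + d -> `|a - b| < e by rewrite ltr_norml; lra.
have e20 : 0 < e / 2 by rewrite divr_gt0.
have [d1 d10 H1] := log_variation_small Gf e20.
have [d2 d20 H2] := log_variation_small Gg e20.
exists (Num.min d1 d2); first by rewrite lt_min d10.
have le1 : Num.min d1 d2 <= d1 by rewrite ge_min lexx.
have le2 : Num.min d1 d2 <= d2 by rewrite ge_min lexx orbT.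
move=> f' g' Gf' Gg' lf lg.
have l1 := H1 _ Gf' (lt_le_trans lf le1); have l2 := H2 _ Gg' (lt_le_trans lg le2).
have [_ _ sym tri] := log_variation_pseudometric R.
have t1 := tri f f' g Gf Gf' Gg; have t2 := tri f' g' g Gf' Gg' Gg.
have t3 := tri f' f g' Gf' Gf Gg'; have t4 := tri f g g' Gf Gg Gg'.
rewrite (sym f' f Gf' Gf) in t3; rewrite (sym g' g Gg' Gg) in t2.
exact: arith l1 l2 t1 t2 t3 t4.
Qed.

Lemma log_variation_admissible (R : realType) :
  admissible_pseudometric (@Diff1AC R) (@rho R) (@log_variation R).
Proof.
split; [exact: log_variation_pseudometric|exact: log_variation_continuous|].
exact: log_variation_right_invariant.
Qed.

(** * Polynomial differential equations and analyticity *)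

(* poly_class u B d N f: f is a polynomial of degree at most d in the functions
   u i, and the sum of the absolute values of its monomials is at most N where
   all |u i| are at most B.  When the u i solve a polynomial ODE, the class is
   stable under differentiation with control of d and N. *)
Inductive poly_class (R : realType) (I : Type) (u : I -> R -> R) (B : R) :
    nat -> R -> (R -> R) -> Prop :=
  | poly_class_cst c : poly_class u B 0 `|c| (cst c)
  | poly_class_var i : poly_class u B 1 B (u i)
  | poly_classD d N1 N2 f g : poly_class u B d N1 f -> poly_class u B d N2 g ->
      poly_class u B d (N1 + N2) (f \+ g)
  | poly_classM d1 d2 N1 N2 f g : poly_class u B d1 N1 f -> poly_class u B d2 N2 g ->
      poly_class u B (d1 + d2) (N1 * N2) (f \* g)
  | poly_class_le d d' N N' f : (d <= d')%N -> N <= N' -> poly_class u B d N f ->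
      poly_class u B d' N' f.

Section poly_class_theory.
Context (R : realType) (I : Type).
Variables (u : I -> R -> R) (B : R).
Hypothesis uB : forall i x, `|u i x| <= B.

Lemma poly_class_bound d N f x : poly_class u B d N f -> `|f x| <= N.
Proof.
elim => [c||{}d N1 N2 {}f g _ f1 _ f2|d1 d2 N1 N2 {}f g _ f1 _ f2|{}d d' {}N N' {}f _ NN' _ h] //=.
- by apply: le_trans (ler_normD _ _) _; exact: lerD.
- by rewrite normrM ler_pM.
- exact: le_trans NN'.
Qed.

Lemma poly_class_ge0 d N f : poly_class u B d N f -> 0 <= N.
Proof. by move=> /(poly_class_bound 0); exact: le_trans. Qed.

Lemma poly_class_exp d N f k : poly_class u B d N f ->
  poly_class u B (k * d) (N ^+ k) (fun x => f x ^+ k).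
Proof.
move=> pf; elim: k => [|k IH].
  rewrite mul0n expr0; have := poly_class_cst u B (1 : R); rewrite normr1.
  by congr poly_class; apply/funext => x; rewrite expr0.
rewrite mulSn exprS (_ : (fun x => f x ^+ k.+1) = f \* (fun x => f x ^+ k)).
  exact: poly_classM.
by apply/funext => x; rewrite exprS.
Qed.

Lemma poly_classZ d N f a : poly_class u B d N f ->
  poly_class u B d (`|a| * N) (fun x => a * f x).
Proof. by move=> pf; exact: poly_classM (poly_class_cst u B a) pf. Qed.

Variables (D : nat) (M : R).
Hypothesis M0 : 0 <= M.
Hypothesis du : forall i x, derivable (u i) x 1.
Hypothesis ode : forall i, poly_class u B D.+1 (M * B) (derive1 (u i)).

(** Leibniz rule: a monomial of degree d yields d products, in each of which one variable of size B
    is replaced by a polynomial of size M * B. *)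
Lemma poly_class_derive1 d N f : poly_class u B d N f ->
  (forall x, derivable f x 1) /\
  poly_class u B (d + D) (d%:R * M * N) (derive1 f).
Proof.
elim => [c|i|{}d N1 N2 {}f g pf [df f1] pg [dg f2]
    |d1 d2 N1 N2 {}f g pf [df f1] pg [dg f2]|{}d d' {}N N' {}f dd' NN' pf [df f1]].
- split; first by move=> x; exact: derivable_cst.
  rewrite (_ : derive1 (cst c) = cst 0).
    apply: (poly_class_le (leq0n _) _ (poly_class_cst u B 0)).
    by rewrite normr0 !mul0r.
  by apply/funext => x; rewrite derive1_cst.
- by split; [exact: du|rewrite mul1r; exact: ode].
- split; first by move=> x; exact: derivableD.
  rewrite (_ : derive1 (f \+ g) = derive1 f \+ derive1 g).
    by rewrite mulrDr; exact: poly_classD.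
  by apply/funext => x; rewrite derive1E deriveD//= !derive1E.
- split; first by move=> x; exact: derivableM.
  rewrite (_ : derive1 (f \* g) = (derive1 f \* g) \+ (f \* derive1 g)).
    rewrite natrD (_ : _ * _ * _ = d1%:R * M * N1 * N2 + N1 * (d2%:R * M * N2)); last by ring.
    apply: poly_classD.
      apply: poly_class_le (poly_classM f1 pg) => //.
      by rewrite addnAC.
    apply: poly_class_le (poly_classM pf f2) => //.
    by rewrite addnA.
  apply/funext => x; rewrite derive1E deriveM//= !derive1E /GRing.scale/=; ring.
- split => //; apply: poly_class_le f1; first by rewrite leq_add2r.
  have N0 := poly_class_ge0 pf.
  by rewrite ler_pM ?mulr_ge0// ler_wpM2r// ler_nat.
Qed.

(** Differentiating the j-th derivative costs a factor M * (d + j * D), which is at most M * (d + D)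
    * (j + 1); the product has the factorial growth that analyticity permits. *)
Lemma poly_class_derive1n d N f k : poly_class u B d N f ->
  (forall x, derivable (derive1n k f) x 1) /\
  poly_class u B (d + k * D) (N * (M * (d + D)%:R) ^+ k * k`!%:R) (derive1n k f).
Proof.
move=> pf.
have : poly_class u B (d + k * D) (N * (M * (d + D)%:R) ^+ k * k`!%:R) (derive1n k f).
  elim: k => [|k IH]; first by rewrite addn0 expr0 fact0 !mulr1.
  rewrite derive1nS.
  apply: poly_class_le (poly_class_derive1 IH).2.
    by rewrite mulSn -!addnA (addnC D).
  have N0 := poly_class_ge0 pf.
  rewrite factS natrM exprSr.
  have : (d + k * D)%:R <= (d + D)%:R * k.+1%:R :> R.
    by rewrite -natrM ler_nat; nia.
  have p0 : 0 <= N * (M * (d + D)%:R) ^+ k * k`!%:R * M.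
    by rewrite !mulr_ge0 ?exprn_ge0 ?mulr_ge0.
  move=> /(ler_wpM2l p0); congr (_ <= _); ring.
by move=> pk; split => //; case: (poly_class_derive1 pk).
Qed.

End poly_class_theory.

Lemma is_derive1P (R : realType) (f : R -> R) (x : R) :
  derivable f x 1 -> is_derive x (1 : R) f (derive1 f x).
Proof. by move=> df; rewrite derive1E; apply/derivableP. Qed.

Lemma is_derive_monomial (R : realType) (c x : R) (n : nat) :
  is_derive x (1 : R) (fun y => c * y ^+ n.+1) (c * (n.+1%:R * x ^+ n)).
Proof.
have d : derivable (fun y : R => y ^+ n.+1) x 1 by exact: exprn_derivable.
rewrite (_ : (fun y => c * y ^+ n.+1) = c *: (fun y : R => y ^+ n.+1)); last first.
  by apply/funext.
by split; [exact: derivableZ|rewrite deriveZ// exp_derive /GRing.scale/= mulr1].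
Qed.

Lemma is_derive_shift (R : realType) (f : R -> R) (x t : R) :
  (forall y : R, derivable f y 1) ->
  is_derive t (1 : R) (fun t => f (x + t)) (derive1 f (x + t)).
Proof.
move=> df.
have dl : is_derive t (1 : R) (fun t => x + t) 1.
  rewrite (_ : (fun t => x + t) = cst x + id)//.
  by apply: is_derive_eq; rewrite add0r.
have := @is_derive1_comp _ f (fun t => x + t) t _ _ (is_derive1P (df (x + t))) dl.
by rewrite mulr1.
Qed.

Lemma is_derive_opp_arg (R : realType) (f : R -> R) (t : R) :
  (forall y : R, derivable f y 1) ->
  is_derive t (1 : R) (fun t => f (- t)) (- derive1 f (- t)).
Proof.
move=> df.
have dl : is_derive t (1 : R) (fun t => - t) (-1).
  by rewrite (_ : (fun t => - t) = - id)//; apply: is_derive_eq.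
have := @is_derive1_comp _ f (fun t => - t) t _ _ (is_derive1P (df (- t))) dl.
by rewrite mulrN1.
Qed.

(** The function S * x^(n + 1) / (n + 1)! - psi x is nondecreasing for x >= 0. Applying this to -
    psi gives the lower bound, and reflecting the argument gives negative h. *)
Lemma increment_le_of_derive1 (R : realType) (psi : R -> R) (S : R) (n : nat) :
  (forall x : R, derivable psi x 1) -> psi 0 = 0 ->
  (forall t : R, `|derive1 psi t| <= S * (`|t| ^+ n / n`!%:R)) ->
  forall h : R, `|psi h| <= S * (`|h| ^+ n.+1 / n.+1`!%:R).
Proof.
have nonneg (p : R -> R) : (forall x : R, derivable p x 1) -> p 0 = 0 ->
    (forall t : R, derive1 p t <= S * (`|t| ^+ n / n`!%:R)) ->
    forall h : R, 0 <= h -> p h <= S * (h ^+ n.+1 / n.+1`!%:R).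
  move=> dp p0 dpS h h0.
  pose c : R := S / n.+1`!%:R.
  pose q := (fun x => c * x ^+ n.+1) - p.
  have dq (x : R) : is_derive x (1 : R) q (S * (x ^+ n / n`!%:R) - derive1 p x).
    have dpx := is_derive1P (dp x); have dm := is_derive_monomial c x n.
    apply: is_derive_eq; congr (_ - _); rewrite /c factS natrM.
    by field; rewrite !gt_eqF ?ltr0n ?fact_gt0.
  have : q 0 <= q h.
    apply: (@ger0_derive1_ndecr _ q 0 h) => //.
    - move=> x; rewrite in_itv/= => /andP[x0 _].
      rewrite derive1E; case: (dq x) => _ ->; rewrite subr_ge0.
      by have := dpS x; rewrite gtr0_norm//.
    - by apply: derivable_within_continuous => x _; case: (dq x).
  by rewrite /q !fctE p0 expr0n mulr0 subrr subr_ge0 /c mulrAC -mulrA.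
move=> dpsi psi0 dpsiS h.
have H (p : R -> R) : (forall x : R, derivable p x 1) -> p 0 = 0 ->
    (forall t : R, `|derive1 p t| <= S * (`|t| ^+ n / n`!%:R)) ->
    forall h : R, 0 <= h -> `|p h| <= S * (h ^+ n.+1 / n.+1`!%:R).
  move=> dp p0 dpS {}h h0; rewrite ler_norml; apply/andP; split.
    rewrite lerNl; apply: (nonneg (\- p)) => //.
    - by move=> x; exact: derivableN.
    - by rewrite /= p0 oppr0.
    - move=> t; have := dpS t; rewrite ler_norml derive1E => /andP[+ _].
      by rewrite derive1E deriveN// lerNl.
  by apply: nonneg => // t; apply: le_trans (ler_norm _) (dpS t).
have [h0|h0] := leP 0 h; first by rewrite (ger0_norm h0); exact: H.
have dr := is_derive_opp_arg _ dpsi.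
rewrite (ltr0_norm h0) -{1}(opprK h); apply: (H (fun t => psi (- t))); rewrite ?oppr_ge0 ?(ltW h0)//.
- by rewrite oppr0.
- by move=> t; rewrite derive1E; case: (dr t) => _ ->; rewrite normrN; have := dpsiS (- t); rewrite normrN.
Qed.

Lemma is_derive_bigsum (R : realType) (n : nat) (g : 'I_n -> R -> R) (dg : 'I_n -> R) (x : R) :
  (forall i, is_derive x (1 : R) (g i) (dg i)) ->
  is_derive x (1 : R) (fun t => \sum_(i < n) g i t) (\sum_(i < n) dg i).
Proof.
move=> H; have := @is_derive_sum _ _ _ n g x 1 dg H.
by rewrite (_ : \sum_(i < n) g i = (fun t => \sum_(i < n) g i t))// funeqE => t; rewrite fct_sumE.
Qed.

Lemma derive1nSr (R : realType) (n : nat) (f : R -> R) :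
  derive1n n.+1 f = derive1n n (derive1 f).
Proof. by rewrite /derive1n iterSr. Qed.

(** As a function of h, the remainder of f vanishes at 0 and has the remainder of f' as its
    derivative, which allows induction on n. *)
Lemma taylor_remainder (R : realType) (n : nat) (f : R -> R) (S x h : R) :
  (forall k (y : R), (k <= n)%N -> derivable (derive1n k f) y 1) ->
  (forall y, `|derive1n n.+1 f y| <= S) ->
  `|f (x + h) - \sum_(k < n.+1) derive1n k f x / k`!%:R * h ^+ k|
     <= S * (`|h| ^+ n.+1 / n.+1`!%:R).
Proof.
elim: n f h => [|n IH] f h df fS.
  pose psi := (fun t => f (x + t)) - cst (f x).
  have dpsi (t : R) : is_derive t (1 : R) psi (derive1 f (x + t)).
    have := is_derive_shift x t (fun y => df 0 y (leqnn _)) => d.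
    by apply: is_derive_eq; rewrite subr0.
  rewrite big_ord1 /= fact0 divr1 expr0 mulr1.
  apply: (@increment_le_of_derive1 _ psi S 0).
  - by move=> t; case: (dpsi t).
  - by rewrite /psi !fctE addr0 subrr.
  - by move=> t; rewrite derive1E; case: (dpsi t) => _ ->; rewrite expr0 fact0 divr1 mulr1; exact: fS.
pose T := fun t => \sum_(k < n.+1) derive1n k.+1 f x / k.+1`!%:R * t ^+ k.+1.
pose psi := (fun t => f (x + t)) - cst (f x) - T.
have dT (t : R) : is_derive t (1 : R) T
    (\sum_(k < n.+1) derive1n k (derive1 f) x / k`!%:R * t ^+ k).
  apply: is_derive_bigsum => k.
  have := is_derive_monomial (derive1n k.+1 f x / k.+1`!%:R) t k => d.
  apply: is_derive_eq; rewrite -derive1nSr factS natrM.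
  by field; rewrite !gt_eqF ?ltr0n ?fact_gt0.
have dpsi (t : R) : is_derive t (1 : R) psi
    (derive1 f (x + t) - \sum_(k < n.+1) derive1n k (derive1 f) x / k`!%:R * t ^+ k).
  have := is_derive_shift x t (fun y => df 0 y (leq0n _)) => d.
  have := dT t => dTt.
  by apply: is_derive_eq; rewrite subr0.
rewrite big_ord_recl /= fact0 divr1 expr0 mulr1 opprD addrA.
apply: (@increment_le_of_derive1 _ psi S n.+1).
- by move=> t; case: (dpsi t).
- rewrite /psi /T !fctE addr0 subrr add0r big1 ?oppr0// => k _.
  by rewrite expr0n mulr0.
- move=> t; rewrite derive1E; case: (dpsi t) => _ ->; apply: IH.
  + by move=> k y kn; rewrite -derive1nSr; apply: df.
  + by move=> y; rewrite -derive1nSr; exact: fS.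
Qed.

(** The bounds are uniform in y, so the Taylor remainder is at most A * (r * |h|)^(n + 1), which
    tends to 0 when |h| < 1 / r. *)
Lemma analytic_of_derive1n_bound (R : realType) (f : R -> R) (A r : R) :
  0 < r -> 0 <= A -> (forall k (y : R), derivable (derive1n k f) y 1) ->
  (forall k (y : R), `|derive1n k.+1 f y| <= A * r ^+ k.+1 * k.+1`!%:R) ->
  analytic_fun f.
Proof.
move=> r0 A0 df fA x.
exists (fun k => derive1n k f x / k`!%:R), r^-1; first by rewrite invr_gt0.
move=> h hr.
have q1 : `|r * h| < 1.
  by rewrite normrM gtr0_norm// mulrC -ltr_pdivlMr// mul1r.
have cq : A * `|r * h| ^+ n.+1 @[n --> \oo] --> (0 : R).
  have := @cvg_geometric R A `|r * h|; rewrite normr_id => /(_ q1).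
  by rewrite -cvg_shiftS.
rewrite -cvg_shiftS /=.
apply/cvgrPdist_le => e e0; move/cvgrPdist_le : cq => /(_ _ e0); apply: filterS => n.
rewrite sub0r normrN => /(le_trans (ler_norm _)); apply: le_trans.
rewrite /pseries seriesEord /=.
apply: le_trans (taylor_remainder x h (fun k y _ => df k y) (fA n)) _.
rewrite normrM (gtr0_norm r0) exprMn.
have f0 : (n.+1)`!%:R != 0 :> R by rewrite gt_eqF// ltr0n fact_gt0.
have -> : A * r ^+ n.+1 * n.+1`!%:R * (`|h| ^+ n.+1 / n.+1`!%:R) =
  A * (r ^+ n.+1 * `|h| ^+ n.+1) by field.
by [].
Qed.

Lemma poly_class_analytic (R : realType) (I : Type) (u : I -> R -> R) (B M : R)
    (D d : nat) (N : R) (f : R -> R) :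
  (forall i x, `|u i x| <= B) -> 0 <= M ->
  (forall i (x : R), derivable (u i) x 1) ->
  (forall i, poly_class u B D.+1 (M * B) (derive1 (u i))) ->
  (forall x : R, derivable f x 1) -> poly_class u B d N (derive1 f) ->
  analytic_fun f.
Proof.
move=> uB M0 du ode df pf.
have N0 := poly_class_ge0 uB pf.
(* The added 1 makes r >= 1, so that the power can be raised from k to k + 1. *)
pose r := M * (d + D)%:R + 1.
have r1 : 1 <= r by rewrite lerDr mulr_ge0.
have r0 : 0 < r by exact: lt_le_trans r1.
apply: (@analytic_of_derive1n_bound _ f N r) => //.
  case=> [|k] y; first exact: df.
  by rewrite derive1nSr; case: (poly_class_derive1n uB M0 du ode k pf).
move=> k y; rewrite derive1nSr.
have [_ pk] := poly_class_derive1n uB M0 du ode k pf.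
apply: le_trans (poly_class_bound uB y pk) _.
have m0 : 0 <= M * (d + D)%:R by rewrite mulr_ge0.
apply: ler_pM => //.
- by rewrite mulr_ge0 ?exprn_ge0.
- apply: ler_wpM2l => //; apply: (@le_trans _ _ (r ^+ k)).
    by apply: lerXn2r; rewrite ?nnegrE// ?(ltW r0)// /r lerDl.
  by rewrite exprS ler_peMl// exprn_ge0// ltW.
- by rewrite ler_nat factS leq_pmull.
Qed.

(** Transports a polynomial in the u i to a larger system v containing the u i \o G; the size may
    change with the new bound, but the degree is kept. *)
Lemma poly_class_comp (R : realType) (I J : Type) (u : I -> R -> R) (v : J -> R -> R)
    (j : I -> J) (B B' : R) (d : nat) (N : R) (f G : R -> R) : B <= B' ->
  (forall i x, v (j i) x = u i (G x)) ->
  poly_class u B d N f -> exists N', poly_class v B' d N' (f \o G).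
Proof.
move=> BB' vu; elim => [c|i|{}d N1 N2 {}f g _ [N1' p1] _ [N2' p2]
    |d1 d2 N1 N2 {}f g _ [N1' p1] _ [N2' p2]|{}d d' {}N N' {}f dd' _ _ [N1 p1]].
- by exists `|c|; exact: poly_class_cst.
- exists B'; rewrite (_ : u i \o G = v (j i)); first exact: poly_class_var.
  by apply/funext => x; rewrite vu.
- by exists (N1' + N2'); exact: poly_classD p1 p2.
- by exists (N1' * N2'); exact: poly_classM p1 p2.
- by exists N1; exact: poly_class_le p1.
Qed.

(** * Linear growth along a cyclic group excludes distortion *)

Section cyclic_group.
Context (R : realType).
Variables (f g : circle R -> circle R).
Hypotheses (fK : cancel f g) (gK : cancel g f).

Lemma circle_invE : circle_inv f = g.
Proof.
rewrite /circle_inv; case: xgetP => [h _ [fh hf]|/(_ g)]; last by case.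
by apply/funext => x; rewrite -{1}(gK x) fh.
Qed.

Let P := circle_pow f.

Lemma circle_pow_succ (n : int) : P (n + 1) = f \o P n.
Proof.
case: n => n; first by rewrite -PoszD addn1.
rewrite /P /= circle_invE NegzE; apply/funext => x /=.
rewrite gK; case: n => [|n]; first by rewrite addNr.
by rewrite -addn1 PoszD opprD subrK -NegzE /= circle_invE.
Qed.

Lemma circle_pow_pred (n : int) : P (n - 1) = g \o P n.
Proof.
have := circle_pow_succ (n - 1); rewrite subrK => ->.
by apply/funext => x /=; rewrite fK.
Qed.

Lemma circle_powD (m n : int) : P (m + n) = P m \o P n.
Proof.
elim/int_ind: m => [|m IH|m IH]; first by rewrite add0r.
  rewrite -addn1 PoszD addrAC circle_pow_succ IH circle_pow_succ.
  by apply/funext.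
rewrite -addn1 PoszD opprD addrAC circle_pow_pred IH circle_pow_pred.
by apply/funext.
Qed.

Lemma circle_pow_in (Q : set (circle R -> circle R)) :
  (forall n, Q (iter n f)) -> (forall n, Q (iter n g)) -> forall m, Q (P m).
Proof. by move=> Qf Qg [m|m]; [exact: Qf|rewrite /P /= circle_invE; exact: (Qg m.+1)]. Qed.

Hypothesis (Gf : forall n, Diff1AC (iter n f)) (Gg : forall n, Diff1AC (iter n g)).
Variable c : R.
Hypotheses (c0 : 0 < c)
  (growth : forall n, c * n%:R <= log_variation (iter n f) id).

Let GP := circle_pow_in Gf Gg.

Lemma growth_not_torsion : ~ torsion f.
Proof.
move=> [n n0 fn]; have := growth n.
have -> : iter n f = id by exact/funext.
have [H _ _ _] := log_variation_pseudometric R; rewrite H; last exact: (Gf 0).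
by rewrite leNgt mulr_gt0// ltr0n.
Qed.

Lemma circle_pow_inj : injective P.
Proof.
suff H k : P k = id -> k = 0.
  move=> k l e; apply/eqP; rewrite -subr_eq0; apply/eqP/H.
  by rewrite circle_powD e -circle_powD subrr.
have key (n : nat) : iter n f = id -> n = 0%N.
  case: n => // n e; case: growth_not_torsion; exists n.+1 => // x.
  by rewrite e.
case: k => n e; first by rewrite (key n e).
have : P (n.+1%:Z) \o P (Negz n) = id by rewrite -circle_powD NegzE subrr.
by rewrite e => /(key n.+1).
Qed.

(** The powers of f are pairwise distinct, so the infimum runs over the single exponent m - n. *)
Lemma cayley_dist_circle_pow (m n : int) :
  cayley_dist f (P m) (P n) = `|m - n|%N%:R.
Proof.
rewrite /cayley_dist -[RHS]inf1; congr inf; apply/seteqP; split=> x.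
  move=> [k /= kn <-]; congr (_%:R); congr absz.
  by apply/(addIr n)/circle_pow_inj; rewrite subrK circle_powD.
by move=> ->; exists (m - n) => //; change (P (m - n) \o P n = P m); rewrite -circle_powD subrK.
Qed.

(** For a maximal d the upper bound is the triangle inequality, and the lower one compares d with
    [log_variation], which grows linearly. *)
Lemma undistorted_of_growth : ~ distorted_in (@Diff1AC R) (@rho R) f.
Proof.
move=> [d [[[d0 dge0 dsym dtri] dcont dinv] dmax]]; apply.
have [A0 [C0 le]] := dmax _ (log_variation_admissible R).
(* The constant supplied by maximality may have any sign; a positive one is needed for division. *)
pose A1 := Num.max A0 0 + 1.
have A10 : 0 < A1 by rewrite ltr_wpDl// le_max lexx orbT.
pose D := d f id.
have Gid : Diff1AC (@idfun (circle R)) := Gf 0.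
have Gf1 : Diff1AC f := Gf 1.
have D0 : 0 <= D by exact: dge0.
have dN n : d (iter n f) id <= D * n%:R.
  elim: n => [|n IH]; first by rewrite mulr0 (d0 _ (Gf 0)).
  have := dtri (iter n.+1 f) f id (Gf n.+1) Gf1 Gid.
  have -> : d (iter n.+1 f) f = d (iter n f) id.
    rewrite -(dinv (iter n f) id f)//; congr (d _ _).
    by apply/funext => x /=; rewrite -iterSr.
  move=> /le_trans; apply; rewrite -natr1 mulrDr mulr1; exact: lerD.
have dL n : c * n%:R <= A1 * d (iter n f) id + C0.
  apply: (le_trans (growth n)); apply: (le_trans (le _ _ (Gf n) Gid)).
  rewrite lerD2r ler_wpM2r//; first exact: dge0.
  by rewrite /A1 (le_trans (_ : A0 <= Num.max A0 0))// ?lerDl// le_max lexx.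
(* Right-invariance moves P n to the identity; for a negative exponent, a further translation and
   symmetry lead back to a positive one. *)
have dP m n : d (P m) (P n) = d (iter `|m - n|%N f) id.
  have -> : d (P m) (P n) = d (P (m - n)) id.
    rewrite -(dinv (P (m - n)) id (P n) (GP _) Gid (GP _)).
    by rewrite -circle_powD subrK.
  case: (m - n) => k //.
  rewrite -(dinv (P (Negz k)) id (P k.+1%:Z) (GP _) Gid (GP _)).
  by rewrite -circle_powD NegzE addNr dsym//; exact: (GP k.+1).
exists (D + A1 / c), (`|C0| / A1).
have Ac : 0 < A1 / c by rewrite divr_gt0.
have A_gt0 : 0 < D + A1 / c by rewrite ltr_wpDl.
have Cge0 : 0 <= `|C0| / A1 by rewrite divr_ge0// ltW.
split => // m n /=; rewrite -/P cayley_dist_circle_pow dP.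
set N := absz _; have N0 : 0 <= N%:R :> R by [].
split.
  rewrite lerBlDr.
  apply: (@le_trans _ _ (c / A1 * N%:R)).
    rewrite ler_wpM2r// -[leRHS]invf_div lef_pV2 ?posrE//.
    by rewrite lerDr.
  have h := dL N; rewrite mulrAC ler_pdivrMr// mulrDl.
  rewrite -[`|C0| / A1 * A1]mulrA mulVf ?gt_eqF// mulr1.
  by apply: (le_trans h); rewrite mulrC lerD2l; exact: ler_norm.
apply: (le_trans (dN N)); rewrite ler_wpDr// ler_wpM2r//.
by rewrite lerDl ltW.
Qed.

End cyclic_group.

(** * Iterates of maps with bounded Lipschitz derivative *)

Lemma lipschitz_of_derive1 (R : realType) (F : R -> R) (C : R) :
  (forall x : R, derivable F x 1) -> (forall x : R, `|derive1 F x| <= C) ->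
  forall x y : R, `|F x - F y| <= C * `|x - y|.
Proof.
move=> dF CF x y.
have := @taylor_remainder R 0 F C y (x - y).
have -> : y + (x - y) = x by ring.
rewrite big_ord1 /= fact0 !divr1 expr0 mulr1 expr1; apply.
  by move=> [|//] z _; exact: dF.
exact: CF.
Qed.

(** This class is stable under composition and implies both C1 and an absolutely continuous
    derivative, so it puts all iterates of f and of its inverse into [Diff1AC]. *)
Definition C11 (R : realType) (F : R -> R) :=
  (forall x : R, derivable F x 1) /\ exists C : R,
    (forall x : R, `|derive1 F x| <= C) /\
    (forall x y : R, `|derive1 F x - derive1 F y| <= C * `|x - y|).

Lemma C11_comp (R : realType) (F G : R -> R) : C11 F -> C11 G -> C11 (F \o G).
Proof.
move=> [dF [CF [bF lF]]] [dG [CG [bG lG]]].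
have CF0 : 0 <= CF by exact: le_trans (bF 0).
have CG0 : 0 <= CG by exact: le_trans (bG 0).
have dFG x : derive1 (F \o G) x = derive1 F (G x) * derive1 G x.
  by rewrite derive1_comp.
split; first by move=> x; apply/derivable1_diffP/differentiable_comp; apply/derivable1_diffP.
exists (CF * CG * (CG + 1)); split=> [x|x y].
  rewrite dFG normrM; apply: (@le_trans _ _ (CF * CG)); first exact: ler_pM.
  by rewrite ler_peMr ?mulr_ge0// lerDr.
rewrite !dFG.
have -> : derive1 F (G x) * derive1 G x - derive1 F (G y) * derive1 G y =
  (derive1 F (G x) - derive1 F (G y)) * derive1 G x
  + derive1 F (G y) * (derive1 G x - derive1 G y) by ring.
apply: le_trans (ler_normD _ _) _; rewrite !normrM.
apply: (@le_trans _ _ (CF * (CG * `|x - y|) * CG + CF * (CG * `|x - y|))).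
  apply: lerD; apply: ler_pM => //.
  apply: le_trans (lF _ _) _; apply: ler_wpM2l => //.
  exact: lipschitz_of_derive1.
have -> : CF * CG * (CG + 1) * `|x - y|
  = CF * (CG * `|x - y|) * CG + CF * (CG * `|x - y|) by ring.
by [].
Qed.

Lemma C11_id (R : realType) : C11 (@idfun R).
Proof.
split; first by move=> x; exact: derivable_id.
exists 1; split=> [x|x y]; rewrite !derive1_id ?normr1// subrr normr0.
by rewrite mulr_ge0.
Qed.

Lemma C11_iter (R : realType) (F : R -> R) n : C11 F -> C11 (iter n F).
Proof.
move=> cF; elim: n => [|n IH]; first exact: C11_id.
exact: (C11_comp cF IH).
Qed.

Lemma lipschitz_continuous (R : realType) (F : R -> R) (C : R) :
  (forall x y : R, `|F x - F y| <= C * `|x - y|) -> continuous F.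
Proof.
move=> lF x; apply/cvgrPdist_lt => e e0.
have C0 : 0 <= C.
  have := lF 1 0; rewrite subr0 normr1 mulr1; exact: le_trans.
have d0 : 0 < e / (C + 1) by rewrite divr_gt0// ltr_wpDl.
near=> y.
have xy : `|x - y| < e / (C + 1) by near: y; apply: cvgr_dist_lt => //; exact: cvg_id.
apply: le_lt_trans (lF x y) _.
apply: (@le_lt_trans _ _ ((C + 1) * `|x - y|)).
  by rewrite ler_wpM2r// lerDl.
by rewrite mulrC -ltr_pdivlMr// ltr_wpDl.
Unshelve. all: by end_near. Qed.

Lemma C11_C1 (R : realType) (F : R -> R) : C11 F -> C1_fun F.
Proof.
by move=> [dF [C [_ lF]]]; split; [exact: dF|exact: lipschitz_continuous lF].
Qed.

Lemma lipschitz_abs_continuous (R : realType) (F : R -> R) (C u v : R) :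
  (forall x y : R, `|F x - F y| <= C * `|x - y|) -> abs_continuous_on u v F.
Proof.
move=> lF e e0.
have C0 : 0 <= C.
  have := lF 1 0; rewrite subr0 normr1 mulr1; exact: le_trans.
have C10 : 0 < C + 1 by rewrite ltr_wpDl.
exists (e / (C + 1)); first by rewrite divr_gt0.
move=> n a b ab _ len.
apply: (@le_lt_trans _ _ (\sum_(i < n) (C + 1) * (b i - a i))).
  apply: ler_sum => i _; apply: le_trans (lF _ _) _.
  have [_ [abi _]] := ab i.
  rewrite ger0_norm ?subr_ge0//; apply: ler_wpM2r; first by rewrite subr_ge0.
  by rewrite lerDl.
by rewrite -mulr_sumr mulrC -ltr_pdivlMr.
Qed.

Lemma Diff1AC_of_C11 (R : realType) (f g : circle R -> circle R) (F G : R -> R) :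
  cancel f g -> cancel g f -> is_lift F f -> is_lift G g ->
  {homo F : x y / x < y} -> C11 F -> C11 G -> Diff1AC f.
Proof.
move=> fK gK lF lG incF cF cG; split.
  by exists g, F, G; split=> //; split=> //; exact: C11_C1.
rewrite (circle_derivE lF); have [_ [C [_ lipF]]] := cF.
exact: lipschitz_abs_continuous lipF.
Qed.

Lemma is_lift_iter (R : realType) (f : circle R -> circle R) (F : R -> R) n :
  is_lift F f -> is_lift (iter n F) (iter n f).
Proof.
move=> lF; elim: n => [|n IH]; first by split=> // x; exact: cvg_id.
exact: (is_lift_comp lF IH).
Qed.

Lemma Diff1AC_iter (R : realType) (f g : circle R -> circle R) (F G : R -> R) n :
  cancel f g -> cancel g f -> is_lift F f -> is_lift G g ->
  {homo F : x y / x < y} -> C11 F -> C11 G -> Diff1AC (iter n f).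
Proof.
move=> fK gK lF lG incF cF cG.
have can_iter (h k : circle R -> circle R) : cancel h k -> cancel (iter n h) (iter n k).
  move=> hk x; elim: n x => [//|m IH] x.
  by rewrite iterSr iterS hk IH.
apply: (@Diff1AC_of_C11 _ _ (iter n g) (iter n F) (iter n G)).
- exact: can_iter.
- exact: can_iter.
- exact: is_lift_iter.
- exact: is_lift_iter.
- by move=> x y xy; clear can_iter; elim: n => [//|m IH]; exact: incF.
- exact: C11_iter.
- exact: C11_iter.
Qed.

(** * Circle diffeomorphisms constructed from lifts *)

Definition circle_map (R : realType) (F : R -> R) (z : circle R) : circle R :=
  to_circle (F (sval z)).

Lemma is_lift_circle_map (R : realType) (F : R -> R) :
  continuous F -> (forall x : R, F (x + 1) = F x + 1) -> is_lift F (circle_map F).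
Proof.
move=> cF F1; split => // x; rewrite /circle_map /=; apply/to_circleP.
exists (Num.floor x).
have per (y : R) : F (y + 1) - (y + 1) = F y - y by rewrite F1; ring.
have := @periodic_int _ (fun y => F y - y) per (- Num.floor x) x.
rewrite /= mulrNz; lra.
Qed.

Lemma circle_map_can (R : realType) (F G : R -> R) :
  cancel F G -> continuous F -> continuous G ->
  (forall x : R, F (x + 1) = F x + 1) -> (forall x : R, G (x + 1) = G x + 1) ->
  cancel (circle_map F) (circle_map G).
Proof.
move=> FK cF cG F1 G1 z.
have [_ H] := is_lift_circle_map cG G1.
have zE : z = to_circle (sval z).
  case: z => x x01; apply: eq_exist => /=.
  have /andP[x0 x1] := x01.
  by rewrite (@floor_def _ x 0) ?subr0// x0 add0r x1.
by rewrite [circle_map F z]/(to_circle (F (sval z))) H FK -zE.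
Qed.

(** F multiplies distances by at least m, so its inverse is Lipschitz with constant 1 / m and
    differentiable; F is onto because F n = F 0 + n at integers n. *)
Lemma circle_diffeo_inverse (R : realType) (F : R -> R) (m : R) :
  0 < m -> (forall x : R, derivable F x 1) -> (forall x : R, m <= derive1 F x) ->
  (forall x : R, F (x + 1) = F x + 1) ->
  exists G : R -> R, [/\ cancel F G, cancel G F, {homo F : x y / x < y},
    (forall x : R, G (x + 1) = G x + 1) &
    forall y : R, is_derive y (1 : R) G (derive1 F (G y))^-1].
Proof.
move=> m0 dF mF F1.
have inc (x y : R) : x <= y -> m * (y - x) <= F y - F x.
  move=> xy; have [||c _ ->] := @MVT_segment _ F (derive1 F) x y xy.
  - by move=> z _; exact: is_derive1P.
  - by apply: derivable_within_continuous => z _; exact: dF.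
  - by rewrite ler_wpM2r// subr_ge0.
have incF : {homo F : x y / x < y}.
  move=> x y xy; rewrite -subr_gt0; apply: lt_le_trans (inc _ _ (ltW xy)).
  by rewrite mulr_gt0// subr_gt0.
have leF := le_mono incF.
have cF : continuous F by move=> x; apply/differentiable_continuous/derivable1_diffP.
have Fint (n : int) : F n%:~R = F 0 + n%:~R.
  have per (y : R) : F (y + 1) - (y + 1) = F y - y by rewrite F1; ring.
  have := @periodic_int _ (fun y => F y - y) per n 0.
  by rewrite /= add0r subr0; lra.
have surj (y : R) : exists x, F x = y.
  pose n := Num.floor (y - F 0).
  have /andP[n1 n2] : n%:~R <= y - F 0 < (n + 1)%:~R by exact: floor_itv.
  have nn : n%:~R <= (n + 1)%:~R :> R by rewrite ler_int lerDl.
  have [| |x _ Fx] := @IVT R F n%:~R (n + 1)%:~R y nn.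
  - by apply: derivable_within_continuous => z _; exact: dF.
  - rewrite !Fint; apply/andP; split; first by rewrite ge_min; apply/orP; left; lra.
    by rewrite le_max; apply/orP; right; lra.
  - by exists x.
have [G GK] := choice surj.
have FK : cancel F G by move=> x; apply: (inc_inj leF); rewrite GK.
have cG : continuous G.
  apply: (@lipschitz_continuous _ _ m^-1) => x y; rewrite mulrC ler_pdivlMr//.
  wlog xy : x y / G x <= G y.
    by move=> H; have [/H//|/ltW/H] := leP (G x) (G y); rewrite distrC [`|y - _|]distrC.
  have := inc _ _ xy; rewrite !GK => h.
  rewrite distrC ger0_norm ?subr_ge0// mulrC; apply: (le_trans h).
  by rewrite distrC ler_norm.
exists G; split => //.
  by move=> x; apply: (inc_inj leF); rewrite F1 !GK.
move=> y; rewrite -{1}(GK y).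
apply: (@is_derive_inverse _ F G); rewrite ?GK.
- by near=> x; exact: FK.
- by near=> x; exact: cF.
- exact: is_derive1P.
- by rewrite gt_eqF// (lt_le_trans m0).
Unshelve. all: by end_near. Qed.

(** * Variation accumulated along an orbit of disjoint intervals *)

(* The orbit P k < Q k < P k.+1 passes through (p, q) at time N.  For each start
   j <= N, the step l p - l q dominates the increment of the sum over (P j, Q j),
   since the intervals (P k, Q k) are disjoint in [0, 1] and the other terms
   therefore add up to eta / 2 at most. *)
Lemma total_variation_orbit_ge (R : realType) (l F G : R -> R) (p q eta : R) (N : nat) :
  cancel F G -> cancel G F -> {homo F : x y / x < y} -> {homo G : x y / x < y} ->
  F 0 = 0 -> F 1 = 1 -> 0 < p -> p < q -> q < 1 -> q < F p -> 0 <= eta ->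
  eta <= l p - l q ->
  (forall x y : R, F p <= x -> x <= y -> y <= 1 -> `|l x - l y| <= eta / 2 * (y - x)) ->
  (forall x y : R, 0 <= x -> x <= y -> y <= G q -> `|l x - l y| <= eta / 2 * (y - x)) ->
  ((eta / 2 * N%:R)%:E
     <= total_variation 0 1 (fun x => (\sum_(i < N) l (iter i F x))%R))%E.
Proof.
move=> FK GK incF incG F0 F1 p0 pq q1 qFp eta0 lpq lr ll.
have [->|] := posnP N; first by rewrite mulr0 total_variation_ge0.
case: N => // N _; set L := (X in total_variation 0 1 X).
have incFi i : {homo iter i F : x y / x < y} by move=> x y xy; elim: i => //= i; exact: incF.
have incGi i : {homo iter i G : x y / x < y} by move=> x y xy; elim: i => //= i; exact: incG.
have itK i x : iter i F (iter i G x) = x.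
  by elim: i x => // i IH x; rewrite iterSr [iter i.+1 G x]iterS GK IH.
have Fi0 i : iter i F 0 = 0 by elim: i => //= i ->.
have Fi1 i : iter i F 1 = 1 by elim: i => //= i ->.
have G0 : G 0 = 0 by rewrite -{1}F0 FK.
have G1 : G 1 = 1 by rewrite -{1}F1 FK.
have Gi0 i : iter i G 0 = 0 by elim: i => //= i ->.
have Gi1 i : iter i G 1 = 1 by elim: i => //= i ->.
pose P k := iter k F (iter N G p); pose Q k := iter k F (iter N G q).
have P0 k : 0 < P k by rewrite -(Fi0 k); apply: incFi; rewrite -(Gi0 N); exact: incGi.
have Q1 k : Q k < 1 by rewrite -[ltRHS](Fi1 k); apply: incFi; rewrite -[ltRHS](Gi1 N); exact: incGi.
have PQ k : P k < Q k by apply: incFi; apply: incGi.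
have iterGF i x : iter i G (F x) = F (iter i G x).
  by elim: i => //= i ->; rewrite FK GK.
have QP k : Q k < P k.+1.
  by rewrite /P iterSr -iterGF; apply: incFi; apply: incGi.
have PN : P N = p by exact: itK.
have QN : Q N = q by exact: itK.
have Pmono i j : (i <= j)%N -> P i <= P j.
  move=> /subnK <-; elim: (j - i)%N => // d IH; rewrite addSn.
  by apply: le_trans IH _; exact/ltW/(lt_trans (PQ _)).
have Qmono i j : (i <= j)%N -> Q i <= Q j.
  move=> /subnK <-; elim: (j - i)%N => // d IH; rewrite addSn.
  by apply: le_trans IH _; exact/ltW/(lt_trans (QP _)).
(* Before time N the interval lies to the left of G q, after it to the right of F p, where the two
   Lipschitz hypotheses apply. *)
have dk k : - (eta / 2 * (Q k - P k)) <= l (P k) - l (Q k).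
  have pos : 0 <= eta / 2 * (Q k - P k) by rewrite mulr_ge0 ?divr_ge0// subr_ge0 ltW.
  have [kN|kN|kN] := ltngtP k N.
  - have : `|l (P k) - l (Q k)| <= eta / 2 * (Q k - P k).
      apply: ll; [exact: ltW|exact: ltW|].
      have -> : G q = Q N.-1.
        have eN : N = N.-1.+1 by rewrite (ltn_predK kN).
        by rewrite /Q {2}eN iterSr itK.
      by apply: Qmono; rewrite -ltnS (ltn_predK kN).
    by rewrite ler_norml => /andP[].
  - have : `|l (P k) - l (Q k)| <= eta / 2 * (Q k - P k).
      apply: lr; [|exact: ltW|exact: ltW].
      have -> : F p = P N.+1 by rewrite -PN.
      exact: Pmono.
    by rewrite ler_norml => /andP[].
  - by move: pos; rewrite kN PN QN => pos; apply: le_trans lpq; lra.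
have iP i j : iter i F (P j) = P (i + j)%N by rewrite /P iterD.
have iQ i j : iter i F (Q j) = Q (i + j)%N by rewrite /Q iterD.
clearbody P Q.
(* Each length Q k - P k is less than P k.+1 - P k, and the latter telescope. *)
have sumQP (j m : nat) : \sum_(i < m) (Q (i + j)%N - P (i + j)%N) <= P (m + j)%N - P j.
  elim: m => [|m IH]; first by rewrite big_ord0 subrr.
  have := QP (m + j)%N; rewrite big_ord_recr addSn /=; move: IH; lra.
have LPQ j : (j <= N)%N -> eta / 2 <= `|L (Q j) - L (P j)|.
  move=> jN; rewrite distrC; apply: le_trans (ler_norm _); rewrite /L -sumrB.
  under eq_bigr do rewrite iP iQ.
  have i0 : (N - j < N.+1)%N by rewrite ltnS leq_subr.
  rewrite (bigD1 (Ordinal i0))//= subnK// PN QN.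
  have : \sum_(i < N.+1 | i != Ordinal i0) - (eta / 2 * (Q (i + j)%N - P (i + j)%N))
      <= \sum_(i < N.+1 | i != Ordinal i0) (l (P (i + j)%N) - l (Q (i + j)%N)).
    by apply: ler_sum.
  have : \sum_(i < N.+1 | i != Ordinal i0) (eta / 2 * (Q (i + j)%N - P (i + j)%N)) <= eta / 2.
    apply: (@le_trans _ _ (\sum_(i < N.+1) (eta / 2 * (Q (i + j)%N - P (i + j)%N)))).
      rewrite [leRHS](bigD1 (Ordinal i0))//= lerDr mulr_ge0 ?divr_ge0//.
      by rewrite subr_ge0 ltW.
    rewrite -mulr_sumr -[leRHS]mulr1 ler_wpM2l ?divr_ge0//.
    rewrite big_ord_recr /=; have := sumQP j N; have := P0 j; have := Q1 (N + j)%N; lra.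
  by rewrite sumrN; move: lpq; lra.
(* [P j, P j.+1] contains the interval (P j, Q j), across which L changes by at least eta / 2. *)
have TVj j : (j <= N.+1)%N -> ((eta / 2 * j%:R)%:E <= total_variation (P 0%N) (P j) L)%E.
  elim: j => [_|j IH jN]; first by rewrite mulr0 total_variationxx.
  rewrite (total_variationD L (Pmono _ _ (leq0n j)) (Pmono _ _ (leqnSn j))).
  rewrite -[j.+1%:R]natr1 mulrDr mulr1 EFinD; apply: leeD; first by apply: IH; exact: ltnW.
  rewrite (total_variationD L (ltW (PQ j)) (ltW (QP j))).
  apply: (@le_trans _ _ (total_variation (P j) (Q j) L)).
    apply: le_trans (total_variation_ge _ (ltW (PQ j))).
    by rewrite lee_fin; exact: LPQ.
  by rewrite leeDl// total_variation_ge0// ltW.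
have P01 : P 0%N <= P N.+1 by exact: Pmono.
have PN1 : P N.+1 <= 1 by exact/ltW/(lt_trans (PQ _)).
rewrite (total_variationD L (ltW (P0 0%N)) (le_trans P01 PN1)).
rewrite (total_variationD L P01 PN1).
apply: le_trans (TVj _ (leqnn _)) _.
have t0 := total_variation_ge0 L (ltW (P0 0%N)).
have t1 := total_variation_ge0 L PN1.
apply: (@le_trans _ _ (total_variation (P 0%N) (P N.+1) L + total_variation (P N.+1) 1 L)%E).
  by rewrite leeDl.
by rewrite leeDr.
Qed.

(** * Powers of sin (pi x) as bumps *)

Definition spi (R : realType) (x : R) : R := sin (pi * x).
Definition cpi (R : realType) (x : R) : R := cos (pi * x).

Lemma is_derive_pi_scale (R : realType) (x : R) : is_derive x (1 : R) (fun y => pi * y) pi.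
Proof.
rewrite (_ : (fun y => pi * y) = (pi : R) *: id)//.
by apply: is_derive_eq; rewrite /GRing.scale/= mulr1.
Qed.

Lemma is_derive_spi (R : realType) (x : R) : is_derive x (1 : R) (@spi R) (pi * cpi x).
Proof.
have := @is_derive1_comp _ sin (fun y => pi * y) x _ _ (is_derive_sin _) (is_derive_pi_scale x).
by rewrite mulrC.
Qed.

Lemma is_derive_cpi (R : realType) (x : R) : is_derive x (1 : R) (@cpi R) (- (pi * spi x)).
Proof.
have := @is_derive1_comp _ cos (fun y => pi * y) x _ _ (is_derive_cos _) (is_derive_pi_scale x).
by rewrite mulNr mulrC.
Qed.

Lemma cpi2Dspi2 (R : realType) (x : R) : cpi x ^+ 2 + spi x ^+ 2 = 1.
Proof. exact: cos2Dsin2. Qed.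

Lemma spi_le1 (R : realType) (x : R) : `|spi x| <= 1.
Proof. exact: sin_max. Qed.

Lemma cpi_le1 (R : realType) (x : R) : `|cpi x| <= 1.
Proof. exact: cos_max. Qed.

Lemma spi_addr1 (R : realType) (x : R) : spi (x + 1) = - spi x.
Proof. by rewrite /spi mulrDr mulr1 sinDpi. Qed.

Lemma cpi_addr1 (R : realType) (x : R) : cpi (x + 1) = - cpi x.
Proof. by rewrite /cpi mulrDr mulr1 cosDpi. Qed.

Lemma spi_onem (R : realType) (x : R) : spi (1 - x) = spi x.
Proof. by rewrite /spi mulrBr mulr1 sinB sinpi cospi mul0r mulN1r sub0r opprK. Qed.

Lemma cpi_onem (R : realType) (x : R) : cpi (1 - x) = - cpi x.
Proof. by rewrite /cpi mulrBr mulr1 cosB sinpi cospi mul0r addr0 mulN1r. Qed.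

Lemma spi_ge0 (R : realType) (x : R) : 0 <= x <= 1 -> 0 <= spi x.
Proof.
move=> /andP[x0 x1]; apply: sin_ge0_pi; have p0 := pi_ge0 R.
by rewrite mulr_ge0//= -[leRHS]mulr1 ler_wpM2l.
Qed.

Lemma ler_cpi (R : realType) (x y : R) : 0 <= x -> x <= y -> y <= 1 -> cpi y <= cpi x.
Proof.
move=> x0 xy y1; have p0 := pi_ge0 R.
have inpi (z : R) : 0 <= z -> z <= 1 -> pi * z \in `[0, pi].
  by move=> z0 z1; rewrite in_itv/= mulr_ge0//= -[leRHS]mulr1 ler_wpM2l.
have x1 : x <= 1 by exact: le_trans y1.
have y0 : 0 <= y by exact: le_trans xy.
by rewrite /cpi leNgt (@ltr_cos R) ?inpi// -leNgt ler_wpM2l.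
Qed.

(** An even exponent gives period 1 and a nonnegative bump; for k > 0 it is at least 4, so the
    second derivative vanishes at 0. The second derivative [bump2] is factored by cos^2 + sin^2 = 1,
    so that its sign is governed by (2 * k + 2) * cos^2 - 1. *)
Definition bump (R : realType) (k : nat) (x : R) : R := spi x ^+ (2 * k).+2.
Definition bump1 (R : realType) (k : nat) (x : R) : R :=
  (2 * k).+2%:R * pi * cpi x * spi x ^+ (2 * k).+1.
Definition bump2 (R : realType) (k : nat) (x : R) : R :=
  (2 * k).+2%:R * pi ^+ 2 * spi x ^+ (2 * k) * ((2 * k).+2%:R * cpi x ^+ 2 - 1).

Lemma is_derive_spi_exp (R : realType) (m : nat) (x : R) :
  is_derive x (1 : R) (fun y => spi y ^+ m.+1) (m.+1%:R * spi x ^+ m * (pi * cpi x)).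
Proof.
have ds := is_derive_spi x; have := is_deriveX m.+1 ds.
rewrite (_ : (fun y => spi y ^+ m.+1) = (@spi R) ^+ m.+1)//.
by apply/funext => y; rewrite exprfctE.
Qed.

Lemma is_derive_bump (R : realType) (k : nat) (x : R) :
  is_derive x (1 : R) (bump k) (bump1 k x).
Proof.
have := is_derive_spi_exp (2 * k).+1 x => h; apply: is_derive_eq.
by rewrite /bump1; ring.
Qed.

Lemma is_derive_bump1 (R : realType) (k : nat) (x : R) :
  is_derive x (1 : R) (bump1 k) (bump2 k x).
Proof.
have ds := is_derive_spi_exp (2 * k) x; have dc := is_derive_cpi x.
have := is_deriveM dc ds => h.
have := @is_deriveZ _ _ _ _ ((2 * k).+2%:R * pi) _ _ _ h.
rewrite (_ : _ \*: _ = bump1 k); last first.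
  apply/funext => y; rewrite /bump1.
  transitivity ((2 * k).+2%:R * pi * (cpi y * spi y ^+ (2 * k).+1)); first by [].
  by ring.
move=> hh; apply: (is_derive_eq hh).
rewrite /bump2 /GRing.scale/=.
have -> : ((2 * k).+2%:R * cpi x ^+ 2 - 1) = (2 * k).+1%:R * cpi x ^+ 2 - spi x ^+ 2 :> R.
  rewrite -natr1; have -> : spi x ^+ 2 = 1 - cpi x ^+ 2 by move: (cpi2Dspi2 x); lra.
  by ring.
by rewrite exprS; ring.
Qed.

Lemma bump_addr1 (R : realType) (k : nat) (x : R) : bump k (x + 1) = bump k x.
Proof.
rewrite /bump spi_addr1 exprNn -signr_odd /= negbK oddM /=.
by rewrite expr0 mul1r.
Qed.

Lemma bump1_addr1 (R : realType) (k : nat) (x : R) : bump1 k (x + 1) = bump1 k x.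
Proof.
rewrite /bump1 spi_addr1 cpi_addr1 exprNn -signr_odd /= oddM /= expr1; ring.
Qed.

Lemma bump1_onem (R : realType) (k : nat) (x : R) : bump1 k (1 - x) = - bump1 k x.
Proof. by rewrite /bump1 spi_onem cpi_onem; ring. Qed.

Lemma norm_bump2_le (R : realType) (k : nat) (x : R) :
  `|bump2 k x| <= ((2 * k).+2%:R * pi) ^+ 2 * `|spi x| ^+ (2 * k).
Proof.
have p0 := pi_ge0 R.
rewrite /bump2 normrM [X in X * _]normrM normrX.
rewrite [`|_ * pi ^+ 2|]ger0_norm ?mulr_ge0 ?exprn_ge0//.
have -> : ((2 * k).+2%:R * pi) ^+ 2 * `|spi x| ^+ (2 * k) =
  (2 * k).+2%:R * pi ^+ 2 * `|spi x| ^+ (2 * k) * (2 * k).+2%:R :> R by ring.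
apply: ler_wpM2l; first by rewrite !mulr_ge0 ?exprn_ge0.
have c2 : 0 <= cpi x ^+ 2 <= 1.
  by rewrite sqr_ge0 -(cpi2Dspi2 x) lerDl sqr_ge0.
have : 2 <= (2 * k).+2%:R :> R by rewrite ler_nat.
rewrite ler_norml; set N := _%:R; move: c2 => /andP[? ?] ?; nra.
Qed.

(** Exponential decay beats the quadratic factor: with b = - ln s0 one has exp (2 * k * b) >= (2 * k
    * b)^3 / 6, which leaves one power of k to spare. *)
Lemma exists_large_exponent (R : realType) (s0 a e : R) : 0 < s0 -> s0 < 1 -> 0 < a -> 0 < e ->
  exists k : nat, [/\ (0 < k)%N, ((2 * k).+2%:R)^-1 <= a &
    ((2 * k).+2%:R * pi) ^+ 2 * s0 ^+ (2 * k) <= e].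
Proof.
move=> s00 s01 a0 e0.
have b0 : 0 < - ln s0 by rewrite oppr_gt0 ln_lt0// s00.
pose b := - ln s0; rewrite -/b in b0; have p2 := pi_ge2 R.
have p0 : 0 < pi :> R by exact: lt_le_trans p2.
(* The last entry solves (4 * k * pi)^2 <= e * (2 * k * b)^3 / 6 for k; the entry 1 ensures 2 * k +
   2 <= 4 * k. *)
pose k := maxn 1 (maxn (Num.bound a^-1) (Num.bound (12 * pi ^+ 2 / (b ^+ 3 * e)))).
have k1 : (0 < k)%N by rewrite leq_max.
have ka : a^-1 < k%:R.
  apply: lt_le_trans (archi_boundP _) _; first by rewrite invr_ge0 ltW.
  by rewrite ler_nat !leq_max leqnn orbT.
have ke : 12 * pi ^+ 2 / (b ^+ 3 * e) < k%:R.
  apply: lt_le_trans (archi_boundP _) _.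
    by rewrite divr_ge0 ?mulr_ge0 ?exprn_ge0 ?ltW.
  by rewrite ler_nat !leq_max leqnn !orbT.
exists k; split => //.
  rewrite invf_ple ?posrE//; apply: le_trans (ltW ka) _; rewrite ler_nat; lia.
have sE : s0 ^+ (2 * k) = expR (- ((2 * k)%:R * b)).
  by rewrite -{1}(@lnK R s0) ?posrE// -expRM_natl /b mulrN opprK.
have kr1 : 1 <= k%:R :> R by rewrite ler1n.
clearbody k b.
have x0 : 0 <= (2 * k)%:R * b by rewrite mulr_ge0// ltW.
have h := expR_ge1Dxn 2 x0.
rewrite sE expRN ler_pdivrMr ?expR_gt0//.
apply: le_trans (_ : e * (((2 * k)%:R * b) ^+ 3 / 6) <= _); last first.
  rewrite ler_pM2l//; apply: le_trans h.
  by rewrite (_ : 3`! = 6)// lerDr.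
rewrite ltr_pdivrMr in ke; last by rewrite mulr_gt0// exprn_gt0.
have -> : (2 * k).+2%:R = 2 * k%:R + 2 :> R by rewrite -addn2 natrD natrM.
rewrite natrM.
have -> : e * ((2 * k%:R * b) ^+ 3 / 6) = 4 / 3 * k%:R ^+ 2 * (k%:R * (b ^+ 3 * e)) by field.
apply: (@le_trans _ _ (4 / 3 * k%:R ^+ 2 * (12 * pi ^+ 2))); last first.
  by rewrite ler_wpM2l ?mulr_ge0 ?exprn_ge0// ltW.
have -> : 4 / 3 * k%:R ^+ 2 * (12 * pi ^+ 2) = (4 * k%:R * pi) ^+ 2 :> R by field.
have q0 : 0 <= (2 * k%:R + 2) * pi :> R by apply: mulr_ge0; [lra|exact: ltW].
have q1 : 0 <= 4 * k%:R * pi :> R by apply: mulr_ge0; [lra|exact: ltW].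
by apply: lerXn2r; rewrite ?nnegrE// ler_pM2r//; lra.
Qed.

Lemma ltr_cpi (R : realType) (x y : R) : 0 <= x -> x < y -> y <= 1 -> cpi y < cpi x.
Proof.
move=> x0 xy y1; have p0 : 0 < pi :> R by apply: lt_le_trans (pi_ge2 R).
have inpi (z : R) : 0 <= z -> z <= 1 -> pi * z \in `[0, pi].
  by move=> z0 z1; rewrite in_itv/= mulr_ge0 ?(ltW p0)//= -[leRHS]mulr1 ler_wpM2l// ltW.
have x1 : x <= 1 by exact: le_trans (ltW xy) y1.
have y0 : 0 <= y by exact: le_trans x0 (ltW xy).
by rewrite /cpi (@ltr_cos R) ?inpi// ltr_pM2l.
Qed.

Lemma spi_cpi_half (R : realType) (x : R) : spi x = cpi (2^-1 - x).
Proof.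
rewrite /cpi mulrBr cosB cos_pihalf sin_pihalf mul0r add0r mul1r.
by rewrite /spi.
Qed.

Lemma cpiN (R : realType) (x : R) : cpi (- x) = cpi x.
Proof. by rewrite /cpi mulrN cosN. Qed.

Lemma spi_le_away_half (R : realType) (x theta : R) :
  0 <= theta -> 0 <= x <= 1 -> theta <= `|x - 2^-1| -> `|spi x| <= cpi theta.
Proof.
move=> t0 x01 tx; rewrite ger0_norm ?spi_ge0// spi_cpi_half.
have -> : cpi (2^-1 - x) = cpi `|x - 2^-1|.
  have [h|h] := leP 0 (x - 2^-1); last by rewrite (ltr0_norm h) opprB.
  by rewrite (ger0_norm h) -(cpiN (x - _)) opprB.
by apply: ler_cpi => //; rewrite ler_norml; move: x01 => /andP[? ?]; lra.
Qed.

Lemma bernoulli_le (R : realType) (x : R) (n : nat) : 0 <= x -> x <= 1 ->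
  1 - n%:R * x <= (1 - x) ^+ n.
Proof.
move=> x0 x1; elim: n => [|n IH]; first by rewrite mul0r subr0 expr0.
have a : 0 <= 1 - x by rewrite subr_ge0.
rewrite exprS -natr1; apply: le_trans (ler_wpM2l a IH).
have : 0 <= n%:R * x ^+ 2 by rewrite mulr_ge0 ?sqr_ge0.
rewrite expr2; lra.
Qed.

Lemma norm_integral_of_ge0 (R : realType) (f F : R -> R) (a b : R) : a < b ->
  (forall x : R, is_derive x (1 : R) F (f x)) -> continuous f ->
  (forall x, a <= x <= b -> 0 <= f x) ->
  F a <= F b /\ \int[lebesgue_measure]_(x in `[a, b]) `|f x| = F b - F a.
Proof.
move=> ab dF cf f0.
have ftc : (\int[lebesgue_measure]_(x in `[a, b]) (f x)%:E = (F b)%:E - (F a)%:E)%E.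
  apply: continuous_FTC2 => //.
  - exact: continuous_subspaceT.
  - have cF : continuous F.
      by move=> x; apply/differentiable_continuous/derivable1_diffP; case: (dF x).
    split; first by move=> x _; case: (dF x).
      exact: cvg_at_right_filter (cF a).
    exact: cvg_at_left_filter (cF b).
  - by move=> x _; rewrite derive1E; case: (dF x).
have e : \int[lebesgue_measure]_(x in `[a, b]) `|f x| = F b - F a.
  transitivity (\int[lebesgue_measure]_(x in `[a, b]) f x); last by rewrite /Rintegral ftc.
  by apply: eq_Rintegral => x; rewrite inE/= in_itv/= => /f0 fx; rewrite ger0_norm.
by split => //; rewrite -subr_ge0 -e; apply: Rintegral_ge0.
Qed.

Lemma norm_integral_of_le0 (R : realType) (f F : R -> R) (a b : R) : a < b ->
  (forall x : R, is_derive x (1 : R) F (f x)) -> continuous f ->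
  (forall x, a <= x <= b -> f x <= 0) ->
  F b <= F a /\ \int[lebesgue_measure]_(x in `[a, b]) `|f x| = F a - F b.
Proof.
move=> ab dF cf f0.
have dN (x : R) : is_derive x (1 : R) (- F) ((- f) x).
  by have := dF x => d; apply: is_deriveN.
have cN : continuous (- f) by move=> x; apply: continuousN; exact: cf.
have fN x : a <= x <= b -> 0 <= (- f) x by move=> /f0; rewrite fctE oppr_ge0.
have [h1 h2] := norm_integral_of_ge0 ab dN cN fN.
move: h1 h2; rewrite !fctE lerN2 => h1 h2; split => //.
transitivity (\int[lebesgue_measure]_(x in `[a, b]) `|(- f) x|).
  by apply: eq_Rintegral => x _; rewrite fctE normrN.
by rewrite h2; ring.
Qed.

Lemma Rintegral_split (R : realType) (f : R -> R) (a b c : R) : a <= b -> b <= c ->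
  continuous f ->
  \int[lebesgue_measure]_(x in `[a, c]) f x =
    \int[lebesgue_measure]_(x in `[a, b]) f x + \int[lebesgue_measure]_(x in `[b, c]) f x.
Proof.
move=> ab bc cf.
have int (u v : R) : (@lebesgue_measure R).-integrable `[u, v] (EFin \o f).
  by apply: continuous_compact_integrable; [exact: segment_compact|exact: continuous_subspaceT].
have := @Rintegral_itvB _ f (BLeft a) (BRight c) b (int a c).
rewrite !bnd_simp => /(_ ab bc) h.
rewrite -(@Rintegral_itv_obnd_cbnd _ b (BRight c) f); first by rewrite -h; ring.
by apply: integrableS (int b c) => //; exact: subset_itv_oc_cc.
Qed.

Lemma bump2_continuous (R : realType) (k : nat) : continuous (@bump2 R k).
Proof.
have cs : continuous (@spi R).
  by move=> x; apply/differentiable_continuous/derivable1_diffP; case: (is_derive_spi x).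
have cc : continuous (@cpi R).
  by move=> x; apply/differentiable_continuous/derivable1_diffP; case: (is_derive_cpi x).
move=> x; rewrite /bump2; apply: cvgM.
  apply: cvgM; first exact: cvg_cst.
  by apply: (@continuous_comp _ _ _ (@spi R) (fun y => y ^+ _)); [exact: cs|exact: exprn_continuous].
apply: cvgB; last exact: cvg_cst.
apply: cvgM; first exact: cvg_cst.
by apply: (@continuous_comp _ _ _ (@cpi R) (fun y => y ^+ _)); [exact: cc|exact: exprn_continuous].
Qed.

(** p and 1 - p are the zeros of the factor (2 * k + 2) * cos^2 - 1. On [0, 1], [bump1] rises from 0
    to its maximum at p, falls to the opposite value at 1 - p and rises back to 0, in total 1 + 2 +
    1 times the maximum. *)
Lemma bump_profile (R : realType) (k : nat) (p : R) : 0 < p -> p < 2^-1 ->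
  0 < cpi p -> cpi p ^+ 2 = (2 * k).+2%:R^-1 ->
  (forall x : R, `|bump1 k x| <= bump1 k p) /\
  \int[lebesgue_measure]_(x in `[0, 1]) `|bump2 k x| = 4 * bump1 k p.
Proof.
move=> p0 p12 r0 r2; set r := cpi p in r0 r2; set q := 1 - p.
have nn0 : 0 < (2 * k).+2%:R :> R by rewrite ltr0n.
have pq : p < q by rewrite /q; lra.
have q1 : q < 1 by rewrite /q; lra.
have rq : cpi q = - r by rewrite /q cpi_onem.
have A (x : R) : 0 <= (2 * k).+2%:R * pi ^+ 2 * spi x ^+ (2 * k).
  apply: mulr_ge0; first by apply: mulr_ge0 => //; exact: sqr_ge0.
  by rewrite exprM; apply: exprn_ge0; exact: sqr_ge0.
have big (x : R) : r <= cpi x \/ cpi x <= - r -> 0 <= bump2 k x.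
  move=> H; rewrite mulr_ge0// subr_ge0 -ler_pdivrMl// mulr1 -r2.
  by case: H => H; nra.
have small (x : R) : - r <= cpi x -> cpi x <= r -> bump2 k x <= 0.
  move=> H1 H2; rewrite mulr_ge0_le0// subr_le0 -ler_pdivlMl// mulr1 -r2.
  by nra.
have db := @is_derive_bump1 R k; have cb := @bump2_continuous R k.
have part1 (x y : R) : 0 <= x -> x < y -> y <= p -> bump1 k x <= bump1 k y /\
    \int[lebesgue_measure]_(x in `[x, y]) `|bump2 k x| = bump1 k y - bump1 k x.
  move=> x0 xy yp; apply: norm_integral_of_ge0 => // z /andP[xz zy].
  by apply: big; left; apply: ler_cpi; lra.
have part2 (x y : R) : p <= x -> x < y -> y <= q -> bump1 k y <= bump1 k x /\
    \int[lebesgue_measure]_(x in `[x, y]) `|bump2 k x| = bump1 k x - bump1 k y.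
  move=> x0 xy yp; apply: norm_integral_of_le0 => // z /andP[xz zy].
  by apply: small; [rewrite -rq|]; apply: ler_cpi; lra.
have part3 (x y : R) : q <= x -> x < y -> y <= 1 -> bump1 k x <= bump1 k y /\
    \int[lebesgue_measure]_(x in `[x, y]) `|bump2 k x| = bump1 k y - bump1 k x.
  move=> x0 xy yp; apply: norm_integral_of_ge0 => // z /andP[xz zy].
  by apply: big; right; rewrite -rq; apply: ler_cpi; lra.
have b0 : bump1 k (0 : R) = 0 by rewrite /bump1 /spi mulr0 sin0 expr0n /= mulr0.
have b1 : bump1 k (1 : R) = 0 by rewrite -(subr0 1) bump1_onem b0 oppr0.
have bq : bump1 k q = - bump1 k p by rewrite /q bump1_onem.
have M0 : 0 <= bump1 k p by rewrite -b0; case: (part1 0 p).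
split.
  have H (x : R) : 0 <= x <= 1 -> `|bump1 k x| <= bump1 k p.
    move=> /andP[x0 x1]; rewrite ler_norml.
    have part1' (u v : R) : 0 <= u -> u <= v -> v <= p -> bump1 k u <= bump1 k v.
      by move=> u0; rewrite le_eqVlt => /predU1P[->//|uv] vp; case: (part1 u v).
    have part2' (u v : R) : p <= u -> u <= v -> v <= q -> bump1 k v <= bump1 k u.
      by move=> u0; rewrite le_eqVlt => /predU1P[->//|uv] vp; case: (part2 u v).
    have part3' (u v : R) : q <= u -> u <= v -> v <= 1 -> bump1 k u <= bump1 k v.
      by move=> u0; rewrite le_eqVlt => /predU1P[->//|uv] vp; case: (part3 u v).
    have [xp|/ltW px] := leP x p.
      have := part1' 0 x (lexx _) x0 xp; have := part1' x p x0 xp (lexx _).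
      by rewrite b0 => -> ?; rewrite andbT; lra.
    have [xq|/ltW qx] := leP x q.
      have := part2' p x (lexx _) px xq; have := part2' x q px xq (lexx _).
      by rewrite bq => -> ->.
    have := part3' q x (lexx _) qx x1; have := part3' x 1 qx x1 (lexx _).
    by rewrite bq b1 => ? ->; lra.
  move=> x; have /andP[f0 f1] := frac_subproof x.
  have <- : bump1 k (x - (Num.floor x)%:~R) = bump1 k x.
    by rewrite -mulrNz; apply: periodic_int => y; exact: bump1_addr1.
  by apply: H; rewrite f0 ltW.
have cn : continuous (fun x : R => `|bump2 k x|).
  by move=> x; apply: continuous_comp; [exact: cb|exact: norm_continuous].
rewrite (@Rintegral_split _ _ 0 p 1)//; [|lra|lra].
rewrite (@Rintegral_split _ _ p q 1)//; [|lra|lra].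
have [_ ->] := part1 0 p (lexx _) p0 (lexx _).
have [_ ->] := part2 p q (lexx _) pq (lexx _).
have [_ ->] := part3 q 1 (lexx _) q1 (lexx _).
by rewrite b0 b1 bq; ring.
Qed.

(** The point p of steepest slope satisfies cos (pi p)^2 = 1 / (2 * k + 2) and so approaches 1/2 as
    k grows, while at distance theta from 1/2 the power of sin decays geometrically. *)
Lemma exists_bump (R : realType) (theta e : R) : 0 < theta -> theta < 2^-1 -> 0 < e ->
  exists (k : nat) (p : R), [/\ (0 < k)%N, 0 < p /\ 2^-1 - theta <= p < 2^-1,
    1 <= bump1 k p, (forall x : R, `|bump1 k x| <= bump1 k p) &
    \int[lebesgue_measure]_(x in `[0, 1]) `|bump2 k x| = 4 * bump1 k p /\
    forall x : R, 0 <= x <= 1 -> theta <= `|x - 2^-1| -> `|bump2 k x| <= e].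
Proof.
move=> t0 t12 e0.
have c1 : cpi (0 : R) = 1 by rewrite /cpi mulr0 cos0.
have chalf : cpi (2^-1 : R) = 0 by rewrite /cpi cos_pihalf.
have s00 : 0 < cpi theta by rewrite -chalf; apply: ltr_cpi; lra.
have s01 : cpi theta < 1 by rewrite -c1; apply: ltr_cpi; lra.
have st : 0 < spi theta.
  by rewrite spi_cpi_half -chalf; apply: ltr_cpi; lra.
have [k [k0 ka ke]] := exists_large_exponent s00 s01 (exprn_gt0 2 st) e0.
set nn := (2 * k).+2%:R in ka ke.
have nn2 : 2 <= nn by rewrite /nn ler_nat.
have nn0 : 0 < nn by lra.
pose r := Num.sqrt nn^-1.
have r0 : 0 < r by rewrite sqrtr_gt0 invr_gt0.
have r2 : r ^+ 2 = nn^-1 by rewrite sqr_sqrtr// invr_ge0 ltW.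
have r12 : r ^+ 2 <= 2^-1 by rewrite r2 lef_pV2 ?posrE.
have r1 : r < 1 by nra.
have p_gt0 : 0 < pi :> R by apply: lt_le_trans (pi_ge2 R).
pose p := acos r / pi.
have r11 : -1 <= r < 1 by rewrite r1 andbT; lra.
have r11' : -1 <= r <= 1 by rewrite (ltW r1) andbT; lra.
have p0 : 0 < p by rewrite divr_gt0// acos_gt0.
have p1 : p <= 1 by rewrite ler_pdivrMr// mul1r acos_lepi.
have cp : cpi p = r by rewrite /cpi /p mulrC divfK ?gt_eqF// acosK.
have p12 : p < 2^-1.
  rewrite ltNge; apply/negP => h.
  have : cpi p <= cpi 2^-1 by apply: ler_cpi; lra.
  by rewrite cp chalf; lra.
(* cos (pi (1/2 - theta)) = sin (pi theta) is at least r = cos (pi p), by the lower bound [ka] on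
   k. *)
have pt : 2^-1 - theta <= p.
  rewrite leNgt; apply/negP => h.
  have : cpi (2^-1 - theta) < cpi p by apply: ltr_cpi; lra.
  rewrite -spi_cpi_half cp => sr.
  by move: ka; rewrite -r2 => h2; nra.
have cp0 : 0 < cpi p by rewrite cp.
have cp2 : cpi p ^+ 2 = nn^-1 by rewrite cp.
have [bM int] := bump_profile p0 p12 cp0 cp2.
exists k, p; split => //; first by rewrite pt p12.
  have sp0 : 0 <= spi p by apply: spi_ge0; lra.
  have sp1 : spi p <= 1 by apply: le_trans (ler_norm _) (spi_le1 p).
  have sp2 : spi p ^+ 2 = 1 - nn^-1 by rewrite -cp2; move: (cpi2Dspi2 p); lra.
  have inn : 0 <= nn^-1 <= 1 by rewrite invr_ge0 ltW//= invf_le1//; lra.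
  (* Bernoulli with sin^2 = 1 - 1 / nn and nn = 2 * (k + 1): the even power is at least 1 - (k + 1)
     / nn = 1/2. *)
  have half : 2^-1 <= spi p ^+ (2 * k).+1.
    apply: (@le_trans _ _ (spi p ^+ (2 * k).+2)).
      have -> : (2 * k).+2 = (2 * k.+1)%N by rewrite mulnS.
      rewrite exprM sp2; case/andP: inn => i0 i1.
      apply: le_trans (bernoulli_le k.+1 i0 i1).
      have -> : nn = 2 * k.+1%:R by rewrite /nn -natrM mulnS.
      have k10 : k.+1%:R != 0 :> R by [].
      have -> : k.+1%:R * (2 * k.+1%:R)^-1 = 2^-1 :> R by field.
      lra.
    by rewrite exprS ler_piMl// exprn_ge0.
  have nr : 1 <= nn * r.
    have -> : nn = (r ^+ 2)^-1 by rewrite r2 invrK.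
    rewrite -ler_pdivrMl ?invr_gt0 ?exprn_gt0// invrK mulr1 expr2.
    by rewrite ler_piMr// ltW.
  rewrite /bump1 -/nn cp.
  have -> : nn * pi * r * spi p ^+ (2 * k).+1 = (nn * r) * (pi * spi p ^+ (2 * k).+1) by ring.
  have : 1 <= pi * spi p ^+ (2 * k).+1.
    apply: (@le_trans _ _ (2 * 2^-1)); first lra.
    by apply: ler_pM => //; exact: pi_ge2.
  by nra.
split => // x x01 tx; apply: le_trans (norm_bump2_le k x) _; apply: le_trans ke.
apply: ler_wpM2l; first exact: sqr_ge0.
apply: lerXn2r; rewrite ?nnegrE//; first exact: ltW.
by apply: spi_le_away_half => //; exact: ltW.
Qed.

(** * Analyticity of trigonometric antiderivatives and of inverse maps *)

Definition trig (R : realType) (b : bool) : R -> R := if b then @spi R else @cpi R.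

Lemma trig_le1 (R : realType) (b : bool) (x : R) : `|trig b x| <= 1.
Proof. by case: b; [exact: spi_le1|exact: cpi_le1]. Qed.

Lemma is_derive_trig (R : realType) (b : bool) (x : R) :
  is_derive x (1 : R) (trig b) ((if b then pi else - pi) * trig (~~ b) x).
Proof.
by case: b => /=; [exact: is_derive_spi|rewrite mulNr; exact: is_derive_cpi].
Qed.

Lemma trig_poly_analytic (R : realType) (d : nat) (N : R) (f f1 : R -> R) :
  (forall x : R, is_derive x (1 : R) f (f1 x)) -> poly_class (@trig R) 1 d N f1 ->
  analytic_fun f.
Proof.
move=> df pf1.
have pi0 : 0 <= pi :> R := pi_ge0 R.
have e1 : derive1 f = f1 by apply: funext => x; rewrite derive1E; exact: derive_val.
apply: (@poly_class_analytic R bool (@trig R) 1 pi 0 d N).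
- exact: trig_le1.
- exact: pi0.
- by move=> b x; apply: ex_derive; exact: is_derive_trig.
- move=> b; have -> : derive1 (@trig R b) = fun x : R => (if b then pi else - pi) * trig (~~ b) x.
    by apply: funext => x; rewrite derive1E; apply: derive_val; exact: is_derive_trig.
  apply: (poly_class_le (leqnn 1) (N := `|if b then pi else - pi| * 1)).
    by case: b; rewrite ?normrN ger0_norm.
  exact: (poly_classZ _ (poly_class_var _ _ _)).
- by move=> x; exact: ex_derive.
- by rewrite e1.
Qed.

(* The functions sin (pi G), cos (pi G) and 1 / F1(G) = G' satisfy a polynomial
   ODE. *)
Lemma trig_poly_inverse_analytic (R : realType) (d : nat) (N : R) (F1 F2 G : R -> R) :
  (forall x : R, 2^-1 <= F1 x) -> (forall x : R, is_derive x (1 : R) F1 (F2 x)) ->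
  poly_class (@trig R) 1 d N F2 ->
  (forall y : R, is_derive y (1 : R) G (F1 (G y))^-1) -> analytic_fun G.
Proof.
move=> F1h dF1 pF2 dG.
pose w y := (F1 (G y))^-1.
(* [Some] indexes the trigonometric functions composed with G, [None] the derivative w of G; F1 >=
   1/2 bounds all of them by 2. *)
pose v (o : option bool) := if o is Some b then trig b \o G else w.
have F10 y : 0 < F1 y by apply: lt_le_trans (F1h y).
have [N' pF2G] : exists N', poly_class v 2 d N' (F2 \o G).
  by apply: (@poly_class_comp R bool (option bool) (@trig R) v Some 1) pF2 => //; lra.
have vB o y : `|v o y| <= 2.
  case: o => [b|] /=; first by apply: le_trans (trig_le1 b _) _; lra.
  rewrite /w ger0_norm ?invr_ge0; last exact: ltW.
  by rewrite -[2 in leRHS]invrK lef_pV2 ?posrE// invr_gt0.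
have N'0 : 0 <= N' := poly_class_ge0 vB pF2G.
have pi0 : 0 <= pi :> R := pi_ge0 R.
have dw (y : R) : is_derive y (1 : R) w (- (w y ^+ 3 * (F2 \o G) y)).
  have dc : is_derive y (1 : R) (F1 \o G) (F2 (G y) * (F1 (G y))^-1).
    exact: is_derive1_comp.
  have nz : (F1 \o G) y != 0 by rewrite gt_eqF// F10.
  have := is_deriveV nz dc.
  move=> h; apply: (is_derive_eq h); rewrite /w /=; set a := F1 _.
  have a0 : a != 0 by rewrite gt_eqF// F10.
  by rewrite /GRing.scale /=; field.
have dtG b (y : R) : is_derive y (1 : R) (@trig R b \o G)
    (((if b then pi else - pi) * trig (~~ b) (G y)) * w y).
  by apply: is_derive1_comp => //; exact: is_derive_trig.
have pw := poly_class_var v 2 None.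
have M0 : 0 <= pi + 4 * N' :> R by apply: addr_ge0 => //; rewrite mulr_ge0.
have dv o (y : R) : derivable (v o) y 1.
  case: o => [b|].
    by case: (dtG b y).
  by case: (dw y).
(* The degrees are 2 for pi * trig * w and d + 3 for w' = - w^3 * F2 (G). *)
have ode o : poly_class v 2 (maxn 1 (d + 2)).+1 ((2 * pi + 4 * N') * 2) (derive1 (v o)).
  case: o => [b|].
    have -> : derive1 (v (Some b)) =
        ((fun y => (if b then pi else - pi) * v (Some (~~ b)) y) \* w).
      by apply: funext => y; rewrite derive1E; apply: derive_val; exact: dtG.
    apply: (poly_class_le (d := 2) (N := `|if b then pi else - pi| * 2 * 2)).
    - by rewrite ltnS leq_maxl.
    - have -> : `|if b then pi else - pi| = pi :> R by case: b; rewrite ?normrN ger0_norm.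
      lra.
    - exact: (poly_classM (poly_classZ _ (poly_class_var _ _ (Some (~~ b)))) pw).
  have -> : derive1 w = fun y => -1 * ((fun y => w y ^+ 3) \* (F2 \o G)) y.
    by apply: funext => y; rewrite derive1E mulN1r; apply: derive_val; exact: dw.
  apply: (poly_class_le (d := 3 * 1 + d) (N := `|-1| * (2 ^+ 3 * N'))).
  - lia.
  - by rewrite normrN1; lra.
  - exact: (poly_classZ _ (poly_classM (poly_class_exp 3 pw) pF2G)).
apply: (@poly_class_analytic R (option bool) v 2 (2 * pi + 4 * N') (maxn 1 (d + 2)) 1 2).
- exact: vB.
- lra.
- exact: dv.
- exact: ode.
- by move=> y; exact: ex_derive.
- have -> : derive1 G = w by apply: funext => y; rewrite derive1E; apply: derive_val; exact: dG.
  exact: pw.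
Qed.

(** * The map with two bumps and its inverse *)

Definition bump_map (R : realType) (al be : R) (k : nat) (x : R) : R :=
  x + al * bump 1 x + be * bump k x.

Definition bump_map1 (R : realType) (al be : R) (k : nat) (x : R) : R :=
  1 + al * bump1 1 x + be * bump1 k x.

Definition bump_map2 (R : realType) (al be : R) (k : nat) (x : R) : R :=
  al * bump2 1 x + be * bump2 k x.

Section bump_map_theory.
Context (R : realType).
Variables (al be : R) (k : nat).
Local Notation F := (bump_map al be k).
Local Notation F1 := (bump_map1 al be k).
Local Notation F2 := (bump_map2 al be k).

Lemma is_derive_bump_map (x : R) : is_derive x (1 : R) F (F1 x).
Proof.
have d1 := is_derive_bump 1 x; have d2 := is_derive_bump k x.
rewrite /bump_map.
apply: is_derive_eq; rewrite /bump_map1 /GRing.scale /=; ring.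
Qed.

Lemma is_derive_bump_map1 (x : R) : is_derive x (1 : R) F1 (F2 x).
Proof.
have d1 := is_derive_bump1 1 x; have d2 := is_derive_bump1 k x.
rewrite /bump_map1.
apply: is_derive_eq; rewrite /bump_map2 /GRing.scale /=; ring.
Qed.

Lemma derivable_bump_map (x : R) : derivable F x 1.
Proof. by case: (is_derive_bump_map x). Qed.

Lemma derive1_bump_map : derive1 F = F1.
Proof.
by apply: funext => x; rewrite derive1E; apply: derive_val; exact: is_derive_bump_map.
Qed.

Lemma bump_map2_continuous : continuous F2.
Proof.
by move=> x; apply: cvgD; apply: cvgM; [exact: cvg_cst|exact: bump2_continuous
  |exact: cvg_cst|exact: bump2_continuous].
Qed.

Lemma derivable_bump_map1 (x : R) : derivable F1 x 1.
Proof. by case: (is_derive_bump_map1 x). Qed.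

Lemma derive1_bump_map1 : derive1 F1 = F2.
Proof.
by apply: funext => x; rewrite derive1E; apply: derive_val; exact: is_derive_bump_map1.
Qed.

Lemma bump_map_addr1 (x : R) : F (x + 1) = F x + 1.
Proof. by rewrite /bump_map !bump_addr1; ring. Qed.

Lemma bump_map0 : F 0 = 0.
Proof. by rewrite /bump_map /bump /spi mulr0 sin0 !expr0n /= !mulr0 !addr0. Qed.

Lemma bump_map_1 : F 1 = 1.
Proof. by rewrite -[X in F X]add0r bump_map_addr1 bump_map0 add0r. Qed.

Lemma bump_map10 : F1 0 = 1.
Proof. by rewrite /bump_map1 /bump1 /spi mulr0 sin0 !expr0n /= !mulr0 !addr0. Qed.

Lemma bump_map20 : (0 < k)%N -> F2 0 = 0.
Proof.
move=> k0; rewrite /bump_map2 /bump2 /spi mulr0 sin0 !expr0n /= muln_eq0 /= -leqn0 leqNgt k0 /=.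
by rewrite !(mulr0, mul0r) addr0.
Qed.

Lemma poly_class_bump_map1 : exists d N, poly_class (@trig R) 1 d N F1.
Proof.
have pb j : exists d N, poly_class (@trig R) 1 d N (bump1 j).
  have p := poly_classM (poly_classZ ((2 * j).+2%:R * pi) (poly_class_var (@trig R) 1 false))
    (poly_class_exp (2 * j).+1 (poly_class_var (@trig R) 1 true)).
  by eexists; eexists; exact: p.
have [d1 [N1 p1]] := pb 1%N; have [d2 [N2 p2]] := pb k.
exists (maxn d1 d2); eexists.
have h1 : poly_class (@trig R) 1 (maxn d1 d2) (`|1| + `|al| * N1) (fun x => 1 + al * bump1 1 x).
  apply: poly_classD; first exact: (poly_class_le (leq0n _) (lexx _) (poly_class_cst _ _ _)).
  exact: (poly_class_le (leq_maxl d1 d2) (lexx _) (poly_classZ _ p1)).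
exact: (poly_classD h1 (poly_class_le (leq_maxr d1 d2) (lexx _) (poly_classZ _ p2))).
Qed.

Lemma poly_class_bump_map2 : exists d N, poly_class (@trig R) 1 d N F2.
Proof.
have pb j : exists d N, poly_class (@trig R) 1 d N (bump2 j).
  have p := poly_classM
    (poly_classZ ((2 * j).+2%:R * pi ^+ 2)
      (poly_class_exp (2 * j) (poly_class_var (@trig R) 1 true)))
    (poly_classD (poly_classZ (2 * j).+2%:R
        (poly_class_exp 2 (poly_class_var (@trig R) 1 false)))
      (poly_class_le (leq0n _) (lexx _) (poly_class_cst (@trig R) 1 (-1)))).
  by eexists; eexists; exact: p.
have [d1 [N1 p1]] := pb 1%N; have [d2 [N2 p2]] := pb k.
exists (maxn d1 d2); eexists.
have h1 := poly_class_le (leq_maxl d1 d2) (lexx _) (poly_classZ al p1).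
exact: (poly_classD h1 (poly_class_le (leq_maxr d1 d2) (lexx _) (poly_classZ _ p2))).
Qed.

Lemma bump_map_analytic : analytic_fun F.
Proof.
have [d [N p]] := poly_class_bump_map1.
exact: (trig_poly_analytic is_derive_bump_map p).
Qed.

Lemma bump_map_inverse : (forall x, 2^-1 <= F1 x) ->
  exists G : R -> R, [/\ cancel F G, cancel G F, {homo F : x y / x < y}, {homo G : x y / x < y} &
    (forall x : R, G (x + 1) = G x + 1) /\
    forall y : R, is_derive y (1 : R) G (F1 (G y))^-1].
Proof.
move=> F1h.
have [||||G [FK GK incF G1 dG]] := @circle_diffeo_inverse R F 2^-1.
- by rewrite invr_gt0.
- exact: derivable_bump_map.
- by rewrite derive1_bump_map.
- exact: bump_map_addr1.
exists G; split => //; last by split => // y; rewrite -derive1_bump_map.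
by move=> x y xy; rewrite -(leW_mono (le_mono incF)) !GK.
Qed.

Lemma C11_bump_map : C11 F.
Proof.
have [d1 [N1 p1]] := poly_class_bump_map1; have [d2 [N2 p2]] := poly_class_bump_map2.
split; first exact: derivable_bump_map.
exists (Num.max N1 N2); rewrite derive1_bump_map; split=> x.
  by apply: le_trans (poly_class_bound (@trig_le1 R) x p1) _; rewrite le_max lexx.
apply: lipschitz_of_derive1; first exact: derivable_bump_map1.
move=> y; rewrite derive1_bump_map1.
by apply: le_trans (poly_class_bound (@trig_le1 R) y p2) _; rewrite le_max lexx orbT.
Qed.

Lemma bump_map_inverse_analytic (G : R -> R) : (forall x, 2^-1 <= F1 x) ->
  (forall y : R, is_derive y (1 : R) G (F1 (G y))^-1) -> analytic_fun G.
Proof.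
move=> F1h dG; have [d [N p]] := poly_class_bump_map2.
exact: (trig_poly_inverse_analytic F1h is_derive_bump_map1 p).
Qed.
End bump_map_theory.

(** G' = 1 / F' (G): inversion is 4-Lipschitz above 1/2, F' is C-Lipschitz and G is 2-Lipschitz,
    whence the constant 8 * C. *)
Lemma C11_inverse (R : realType) (F G : R -> R) : C11 F ->
  (forall x, 2^-1 <= derive1 F x) ->
  (forall y : R, is_derive y (1 : R) G (derive1 F (G y))^-1) -> C11 G.
Proof.
move=> [dF [C [FC FL]]] F1h dG.
have C0 : 0 <= C by apply: le_trans (FC 0).
have derG (y : R) : derivable G y 1 by case: (dG y).
have G1 : derive1 G = fun y => (derive1 F (G y))^-1.
  by apply: funext => y; rewrite derive1E; apply: derive_val; exact: dG.
have F0 x : 0 < derive1 F x by apply: lt_le_trans (F1h x).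
have i2 x : (derive1 F x)^-1 <= 2.
  by rewrite -[2 in leRHS]invrK lef_pV2 ?posrE// invr_gt0.
have i0 x : 0 <= (derive1 F x)^-1 by rewrite invr_ge0 ltW.
have GL (x y : R) : `|G x - G y| <= 2 * `|x - y|.
  by apply: lipschitz_of_derive1 => // z; rewrite G1 ger0_norm.
split => //; exists (2 + 8 * C); rewrite G1; split => x.
  by rewrite ger0_norm//; apply: le_trans (i2 _) _; lra.
move=> y; set a := derive1 F _; set b := derive1 F (G y).
have -> : a^-1 - b^-1 = (b - a) * (a^-1 * b^-1) by field; rewrite !gt_eqF ?F0.
rewrite normrM (ger0_norm (mulr_ge0 (i0 _) (i0 _))) distrC.
have h1 : a^-1 * b^-1 <= 4 by have := ler_pM (i0 _) (i0 _) (i2 (G x)) (i2 (G y)); rewrite -/a -/b; lra.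
have h2 := FL (G x) (G y).
have h3 := GL x y.
have h4 : `|a - b| <= C * (2 * `|x - y|) by apply: le_trans h2 _; exact: ler_wpM2l.
have h5 := ler_pM (normr_ge0 _) (mulr_ge0 (i0 _) (i0 _)) h4 h1.
by apply: le_trans h5 _; have := normr_ge0 (x - y); lra.
Qed.

(** * Logarithmic derivatives of iterates *)

Lemma derive1_iter (R : realType) (F : R -> R) (n : nat) (x : R) :
  (forall x : R, derivable F x 1) ->
  derivable (iter n F) x 1 /\
  derive1 (iter n F) x = \prod_(i < n) derive1 F (iter i F x).
Proof.
move=> dF; elim: n => [|n [dn en]].
  rewrite big_ord0; split; first exact: derivable_id.
  by rewrite (_ : iter 0 F = id)// derive1_id.
have -> : iter n.+1 F = F \o iter n F by [].
split; last by rewrite derive1_comp// big_ord_recr /= mulrC en.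
apply/derivable1_diffP/differentiable_comp; first exact/derivable1_diffP.
by apply/derivable1_diffP; exact: dF.
Qed.

Lemma ln_prod (R : realType) (n : nat) (a : nat -> R) : (forall i, 0 < a i) ->
  ln (\prod_(i < n) a i) = \sum_(i < n) ln (a i).
Proof.
move=> a0; elim: n => [|n IH]; first by rewrite !big_ord0 ln1.
by rewrite !big_ord_recr /= lnM ?IH// posrE ?prodr_gt0.
Qed.

Lemma log_deriv_iter (R : realType) (f : circle R -> circle R) (F : R -> R) (n : nat) :
  is_lift F f -> (forall x : R, derivable F x 1) -> (forall x, 0 < derive1 F x) ->
  log_deriv (iter n f) = fun x => \sum_(i < n) ln (derive1 F (iter i F x)).
Proof.
move=> lF dF F0; apply: funext => x.
rewrite /log_deriv (circle_derivE (is_lift_iter n lF)).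
have [_ ->] := derive1_iter n x dF.
exact: (ln_prod n (fun i => F0 _)).
Qed.

Lemma log_deriv_iter_sub_id (R : realType) (f : circle R -> circle R) (F : R -> R) (n : nat) :
  is_lift F f -> (forall x : R, derivable F x 1) -> (forall x, 0 < derive1 F x) ->
  log_deriv (iter n f) \- log_deriv id = fun x => \sum_(i < n) ln (derive1 F (iter i F x)).
Proof.
move=> lF dF F0; have id0 := log_deriv_iter 0 lF dF F0.
rewrite (log_deriv_iter n lF dF F0); apply: funext => x.
rewrite -[log_deriv id]/(log_deriv (iter 0 f)) id0.
by rewrite -[LHS]/(_ - \sum_(i < 0) _) big_ord0 subr0.
Qed.

Lemma cpi_half (R : realType) : cpi 2^-1 = 0 :> R.
Proof. exact: cos_pihalf. Qed.

Lemma cpi_ge0 (R : realType) (x : R) : 0 <= x -> x <= 2^-1 -> 0 <= cpi x.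
Proof. by move=> x0 x1; rewrite -(cpi_half R); apply: ler_cpi => //; lra. Qed.

Lemma bump_ge0 (R : realType) (k : nat) (x : R) : 0 <= bump k x.
Proof.
have -> : bump k x = (spi x ^+ k.+1) ^+ 2 by rewrite -exprM /bump; congr (_ ^+ _); lia.
exact: sqr_ge0.
Qed.

(** * Quantitative estimates for the map with two bumps *)

Section steep_bump.
Context (R : realType).
Variables (mu al be : R) (k : nat) (p : R).
(** The displacement near 1/2 is at least al / 2 = 4 * theta, twice the width of the neighbourhood
    of radius theta. *)
Local Notation theta := (al / 8).
Local Notation F := (bump_map al be k).
Local Notation F1 := (bump_map1 al be k).
Local Notation F2 := (bump_map2 al be k).
Hypotheses (mu0 : 0 < mu) (mu_le : mu <= 4^-1) (p0 : 0 < p) (p_lt : p < 2^-1).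
Hypotheses (al0 : 0 < al) (al_pi2 : al * (16 * pi ^+ 2) = mu / 8).
Hypotheses (M1 : 1 <= bump1 k p) (bM : forall x : R, `|bump1 k x| <= bump1 k p).
Hypothesis beM : be * bump1 k p = mu.
Hypothesis small : forall x : R, 0 <= x <= 1 -> theta <= `|x - 2^-1| ->
  `|bump2 k x| <= 8^-1.

Let pi2 : 2 <= pi :> R := pi_ge2 R.

Let pi0 : 0 < pi :> R := pi_gt0 R.

Let al_pi : al * pi <= mu / 256.
Proof.
have h : al * pi * pi = mu / 128 by have := al_pi2; lra.
have := ler_wpM2l (ltW (mulr_gt0 al0 pi0)) pi2; lra.
Qed.

Let M0 : 0 < bump1 k p. Proof. exact: lt_le_trans M1. Qed.

Let be0 : 0 < be. Proof. by rewrite -(pmulr_lgt0 _ M0) beM. Qed.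

Let be_le : be <= mu.
Proof. by rewrite -beM ler_peMr// ltW. Qed.

Let norm_bump11 (x : R) : `|bump1 1 x| <= 4 * pi.
Proof.
have -> : bump1 1 x = 4 * pi * (cpi x * spi x ^+ 3) by rewrite mulrA.
rewrite normrM [X in _ * X]normrM normrX ger0_norm; last by rewrite mulr_ge0// ltW.
have c := cpi_le1 x; have s := exprn_ile1 3 (normr_ge0 (spi x)) (spi_le1 x).
have cs : `|cpi x| * `|spi x| ^+ 3 <= 1 by rewrite mulr_ile1// exprn_ge0.
by apply: ler_piMr cs; rewrite mulr_ge0// ltW.
Qed.

Let norm_bump21 (x : R) : `|bump2 1 x| <= 16 * pi ^+ 2.
Proof.
apply: le_trans (norm_bump2_le 1 x) _.
have s := exprn_ile1 2 (normr_ge0 (spi x)) (spi_le1 x).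
have -> : ((2 * 1).+2%:R * pi) ^+ 2 = 16 * pi ^+ 2 :> R by ring.
by apply: ler_piMr => //; rewrite mulr_ge0// sqr_ge0.
Qed.

Lemma norm_bump_map2_le (x : R) : `|F2 x| <= mu / 8 + be * `|bump2 k x|.
Proof.
apply: le_trans (ler_normD _ _) _; rewrite (normrM al) (normrM be) (gtr0_norm al0) (gtr0_norm be0).
by rewrite lerD2r -al_pi2 ler_wpM2l// ltW.
Qed.

(** The wide bump changes the derivative by at most 4 * al * pi <= mu / 64, the narrow one by at
    most mu <= 1/4. *)
Lemma steep_bump_derive_ge (x : R) : 2^-1 <= F1 x.
Proof.
have h1 : `|al * bump1 1 x| <= 4 * (al * pi).
  by rewrite normrM gtr0_norm// mulrCA ler_wpM2l// ltW.
have h2 : `|be * bump1 k x| <= mu.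
  by rewrite normrM gtr0_norm// -beM ler_wpM2l// ltW.
move: h1 h2; rewrite !ler_norml /bump_map1 => /andP[h1 _] /andP[h2 _].
have := al_pi; have := mu_le; have := mu0; lra.
Qed.

(** The slopes of both bumps are odd about 1/2, so F1 is 1 + A at p and 1 - A at 1 - p with A >= mu;
    moreover ln (1 + A) >= 0 and ln (1 - A) <= - A. *)
Lemma steep_bump_log_gap : mu <= ln (F1 p) - ln (F1 (1 - p)).
Proof.
have a0 : 0 <= al * bump1 1 p.
  have c0 := cpi_ge0 (ltW p0) (ltW p_lt).
  have s0 : 0 <= spi p by apply: spi_ge0; move: p0 p_lt; lra.
  by rewrite mulr_ge0 ?(ltW al0)// mulr_ge0 ?exprn_ge0// mulr_ge0// mulr_ge0// ltW.
have e1 : F1 p = 1 + (al * bump1 1 p + mu) by rewrite /bump_map1 beM addrA.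
have e2 : F1 (1 - p) = 1 + - (al * bump1 1 p + mu).
  by rewrite /bump_map1 !bump1_onem !mulrN beM; ring.
have h2 := steep_bump_derive_ge (1 - p).
rewrite e1 e2; rewrite e2 in h2.
set A := al * bump1 1 p + mu in h2 *.
have Amu : mu <= A by rewrite lerDr.
have g1 : 0 <= ln (1 + A) by rewrite ln_ge0// lerDl (le_trans _ Amu)// ltW.
have g2 : ln (1 + - A) <= - A by apply: le_ln1Dx; lra.
lra.
Qed.

(** Near 1/2 one has cos^2 <= 1/16, hence sin^4 >= 1/2, and the wide bump alone moves x by al /
    2. *)
Lemma steep_bump_displacement (x : R) : `|x - 2^-1| <= theta -> x + 4 * theta <= F x.
Proof.
move=> xt.
have cl : `|cpi x| <= pi * `|x - 2^-1|.
  rewrite -[cpi x]subr0 -(cpi_half R); apply: lipschitz_of_derive1 => [y|y].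
    by case: (is_derive_cpi y).
  have -> : derive1 (@cpi R) y = - (pi * spi y).
    by rewrite derive1E; apply: derive_val; exact: is_derive_cpi.
  rewrite normrN normrM gtr0_norm//.
  by apply: ler_piMr; [exact: ltW|exact: spi_le1].
have cs : `|cpi x| <= 4^-1.
  apply: le_trans cl _; apply: le_trans (_ : pi * theta <= _).
    by apply: ler_wpM2l => //; exact: ltW.
  by have := al_pi; have := mu_le; lra.
have c2 : cpi x ^+ 2 <= 16^-1.
  by move: cs; rewrite ler_norml => /andP[]; nra.
have s2 := cpi2Dspi2 x.
have b1 : 2^-1 <= bump 1 x.
  have -> : bump 1 x = (spi x ^+ 2) ^+ 2 by rewrite -exprM.
  nra.
have b2 := bump_ge0 k x.
have h1 : al * 2^-1 <= al * bump 1 x by apply: ler_wpM2l => //; exact: ltW.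
have h2 : 0 <= be * bump k x by rewrite mulr_ge0// ltW.
rewrite /bump_map; lra.
Qed.

(** Here |F2| <= mu / 8 + be / 8 <= mu / 4, and [ln] is 2-Lipschitz above 1/2. *)
Lemma steep_bump_log_lipschitz (x y : R) : 0 <= x -> x <= y -> y <= 1 ->
  (forall z, x <= z <= y -> theta <= `|z - 2^-1|) ->
  `|ln (F1 x) - ln (F1 y)| <= mu / 2 * (y - x).
Proof.
move=> x0 xy y1 away.
have [z zxy e] : exists2 z, z \in `[x, y] & F1 y - F1 x = F2 z * (y - x).
  apply: (@MVT_segment R F1 F2) xy _ _ => [z _|]; first exact: is_derive_bump_map1.
  apply: continuous_subspaceT => z; apply: differentiable_continuous.
  by apply/derivable1_diffP; exact: derivable_bump_map1.
move: zxy; rewrite in_itv /= => zxy; have tz := away z zxy; case/andP: zxy => xz zy.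
have z01 : 0 <= z <= 1 by rewrite (le_trans x0 xz) (le_trans zy y1).
have F2z : `|F2 z| <= mu / 4.
  have h : be * `|bump2 k z| <= mu * 8^-1 by rewrite ler_pM ?small// ltW.
  by have := norm_bump_map2_le z; lra.
have half0 : 0 < 2^-1 :> R by rewrite invr_gt0.
have := lipschitz_ln half0 (steep_bump_derive_ge x) (steep_bump_derive_ge y).
rewrite invrK (distrC (F1 x)) e normrM => h; apply: le_trans h _.
have yx : 0 <= y - x by rewrite subr_ge0.
by rewrite (ger0_norm yx); have := ler_wpM2r yx F2z; lra.
Qed.

(** p and 1 - p lie within theta of 1/2, so F p is beyond 1/2 + theta and G (1 - p) before 1/2 -
    theta; the orbit estimate applies with eta = mu. *)
Lemma steep_bump_orbit_growth (G : R -> R) (N : nat) : 2^-1 - theta <= p -> theta < 2^-1 ->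
  cancel F G -> cancel G F -> {homo F : x y / x < y} -> {homo G : x y / x < y} ->
  ((mu / 2 * N%:R)%:E
     <= total_variation 0 1 (fun x => (\sum_(i < N) ln (F1 (iter i F x)))%R))%E.
Proof.
move=> pt t12 FK GK incF incG.
have th0 : 0 < theta by rewrite divr_gt0.
have p1 := p0; have p2 := p_lt.
have Fp : 2^-1 + theta < F p.
  apply: lt_le_trans (steep_bump_displacement _); first lra.
  by rewrite ler_norml; lra.
have Gq : G (1 - p) <= 2^-1 - theta.
  rewrite -[leRHS]FK (le_mono incG).
  apply: le_trans (steep_bump_displacement _); first lra.
  by rewrite ler_norml; lra.
have away (x y z : R) : x <= z <= y -> y <= 2^-1 - theta \/ 2^-1 + theta <= x ->
    theta <= `|z - 2^-1|.
  by move=> /andP[xz zy] h; rewrite ler_normr; case: h => h; apply/orP; [right|left]; lra.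
apply: (@total_variation_orbit_ge R (fun x => ln (F1 x)) F G p (1 - p)) => //.
- exact: bump_map0.
- exact: bump_map_1.
- lra.
- lra.
- lra.
- exact: ltW.
- exact: steep_bump_log_gap.
- move=> x y Fx xy y1; apply: steep_bump_log_lipschitz => //; first lra.
  by move=> z xzy; apply: (away x y) => //; right; lra.
- move=> x y x0 xy yG; apply: steep_bump_log_lipschitz => //; first lra.
  by move=> z xzy; apply: (away x y) => //; left; lra.
Qed.
End steep_bump.

(** * The fixed point, the integral of the second derivative, and the conclusion *)

Lemma spi_gt0 (R : realType) (x : R) : 0 < x -> x < 1 -> 0 < spi x.
Proof.
move=> x0 x1; have p0 := pi_gt0 R; rewrite /spi; apply: sin_gt0_pi.
by rewrite mulr_gt0//= gtr_pMr.
Qed.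

(** F maps [0, 1) to itself, so a fixed point of the circle map is one of F without integer shift;
    and F x > x on (0, 1), where the wide bump is positive. *)
Lemma bump_map_fixed (R : realType) (al be : R) (k : nat) : 0 < al -> 0 <= be ->
  {homo bump_map al be k : x y / x < y} ->
  [set z | circle_map (bump_map al be k) z = z] = [set to_circle 0].
Proof.
move=> al0 be0 incF; set F := bump_map al be k.
have s0 : sval (to_circle (0 : R)) = 0 by rewrite /= floor0 subrr.
apply/seteqP; split => z /=; last first.
  by move=> ->; rewrite /circle_map s0 /F bump_map0.
case: z => [x x01] fx.
have [x0 x1] := andP x01.
have Fx : F x - (Num.floor (F x))%:~R = x := congr1 sval fx.
have F0 : F 0 = 0 := bump_map0 al be k; have F1 : F 1 = 1 := bump_map_1 al be k.
have Fx01 : 0 <= F x < 1 by rewrite -{1}F0 -F1 (le_mono incF) x0 incF.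
move: Fx; rewrite (floor_def (m := 0)) ?Fx01// subr0 => Fx.
apply: val_inj; rewrite /= floor0 subr0; apply/eqP; rewrite eq_le x0 andbT leNgt.
apply/negP => xp.
have b1 : 0 < al * bump 1 x by rewrite mulr_gt0// exprn_gt0// spi_gt0.
have b2 : 0 <= be * bump k x by rewrite mulr_ge0// bump_ge0.
by move: Fx; rewrite /F /bump_map; lra.
Qed.

Lemma norm_integral_le_affine (R : realType) (u v : R -> R) (b c : R) :
  continuous u -> continuous v -> (forall x, `|u x| <= c + b * `|v x|) ->
  (\int[lebesgue_measure]_(x in `[0%R, 1%R]) `|u x|%:E
     <= (c + b * \int[lebesgue_measure]_(x in `[0, 1]) `|v x|)%:E)%E.
Proof.
move=> cu cv uv.
have int (g : R -> R) : continuous g -> (@lebesgue_measure R).-integrable `[0, 1] (EFin \o g).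
  by move=> cg; apply: continuous_compact_integrable;
    [exact: segment_compact|exact: continuous_subspaceT].
have cn (g : R -> R) : continuous g -> continuous (fun x => `|g x|).
  by move=> cg x; apply: cvg_norm; exact: cg.
have iv := int _ (cn _ cv); have iu := int _ (cn _ cu).
have ibv : (@lebesgue_measure R).-integrable `[0, 1] (EFin \o (fun x => b * `|v x|)).
  by apply: int => x; apply: cvgM; [exact: cvg_cst|exact: (cn _ cv)].
have ic : (@lebesgue_measure R).-integrable `[0, 1] (EFin \o (fun _ : R => c)).
  by apply: int => x; exact: cvg_cst.
have m1 : fine (@lebesgue_measure R `[0, 1]%classic) = 1.
  by rewrite lebesgue_measure_itv /= lte_fin ltr01 oppr0 adde0.
have <- : \int[lebesgue_measure]_(x in `[0, 1]) (c + b * `|v x|) =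
    c + b * \int[lebesgue_measure]_(x in `[0, 1]) `|v x|.
  rewrite RintegralD//; rewrite RintegralZl//; rewrite Rintegral_cst//.
  by rewrite [fine _]m1 mulr1.
rewrite -[leLHS]fineK; last exact: (integrable_fin_num _ iu).
rewrite lee_fin; apply: le_Rintegral => //.
by apply: int => x; apply: cvgD; [exact: cvg_cst|apply: cvgM; [exact: cvg_cst|exact: (cn _ cv)]].
Qed.

Theorem theorem1p4 (R : realType) (K : R) (hK0 : 0 < K) (hK2 : K <= 2) :
  exists f : circle R -> circle R,
    [/\ analytic_diffeo f,
        exists x0 : circle R,
          [/\ [set x | f x = x] = [set x0],
              circle_deriv f (sval x0) = 1 &
              circle_deriv2 f (sval x0) = 0],
        (\int[lebesgue_measure]_(x in `[0%R, 1%R]) `|circle_deriv2 f x|%:E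
           <= (2 * K)%:E)%E &
        C1AC_undistorted f].
Proof.
(* K <= 2 gives mu <= 1/4, which the bound F' >= 1/2 uses, and mu / 8 + 4 * mu <= 2 * K bounds the
   integral. *)
pose mu : R := K / 8.
have mu0 : 0 < mu by rewrite /mu; lra.
have mu_le : mu <= 4^-1 by rewrite /mu; lra.
have pi0 := pi_gt0 R; have pi2 := pi_ge2 R.
(* 16 * pi^2 bounds the second derivative of sin (pi x)^4, so the wide bump contributes at most mu /
   8 to |F''|. *)
pose al : R := mu / (128 * pi ^+ 2).
have al0 : 0 < al by rewrite divr_gt0// mulr_gt0// exprn_gt0.
have al_pi2 : al * (16 * pi ^+ 2) = mu / 8.
  have pn : pi != 0 :> R by rewrite gt_eqF.
  by rewrite /al; move: (pi : R) pn => c c0; field.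
have th0 : 0 < al / 8 by rewrite divr_gt0.
have th1 : al / 8 < 2^-1.
  have al1 : al <= al * (16 * pi ^+ 2) by rewrite ler_peMr ?(ltW al0)//; nra.
  by clearbody al mu; lra.
have e0 : 0 < 8^-1 :> R by rewrite invr_gt0.
have [k [p [k0 [p0 /andP[pt p12]] M1 bM [intM small]]]] := exists_bump th0 th1 e0.
have M0 : 0 < bump1 k p by exact: lt_le_trans M1.
(* Normalises the maximal slope of the narrow bump to mu, so that its second derivative has integral
   4 * mu in absolute value whatever k is. *)
pose be := mu / bump1 k p.
have be0 : 0 < be by rewrite divr_gt0.
have beM : be * bump1 k p = mu by rewrite divfK// gt_eqF.
have muK : mu / 8 + 4 * mu <= 2 * K by rewrite /mu; lra.
clearbody be al mu.
pose F := bump_map al be k.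
have F1h := steep_bump_derive_ge mu0 mu_le al0 al_pi2 M1 bM beM.
have [G [FK GK incF incG [G1 dG]]] := bump_map_inverse F1h.
have F1E : derive1 F = bump_map1 al be k := derive1_bump_map al be k.
have cF : C11 F := C11_bump_map al be k.
have cG : C11 G by apply: (C11_inverse cF); rewrite F1E.
have dF : forall x : R, derivable F x 1 := cF.1.
have contF : continuous F.
  by move=> x; apply/differentiable_continuous/derivable1_diffP; case: cF.
have contG : continuous G.
  by move=> x; apply/differentiable_continuous/derivable1_diffP; case: cG.
have F_1 := bump_map_addr1 al be k.
have lF : is_lift F (circle_map F) by exact: is_lift_circle_map.
have lG : is_lift G (circle_map G) by exact: is_lift_circle_map.
have fK : cancel (circle_map F) (circle_map G) by exact: circle_map_can.
have gK : cancel (circle_map G) (circle_map F) by exact: circle_map_can.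
have F10 x : 0 < derive1 F x by rewrite F1E; apply: lt_le_trans (F1h x).
have d1 : circle_deriv (circle_map F) = bump_map1 al be k by rewrite (circle_derivE lF).
have d2 : circle_deriv2 (circle_map F) = bump_map2 al be k.
  by rewrite /circle_deriv2 d1 derive1_bump_map1.
have Df n : Diff1AC (iter n (circle_map F)) := Diff1AC_iter n fK gK lF lG incF cF cG.
have Dg n : Diff1AC (iter n (circle_map G)) := Diff1AC_iter n gK fK lG lF incG cG cF.
have lD n : log_deriv (iter n (circle_map F)) \- log_deriv id =
    fun x => \sum_(i < n) ln (bump_map1 al be k (iter i F x)).
  have := log_deriv_iter_sub_id n lF dF F10; rewrite F1E; exact.
have growth n : mu / 2 * n%:R <= log_variation (iter n (circle_map F)) id.
  rewrite /log_variation -lee_fin fineK; last exact: log_variation_fin_num (Df n) (Df 0%N).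
  rewrite lD.
  exact: (steep_bump_orbit_growth mu0 mu_le p0 p12 al0 al_pi2 M1 bM beM small).
have c0 : 0 < mu / 2 by rewrite divr_gt0.
exists (circle_map F); split.
- exists (circle_map G), F, G; split; split => //.
    exact: bump_map_analytic.
  exact: (bump_map_inverse_analytic F1h dG).
- exists (to_circle 0); split; first exact: (bump_map_fixed al0 (ltW be0) incF).
    by rewrite d1 /= floor0 subrr bump_map10.
  by rewrite d2 /= floor0 subrr bump_map20.
- rewrite d2.
  have F2le := norm_bump_map2_le mu0 al0 al_pi2 M1 beM.
  have := norm_integral_le_affine (@bump_map2_continuous R al be k) (@bump2_continuous R k) F2le.
  by rewrite intM mulrCA beM => h; apply: (le_trans h); rewrite lee_fin.
- split; first exact: (Df 1%N).
  case; first exact: (undistorted_of_growth fK gK Df Dg c0 growth).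
  exact: (growth_not_torsion Df c0 growth).
Qed.
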